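(* There exists a function $C:[0,\infty)\times[0,\infty)\times(0,\infty)\to(0,\infty)$ such that the following holds. Let $R>0$, let $B_R(0)\subset\mathbb{R}^2$ be the open ball of radius $R$ centered at the origin, and let $\Theta\in C^2(B_R(0))$ satisfy $-\pi<\Theta<\pi$ in $B_R(0)$ and $D\Theta(x)=0$ for every $x\in B_R(0)$ with $\Theta(x)=0$. Let $u$ be a smooth real-valued function on $B_R(0)$ solving $$\arctan\lambda_1(x)+\arctan\lambda_2(x)=\Theta(x)\quad\text{in } B_R(0),$$ where $\lambda_1(x),\lambda_2(x)$ are the eigenvalues of the Hessian $D^2u(x)$. Then $$|D^2u(0)|\le C\big(\|u\|_{C^1(B_R(0))},\ \|\Theta\|_{C^2(B_R(0))},\ R\big).$$
   Context: The norms $\|u\|_{C^1(B_R(0))}$ and $\|\Theta\|_{C^2(B_R(0))}$ are the usual sup-norms of the function and its derivatives up to order 1, respectively 2, over the ball; the estimate is understood for finite norms (it is vacuous if one of them is infinite). *)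

(* Defs.v *)
From HB Require Import structures.
From mathcomp Require Import all_boot all_order all_algebra.
From mathcomp Require Import all_classical all_reals all_analysis.

Set Implicit Arguments.
Unset Strict Implicit.
Unset Printing Implicit Defensive.

Import Order.TTheory GRing.Theory Num.Theory.
Import numFieldNormedType.Exports.

Local Open Scope classical_set_scope.
Local Open Scope ring_scope.

(* The library's norm on matrices is the max norm; the ball of the statement
   and the size of Du, D^2 u use the Euclidean (Frobenius) norm instead. *)
Definition enorm (R : realType) (m n : nat) (A : 'M[R]_(m, n)) : R :=
  Num.sqrt (\sum_i \sum_j A i j ^+ 2).

Definition eball (R : realType) (n : nat) (r : R) : set 'rV[R]_n :=
  [set x | enorm x < r].

Definition partial (R : realType) (n : nat) (i : 'I_n.+1)
    (f : 'rV[R]_n.+1 -> R) (x : 'rV[R]_n.+1) : R :=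
  'D_(delta_mx 0 i) f x.

Definition grad (R : realType) (n : nat) (f : 'rV[R]_n.+1 -> R)
    (x : 'rV[R]_n.+1) : 'rV[R]_n.+1 :=
  \row_i partial i f x.

Definition hessian (R : realType) (n : nat) (f : 'rV[R]_n.+1 -> R)
    (x : 'rV[R]_n.+1) : 'M[R]_n.+1 :=
  \matrix_(i, j) partial j (partial i f) x.

(* Meant for open U: then only the values of f on U matter, and
   C_class k U f says that f is of class C^k on U. *)
Fixpoint C_class (R : realType) (n : nat) (k : nat) (U : set 'rV[R]_n.+1)
    (f : 'rV[R]_n.+1 -> R) : Prop :=
  match k with
  | 0 => forall x, U x -> {for x, continuous f}
  | k'.+1 => (forall x, U x -> differentiable f x) /\
             (forall i, C_class k' U (partial i f))
  end.

Definition smooth (R : realType) (n : nat) (U : set 'rV[R]_n.+1)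
    (f : 'rV[R]_n.+1 -> R) : Prop :=
  forall k, C_class k U f.

(* Supremum over a nonempty U, equal to +oo when F is unbounded on U. *)
Definition sup_norm (R : realType) (n p q : nat) (U : set 'rV[R]_n)
    (F : 'rV[R]_n -> 'M[R]_(p, q)) : \bar R :=
  ereal_sup [set (enorm (F x))%:E | x in U].

Definition C1_norm (R : realType) (n : nat) (U : set 'rV[R]_n.+1)
    (f : 'rV[R]_n.+1 -> R) : \bar R :=
  (ereal_sup [set `|f x|%:E | x in U] + sup_norm U (grad f))%E.

Definition C2_norm (R : realType) (n : nat) (U : set 'rV[R]_n.+1)
    (f : 'rV[R]_n.+1 -> R) : \bar R :=
  (C1_norm U f + sup_norm U (hessian f))%E.

(* Main.v *)
(* The Hessian is written through its trace and its Hopf part G = (u_11 - u_22)/2 - i u_12.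
   With e = tan (Theta / 2), w = G / (1 + e (Laplacian u) / 2), zeta = e w, d = d_1 - i d_2
   and db = d_1 + i d_2, the equation becomes |zeta| < 1 together with the first-order system
     db w - conj(zeta) d w = (1 + |w|^2) (dTheta - zeta dbTheta) / 2,
   and (Laplacian u) / 2 = e (1 + |w|^2) / (1 - |zeta|^2). So it suffices to bound e and w
   from above and 1 - |zeta| from below at the origin, which takes three steps.
   - A maximum of (1 + |w|^2) (rho^2 - |x|^2)^2 exp |Du|^2 gives the bound on w: where |w| is
     large, |Theta| is small, and so is D Theta, because D Theta vanishes on Theta = 0.
   - If |Theta| were close to pi, both eigenvalues would be large on a whole segment,
     contradicting the bound on Du; so |e| is bounded.
   - If |e(0)| is small then so is |zeta(0)|. Otherwise |e| is bounded below near 0; put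
     alpha = zeta(0)/|zeta(0)| and gamma^2 = alpha. With cutoffs in Re (gamma x) and
     Im (gamma x), where x = x_1 + i x_2, a maximum of
       cutoffs^12 exp (m y^2 / 2) / (1 - Re (conj(alpha) zeta)), y = Re (gamma (u_1 + i u_2)),
     gives a lower bound for 1 - |zeta(0)|: near zeta = alpha the operator db - conj(zeta) d
     sends y to e + 1/e up to a phase, and a large weight m makes this dominate. *)

Require Import Defs.
From HB Require Import structures.
From mathcomp Require Import all_boot all_order all_algebra.
From mathcomp Require Import all_classical all_reals all_analysis.
From mathcomp Require Import ring lra.
Import Order.TTheory GRing.Theory Num.Theory.
Import numFieldNormedType.Exports.
From mathcomp Require Import complex.
Local Open Scope classical_set_scope.
Local Open Scope ring_scope.

Set Implicit Arguments.
Unset Strict Implicit.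
Unset Printing Implicit Defensive.

(** * Functions of class C^k *)

(** The modulus of [w] is the tangent of half the difference of the two arctangents, as [e] is that
    of half their sum. So [|zeta| < 1] only says that both angles stay below pi / 2 in modulus, and
    all relations become rational in [e] and [w]. The first-order system bounds one complex
    derivative of [w] or [zeta] by first derivatives of the phase; the other is recovered from the
    gradient of one factor of the test function, which at a maximum is balanced by the gradients of
    the other factors. The obstacle is that ellipticity is lost as [|zeta|] tends to 1. Near
    [zeta = alpha] the operator almost annihilates Re (gamma x), but not Im (gamma x), and the cost
    of the cutoff in the latter has to be absorbed. The square of the logarithmic gradient does
    this: there the cutoff contributes in a nearly imaginary and [y] in a nearly real direction, so
    neither can cancel the other. With exponent N the cutoff yields 6 N^2 and costs 72 N multiples
    of the same quantity, whence the exponent 12. *)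

Section DifferentiableNear.
Context (R : realType) (V W : normedModType R).

Lemma near_eq_differentiable (f g : V -> W) (x : V) :
  (\forall y \near x, f y = g y) -> differentiable f x -> differentiable g x.
Proof.
move=> fg df.
have fgx : f x = g x by exact: (nbhs_singleton fg).
have [cd /eqaddoP Hf] := (diff_locallyP x f).1 df.
have Hg : g \o shift x = cst (g x) + 'd f x +o_ 0 id.
  apply/eqaddoP => e e0.
  have fg0 : \forall y \near (0:V), f (y + x) = g (y + x).
    by move: fg; rewrite (near_shift 0)/= subr0.
  apply: filterS2 fg0 (Hf e e0) => y E.
  suff -> : (f \o shift x - (cst (f x) + 'd f x)) y =
            (g \o shift x - (cst (g x) + 'd f x)) y by [].
  by rewrite !fctE /= E fgx.
apply/diff_locallyP; have E := diff_unique cd Hg; rewrite E; split => //.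
Qed.

End DifferentiableNear.

Section Partial.
Context (R : realType) (n : nat).
Implicit Types (f g : 'rV[R]_n.+1 -> R) (U : set 'rV[R]_n.+1) (i j : 'I_n.+1) (x y : 'rV[R]_n.+1) (k : nat).

Lemma enorm_ge0 m p (A : 'M[R]_(m, p)) : 0 <= enorm A.
Proof. exact: sqrtr_ge0. Qed.

Lemma continuous_enorm : continuous (@enorm R 1 n.+1).
Proof.
move=> x; rewrite /enorm; apply: continuous_comp; last exact: sqrt_continuous.
have H m (F : 'I_m -> 'rV[R]_n.+1 -> R) : (forall l, {for x, continuous (F l)}) ->
   {for x, continuous (fun y => \sum_l F l y)}.
  move=> HF; have -> : (fun y => \sum_l F l y) = \sum_l F l.
    by apply/funext => y; rewrite fct_sumE.
  apply: (big_ind (fun g : 'rV[R]_n.+1 -> R => {for x, continuous g})) => //.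
    exact: cst_continuous.
  by move=> f g; exact: continuousD.
apply: (H) => a; apply: H => b.
apply: (@continuous_comp _ _ _ (fun y : 'rV[R]_n.+1 => y a b) (fun z => z ^+ 2)).
  exact: coord_continuous.
exact: exprn_continuous.
Qed.

Lemma open_eball (r : R) : open (@eball R n.+1 r).
Proof.
have -> : @eball R n.+1 r = (@enorm R 1 n.+1) @^-1` [set y | y < r] by [].
apply: open_comp; last exact: open_lt.
by move=> x _; exact: continuous_enorm.
Qed.

Lemma near_eq_partial i f g x :
  (\forall y \near x, f y = g y) -> partial i f x = partial i g x.
Proof. exact: near_eq_derive. Qed.

Lemma eq_partial U i f g : open U -> (forall y, U y -> f y = g y) ->
  forall x, U x -> partial i f x = partial i g x.
Proof.
move=> oU fg x Ux; apply: near_eq_partial.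
by move: (open_nbhs_nbhs (conj oU Ux)); apply: filterS.
Qed.

(** Rules for partial derivatives hold only where the functions are differentiable, that is, on [U].
    This transfer along equality on [U] lets each closure property below end with a pointwise
    identity there. *)
Lemma C_class_ext k U f g : open U -> (forall y, U y -> f y = g y) ->
  C_class k U f -> C_class k U g.
Proof.
elim: k f g => [|k IH] f g oU fg /=.
  move=> cf x Ux; have := cf _ Ux.
  have xU := open_nbhs_nbhs (conj oU Ux).
  rewrite /prop_for /continuous_at -(fg _ Ux); apply: cvg_trans.
  have E : \forall y \near x, f y = g y by apply: filterS xU => y /fg.
  exact: near_eq_cvg E.
move=> [df pf]; split=> [x Ux|i].
  apply: (near_eq_differentiable _ (df _ Ux)).
  by move: (open_nbhs_nbhs (conj oU Ux)); apply: filterS => y /fg.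
apply: (IH _ _ oU _ (pf i)); exact: eq_partial.
Qed.

Lemma C_class_sub k U U' f : (forall x, U' x -> U x) -> C_class k U f -> C_class k U' f.
Proof.
elim: k f => [|k IH] f UU' /=; first by move=> cf x /UU'; exact: cf.
move=> [df pf]; split=> [x /UU'|i]; [exact: df|exact: IH].
Qed.

Lemma C_class_continuous k U f x : C_class k U f -> U x -> {for x, continuous f}.
Proof.
case: k => [|k] /=; first by move=> cf; exact: cf.
by move=> [df _] /df; exact: differentiable_continuous.
Qed.

Lemma C_classW k U f : C_class k.+1 U f -> C_class k U f.
Proof.
elim: k f => [|k IH] f; first by move=> cf x; exact: (C_class_continuous cf).
by move=> [df pf]; split=> // i; apply: IH.
Qed.

Lemma C_class_le k l U f : (k <= l)%N -> C_class l U f -> C_class k U f.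
Proof.
elim: l => [|l IH]; first by rewrite leqn0 => /eqP->.
by rewrite leq_eqVlt => /orP[/eqP->//|/IH H] /C_classW; exact: H.
Qed.

Lemma partial_cst i (a : R) x : partial i (fun=> a) x = 0.
Proof. exact: derive_cst. Qed.

Lemma partialD i f g x : differentiable f x -> differentiable g x ->
  partial i (fun y => f y + g y) x = partial i f x + partial i g x.
Proof. by move=> df dg; rewrite /partial deriveD//; exact: diff_derivable. Qed.

Lemma partialN i f x : differentiable f x ->
  partial i (fun y => - f y) x = - partial i f x.
Proof. by move=> df; rewrite /partial deriveN//; exact: diff_derivable. Qed.

Lemma partialM i f g x : differentiable f x -> differentiable g x ->
  partial i (fun y => f y * g y) x = partial i f x * g x + f x * partial i g x.
Proof.
move=> df dg; rewrite /partial deriveM; try exact: diff_derivable.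
by rewrite -![_ *: _]/(_ * _) addrC mulrC.
Qed.

Lemma partialV i f x : differentiable f x -> f x != 0 ->
  partial i (fun y => (f y)^-1) x = - partial i f x * (f x)^-1 * (f x)^-1.
Proof.
move=> df f0; rewrite /partial deriveV//; last exact: diff_derivable.
by rewrite -[_ *: _]/(_ * _) -exprVn expr2; ring.
Qed.

Lemma partial_comp i (h : R -> R) (dh : R) f x : differentiable f x ->
  is_derive (f x) 1 h dh -> partial i (fun y => h (f y)) x = dh * partial i f x.
Proof.
move=> df [dhx <-]; have dh' := (derivable1_diffP h (f x)).1 dhx.
rewrite /partial deriveE; last exact: (differentiable_comp df dh').
rewrite -[fun y => _]/(h \o f) (diff_comp df dh')/= -(deriveE _ df).
rewrite -derive1E derive1E'//.
by rewrite -[X in 'd h _ X]mulr1 -[X in 'd h _ X]/(_ *: 1) linearZ/= mulrC.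
Qed.

Lemma partial_coord i j x : partial i (fun y : 'rV[R]_n.+1 => y 0 j) x = (i == j)%:R.
Proof.
have @f : {linear 'rV[R]_n.+1 -> R}.
  by exists (fun N : 'rV[R]_n.+1 => N 0 j); do 2![eexists]; do ?[constructor];
     rewrite ?mxE// => ? *; rewrite ?mxE//; move=> ?; rewrite !mxE.
rewrite /partial deriveE; last exact: differentiable_coord.
rewrite (_ : (fun _ => _) = f) // diff_lin; last exact: coord_continuous.
by rewrite /= mxE eqxx/= eq_sym.
Qed.

Lemma C_class_cst k U a : C_class k U (fun=> a).
Proof.
elim: k a => [|k IH] a /=; first by move=> x _; exact: cst_continuous.
split=> [x _|i]; first exact: differentiable_cst.
by rewrite (_ : partial i _ = fun=> 0)//; apply/funext => x; exact: partial_cst.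
Qed.

Lemma C_class_coord k U j : C_class k U (fun y => y 0 j).
Proof.
case: k => [|k] /=; first by move=> x _; exact: coord_continuous.
split=> [x _|i]; first exact: differentiable_coord.
rewrite (_ : partial i _ = fun=> (i == j)%:R); first exact: C_class_cst.
by apply/funext => x; exact: partial_coord.
Qed.

Lemma C_classD k U f g : open U -> C_class k U f -> C_class k U g ->
  C_class k U (fun y => f y + g y).
Proof.
move=> oU; elim: k f g => [|k IH] f g /=.
  by move=> cf cg x Ux; apply: continuousD; [exact: cf|exact: cg].
move=> [df pf] [dg pg]; split=> [x Ux|i].
  by apply: differentiableD; [exact: df|exact: dg].
apply: (C_class_ext oU _ (IH _ _ (pf i) (pg i))) => x Ux.
by rewrite partialD//; [exact: df|exact: dg].
Qed.

Lemma C_classN k U f : open U -> C_class k U f -> C_class k U (fun y => - f y).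
Proof.
move=> oU; elim: k f => [|k IH] f /=.
  by move=> cf x Ux; apply: continuousN; exact: cf.
move=> [df pf]; split=> [x Ux|i]; first by apply: differentiableN; exact: df.
apply: (C_class_ext oU _ (IH _ (pf i))) => x Ux.
by rewrite partialN//; exact: df.
Qed.

Lemma C_classB k U f g : open U -> C_class k U f -> C_class k U g ->
  C_class k U (fun y => f y - g y).
Proof. by move=> oU cf cg; apply: C_classD => //; exact: C_classN. Qed.

Lemma C_classM k U f g : open U -> C_class k U f -> C_class k U g ->
  C_class k U (fun y => f y * g y).
Proof.
move=> oU; elim: k f g => [|k IH] f g.
  by move=> cf cg x Ux; apply: continuousM; [exact: cf|exact: cg].
move=> cf cg; have [df pf] := cf; have [dg pg] := cg; split=> [x Ux|i].
  by apply: differentiableM; [exact: df|exact: dg].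
have H := C_classD oU (IH _ _ (pf i) (C_classW cg)) (IH _ _ (C_classW cf) (pg i)).
apply: (C_class_ext oU _ H) => x Ux.
by rewrite partialM//; [exact: df|exact: dg].
Qed.

Lemma C_classV k U f : open U -> (forall x, U x -> f x != 0) -> C_class k U f ->
  C_class k U (fun y => (f y)^-1).
Proof.
move=> oU f0; elim: k => [|k IH].
  by move=> cf x Ux; apply: continuousV; [exact: f0|exact: cf].
move=> cf; have [df pf] := cf; split=> [x Ux|i].
  by apply: differentiableV; [exact: df|exact: f0].
have Hi := IH (C_classW cf).
have H := C_classM oU (C_classM oU (C_classN oU (pf i)) Hi) Hi.
apply: (C_class_ext oU _ H) => x Ux.
by rewrite partialV//; [exact: df|exact: f0].
Qed.

Lemma differentiable_comp1 (h : R -> R) (dh : R) f x : differentiable f x ->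
  is_derive (f x) 1 h dh -> differentiable (fun y => h (f y)) x.
Proof.
move=> df [dhx _]; apply: (@differentiable_comp _ _ _ _ f h) => //.
exact/derivable1_diffP.
Qed.

Lemma C_class_ln k U f : open U -> (forall x, U x -> 0 < f x) -> C_class k U f ->
  C_class k U (fun y => ln (f y)).
Proof.
move=> oU f0; case: k => [|k] cf.
  move=> x Ux; apply: (@continuous_comp _ _ _ f (@ln R)); first exact: cf.
  by apply: continuous_ln; exact: f0.
have [df pf] := cf; split=> [x Ux|i].
  by apply: (differentiable_comp1 (df _ Ux)); apply: is_derive1_ln; exact: f0.
have H := C_classM oU (C_classV oU (fun x Ux => lt0r_neq0 (f0 x Ux)) (C_classW cf)) (pf i).
apply: (C_class_ext oU _ H) => x Ux.
rewrite (partial_comp i (df _ Ux) (is_derive1_ln (f0 _ Ux)))//.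
Qed.

Lemma is_derive_tan2 (t : R) : cos (t / 2) != 0 ->
  is_derive t 1 (fun s => tan (s / 2)) ((1 + tan (t / 2) ^+ 2) / 2).
Proof.
move=> c0; have H1 : is_derive t 1 (fun s : R => s / 2) (2^-1).
  rewrite (_ : (fun s => s / 2) = (fun s : R => 2^-1 *: s)); last first.
    by apply/funext => s; rewrite mulrC.
  by apply: is_derive_eq; rewrite -[_ *: _]/(_ * _) mulr1.
have H2 := is_derive_tan c0; rewrite cos2_tan2// in H2.
apply: DeriveDef.
  apply/derivable1_diffP; apply: (@differentiable_comp _ _ _ _ (fun s : R => s/2) (@tan R)).
    by apply/derivable1_diffP; exact: ex_derive.
  by apply/derivable1_diffP; exact: ex_derive.
rewrite -derive1E (@derive1_comp _ (fun s : R => s/2) (@tan R)); try exact: ex_derive.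
by rewrite !derive1E !derive_val.
Qed.

(** The derivative of [tan (s / 2)] is a polynomial in [tan (s / 2)] itself, so the induction
    hypothesis already covers the factor produced by the chain rule. *)
Lemma C_class_tan2 k U f : open U -> (forall x, U x -> cos (f x / 2) != 0) ->
  C_class k U f -> C_class k U (fun y => tan (f y / 2)).
Proof.
move=> oU f0; elim: k => [|k IH] cf.
  move=> x Ux; apply: (@continuous_comp _ _ _ (fun y => f y / 2) (@tan R)).
    apply: (@continuousM _ _ f (fun=> 2^-1)); [exact: cf|exact: cst_continuous].
  by apply: continuous_tan; exact: f0.
have [df pf] := cf; split=> [x Ux|i].
  exact: (differentiable_comp1 (h := fun s => tan (s / 2)) (df _ Ux) (is_derive_tan2 (f0 _ Ux))).
have Ht := IH (C_classW cf).
have H := C_classM oU (C_classM oU (C_classD oU (C_class_cst k U 1)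
  (C_classM oU Ht Ht)) (C_class_cst k U 2^-1)) (pf i).
apply: (C_class_ext oU _ H) => x Ux.
have -> := partial_comp (h := fun s => tan (s / 2)) i (df _ Ux) (is_derive_tan2 (f0 _ Ux)).
by rewrite expr2.
Qed.

End Partial.

(** * Second order conditions and symmetry of second derivatives *)

Section OneVariable.
Context (R : realType).

(** If [l] were positive, the difference quotient of [h] at 0 would make [h] positive just to the
    right of 0, and by the mean value theorem [g] would exceed [g 0] there. Only differentiability
    of [h] at 0 enters, so second derivatives need not be continuous. *)
Lemma second_derivative_at_max (g h : R -> R) (l d : R) : 0 < d ->
  (forall t : R, `|t| < d -> is_derive t (1:R) g (h t)) ->
  (forall t : R, `|t| < d -> g t <= g 0) ->
  is_derive (0:R) (1:R) h l -> h 0 = 0 /\ l <= 0.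
Proof.
move=> d0 gh gmax [hl hl'].
have H0 : h 0 = 0.
  have lt0d : `|0 : R| < d by rewrite normr0.
  have := @derive1_at_max R g (- d) d 0.
  case.
  - by rewrite -subr_ge0 opprK addr_ge0// ltW.
  - move=> t; rewrite in_itv/= -ltr_norml => td.
    exact: (@ex_derive _ _ _ _ _ _ _ (gh t td)).
  - by rewrite in_itv/= -ltr_norml.
  - by move=> t; rewrite in_itv/= -ltr_norml; exact: gmax.
  by move=> _; rewrite (@derive_val _ _ _ _ _ _ _ (gh 0 lt0d)).
split=> //; rewrite leNgt; apply/negP => l0.
have hcv : (fun t => t^-1 *: ((h \o shift 0) (t *: 1) - h 0)) @ 0^' --> l.
  by rewrite -hl'; exact: hl.
have l2 : l / 2 < l by lra.
have Hn : nbhs (0:R) (fun t : R => t != 0 ->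
    l / 2 < t^-1 *: ((h \o shift 0) (t *: 1) - h 0)) by exact: cvgr_gt l hcv _ l2.
have [e/= e0 He] := (nbhs_ballP _ _).1 Hn.
have de0 : 0 < Num.min d e / 2.
  by rewrite divr_gt0// lt_min d0 e0.
have md : Num.min d e <= d by rewrite ge_min lexx.
have me : Num.min d e <= e by rewrite ge_min lexx orbT.
have lt_d : Num.min d e / 2 < d by lra.
have lt_e : Num.min d e / 2 < e by lra.
have [||c cI] := @MVT R g h 0 (Num.min d e / 2) de0.
- move=> t; rewrite in_itv/= => /andP[t0 t1]; apply: gh.
  by rewrite gtr0_norm// (lt_trans t1).
- apply: derivable_within_continuous => t; rewrite in_itv/= => /andP[t0 t1].
  apply: (@ex_derive _ _ _ _ _ _ _ (gh t _)).
  by rewrite ger0_norm// (le_lt_trans t1).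
move=> E; move: cI; rewrite in_itv/= => /andP[c0 c1].
have : l / 2 < c^-1 *: (h (c *: 1 + 0) - h 0).
  apply: He; last by rewrite gt_eqF.
  by rewrite /ball/= sub0r normrN gtr0_norm// (lt_trans c1).
rewrite addr0 -[c *: 1]/(c * 1) mulr1 H0 subr0 -[_ *: _]/(_ * _) => hc.
have hc0 : 0 < h c.
  have : 0 < c^-1 * h c by apply: lt_trans hc; rewrite divr_gt0.
  by rewrite pmulr_rgt0// invr_gt0.
have := gmax (Num.min d e / 2); rewrite gtr0_norm// => /(_ lt_d).
by rewrite -subr_le0 E leNgt subr0 mulr_gt0.
Qed.

End OneVariable.

Section Lines.
Context (R : realType) (n : nat).
Implicit Types (f : 'rV[R]_n.+1 -> R) (U : set 'rV[R]_n.+1) (i j : 'I_n.+1) (x y a : 'rV[R]_n.+1).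

Lemma is_derive_line f a x t : differentiable f (t *: a + x) ->
  is_derive t 1 (fun s => f (s *: a + x)) ('D_a f (t *: a + x)).
Proof.
move=> df; have H := @diff_derivable _ _ _ _ _ a df.
have E : (fun h : R => h^-1 *: (((fun s => f (s *: a + x)) \o shift t) (h *: 1)
            - f (t *: a + x))) =
         (fun h : R => h^-1 *: ((f \o shift (t *: a + x)) (h *: a) - f (t *: a + x))).
  apply/funext => h /=; congr (_ *: (f _ - _)).
  by rewrite -[h *: 1]/(h * 1) mulr1 scalerDl addrA.
by split; rewrite /derivable /derive E.
Qed.

Lemma is_derive_line0 f a x : differentiable f x ->
  is_derive (0:R) (1:R) (fun s => f (s *: a + x)) ('D_a f x).
Proof.
have E : x = 0 *: a + x by rewrite scale0r add0r.
by move=> df; rewrite [X in 'D_a f X]E; apply: is_derive_line; rewrite -E.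
Qed.

Lemma derive_partial f a x : differentiable f x ->
  'D_a f x = \sum_i a 0 i * partial i f x.
Proof.
move=> df; rewrite deriveE// {1}(row_sum_delta a) linear_sum.
by apply: eq_bigr => i _; rewrite linearZ/= /partial deriveE.
Qed.

Lemma near_line U a x : open U -> U x ->
  exists2 d : R, 0 < d & forall t, `|t| < d -> U (t *: a + x).
Proof.
move=> oU Ux; have /nbhs_ballP[e /= e0 He] := open_nbhs_nbhs (conj oU Ux).
have a1 : 0 < `|a| + 1 by rewrite ltr_pwDr.
exists (e / (`|a| + 1)); first by rewrite divr_gt0.
move=> t; rewrite ltr_pdivlMr// => te; apply: He.
rewrite -ball_normE /ball_/= opprD addrCA subrr addr0 normrN normrZ.
apply: le_lt_trans te; rewrite ler_wpM2l//; lra.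
Qed.

Lemma near_box U a b x : open U -> U x ->
  exists2 d : R, 0 < d & forall s t, `|s| < d -> `|t| < d -> U (s *: a + (t *: b + x)).
Proof.
move=> oU Ux; have /nbhs_ballP[e /= e0 He] := open_nbhs_nbhs (conj oU Ux).
have a1 : 0 < `|a| + `|b| + 1 by rewrite ltr_pwDr// addr_ge0.
exists (e / (`|a| + `|b| + 1)); first by rewrite divr_gt0.
move=> s t; rewrite !ltr_pdivlMr// => se te; apply: He.
rewrite -ball_normE /ball_/= addrA opprD addrCA subrr addr0 normrN.
apply: le_lt_trans (ler_normD _ _) _; rewrite !normrZ.
have := normr_ge0 s; have := normr_ge0 t; have := normr_ge0 a; have := normr_ge0 b.
have := ltr_pwDr; nra.
Qed.

Lemma partial_max U f x : open U -> C_class 2 U f -> U x ->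
  (forall y, U y -> f y <= f x) ->
  (forall i, partial i f x = 0) /\
  forall a, \sum_i \sum_j a 0 i * a 0 j * partial j (partial i f) x <= 0.
Proof.
move=> oU [df pf] Ux fmax.
have main a : \sum_i a 0 i * partial i f x = 0 /\
    \sum_i \sum_j a 0 i * a 0 j * partial j (partial i f) x <= 0.
  have [d d0 dU] := near_line a oU Ux.
  have := @second_derivative_at_max R (fun t => f (t *: a + x))
     (fun t => \sum_i a 0 i * partial i f (t *: a + x))
     (\sum_i \sum_j a 0 i * a 0 j * partial j (partial i f) x) d d0.
  rewrite scale0r add0r; apply.
  - move=> t td; rewrite -derive_partial; last exact/df/dU.
    exact/is_derive_line/df/dU.
  - by move=> t td; exact/fmax/dU.
  - have H i : is_derive (0:R) 1 (fun t => a 0 i * partial i f (t *: a + x))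
        (\sum_j a 0 i * a 0 j * partial j (partial i f) x).
      have dpf : differentiable (partial i f) x by exact: (pf i).1.
      have Hp := is_derive_line0 a dpf; rewrite (derive_partial a dpf) in Hp.
      have -> : \sum_j a 0 i * a 0 j * partial j (partial i f) x =
         a 0 i *: \sum_j a 0 j * partial j (partial i f) x.
        by rewrite -[_ *: _]/(_ * _) mulr_sumr; apply: eq_bigr => j _; rewrite mulrA.
      exact: is_deriveZ.
    rewrite (_ : (fun t => _) = \sum_i (fun t : R => a 0 i * partial i f (t *: a + x))).
      exact: is_derive_sum.
    by apply/funext => t; rewrite fct_sumE.
split=> [i|a]; last exact: (main a).2.
have := (main (delta_mx 0 i)).1; rewrite (bigD1 i)//= mxE !eqxx mul1r.
rewrite big1 ?addr0// => j ji; rewrite mxE eqxx/= (negbTE ji) mul0r//.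
Qed.

(** Two applications of the mean value theorem, along [i] to the increment of [f] in direction [j],
    then along [j] to [partial i f]. *)
Lemma double_difference U f i j x (t : R) : 0 < t ->
  (forall s s', 0 <= s <= t -> 0 <= s' <= t ->
     U (s *: delta_mx 0 i + (s' *: delta_mx 0 j + x))) ->
  C_class 2 U f ->
  exists s s', [/\ 0 < s < t, 0 < s' < t &
    f (t *: delta_mx 0 i + (t *: delta_mx 0 j + x)) - f (t *: delta_mx 0 i + x)
      - (f (t *: delta_mx 0 j + x) - f x) =
    partial j (partial i f) (s *: delta_mx 0 i + (s' *: delta_mx 0 j + x)) * t * t].
Proof.
move=> t0 tU [df pf]; set ei := delta_mx 0 i; set ej := delta_mx 0 j.
have tt : 0 <= t <= t by rewrite lexx ltW.
have t00 : 0 <= (0:R) <= t by rewrite lexx ltW.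
have U0 s : 0 <= s <= t -> U (s *: ei + x).
  by move=> st; have := tU s 0 st t00; rewrite scale0r add0r.
have Ht s : 0 <= s <= t -> is_derive s 1
   (fun s => f (s *: ei + (t *: ej + x)) - f (s *: ei + x))
   (partial i f (s *: ei + (t *: ej + x)) - partial i f (s *: ei + x)).
  move=> st; apply: is_deriveB; apply: is_derive_line; apply: df.
    exact: tU.
  exact: U0.
have [||s sI] := MVT t0 (f := fun s => f (s *: ei + (t *: ej + x)) - f (s *: ei + x))
  (df := fun s => partial i f (s *: ei + (t *: ej + x)) - partial i f (s *: ei + x)).
- by move=> s; rewrite in_itv/= => /andP[s0 s1]; apply: Ht; rewrite !ltW.
- by apply: derivable_within_continuous => s; rewrite in_itv/= => st; exact: (@ex_derive _ _ _ _ _ _ _ (Ht s st)).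
rewrite scale0r !add0r subr0 => E1; move: sI; rewrite in_itv/= => sI.
have sI' : 0 <= s <= t by case/andP: sI => s0 s1; rewrite !ltW.
have Hs s' : 0 <= s' <= t -> is_derive s' 1
   (fun s' => partial i f (s' *: ej + (s *: ei + x)))
   (partial j (partial i f) (s' *: ej + (s *: ei + x))).
  move=> st; apply: is_derive_line; apply: (pf i).1.
  by rewrite addrCA; exact: tU.
have [||s' s'I] := MVT t0 (f := fun s' => partial i f (s' *: ej + (s *: ei + x)))
  (df := fun s' => partial j (partial i f) (s' *: ej + (s *: ei + x))).
- by move=> s'; rewrite in_itv/= => /andP[s0 s1]; apply: Hs; rewrite !ltW.
- by apply: derivable_within_continuous => s'; rewrite in_itv/= => st; exact: (@ex_derive _ _ _ _ _ _ _ (Hs s' st)).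
rewrite scale0r add0r subr0 => E2; move: s'I; rewrite in_itv/= => s'I.
exists s, s'; split=> //.
by rewrite E1 [s *: _ + (t *: _ + _)]addrCA E2 [s *: _ + (s' *: _ + _)]addrCA.
Qed.

(** Schwarz's theorem: the double difference over a small square is symmetric in [i] and [j], so
    both mixed derivatives take a common value at points as close to [x] as desired, and both are
    continuous at [x]. *)
Lemma partialC U f i j x : open U -> C_class 2 U f -> U x ->
  partial i (partial j f) x = partial j (partial i f) x.
Proof.
move=> oU cf Ux; apply/eqP; rewrite -subr_eq0 -normr_le0; apply/ler_addgt0Pr => e e0.
rewrite add0r.
have e2 : 0 < e / 2 by rewrite divr_gt0.
have [_ pf] := cf.
have ci : {for x, continuous (partial i (partial j f))}.
  exact: ((pf j).2 i _ Ux).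
have cj : {for x, continuous (partial j (partial i f))}.
  exact: ((pf i).2 j _ Ux).
have Hi : \forall y \near x, `|partial i (partial j f) x - partial i (partial j f) y| < e / 2.
  by move/cvgrPdist_lt: ci => /(_ _ e2).
have Hj : \forall y \near x, `|partial j (partial i f) x - partial j (partial i f) y| < e / 2.
  by move/cvgrPdist_lt: cj => /(_ _ e2).
have HU := open_nbhs_nbhs (conj oU Ux).
have : \forall y \near x, [/\ U y, `|partial i (partial j f) x - partial i (partial j f) y| < e / 2
   & `|partial j (partial i f) x - partial j (partial i f) y| < e / 2].
  by move: HU Hi Hj; apply: filterS3 => y.
move=> Hn; have [B [oB Bx] HB] : exists2 B, open_nbhs x B & forall y, B y -> [/\ U y, `|partial i (partial j f) x - partial i (partial j f) y| < e / 2
   & `|partial j (partial i f) x - partial j (partial i f) y| < e / 2] by move: Hn; rewrite -nbhs_nearE nbhsE.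
have [d d0 dB] := near_box (delta_mx 0 i) (delta_mx 0 j) oB Bx.
have d2 : 0 < d / 2 by rewrite divr_gt0.
have lt s : 0 <= s <= d / 2 -> `|s| < d by move=> /andP[s0 s1]; rewrite ger0_norm//; lra.
have cfB : C_class 2 B f by apply: C_class_sub cf => y /HB[].
have HB1 s s' : 0 <= s <= d/2 -> 0 <= s' <= d/2 ->
     B (s *: delta_mx 0 i + (s' *: delta_mx 0 j + x)) by move=> ? ?; apply: dB; exact: lt.
have HB2 s s' : 0 <= s <= d/2 -> 0 <= s' <= d/2 ->
     B (s *: delta_mx 0 j + (s' *: delta_mx 0 i + x)) by move=> ? ?; rewrite addrCA; exact: HB1.
have [s1 [s2 [s1I s2I E1]]] := double_difference d2 HB1 cfB.
have [s3 [s4 [s3I s4I E2]]] := double_difference d2 HB2 cfB.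
have W s : 0 < s < d/2 -> 0 <= s <= d/2 by move=> /andP[? ?]; rewrite !ltW.
have [_ _ L1] := HB _ (HB1 _ _ (W _ s1I) (W _ s2I)).
have [_ L2 _] := HB _ (HB2 _ _ (W _ s3I) (W _ s4I)).
have E : partial j (partial i f) (s1 *: delta_mx 0 i + (s2 *: delta_mx 0 j + x)) =
         partial i (partial j f) (s3 *: delta_mx 0 j + (s4 *: delta_mx 0 i + x)).
  have E0 : d / 2 *: delta_mx 0 j + (d / 2 *: delta_mx 0 i + x) =
            d / 2 *: delta_mx 0 i + (d / 2 *: delta_mx 0 j + x) :> 'rV[R]_n.+1 by exact: addrCA.
  rewrite E0 in E2; move: E1 E2.
  move: (partial j _ _) (partial i _ _) (f (_ + _)) (f (_ + _)) (f (_ + _)) (f x).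
  move=> A B' p q s t E1 E2; have dd : d / 2 != 0 by rewrite gt_eqF.
  by apply: (mulIf dd); apply: (mulIf dd); rewrite -E1 -E2; ring.
rewrite E in L1; move: L1 L2.
move: (partial i (partial j f) x) (partial j (partial i f) x) => A B'.
move: (partial i _ _) => c; rewrite !ltr_norml => /andP[h1 h2] /andP[h3 h4].
by clear -h1 h2 h3 h4; rewrite ler_norml; apply/andP; split; lra.
Qed.

End Lines.

Local Open Scope complex_scope.
Local Notation cplx f := (fun y => (f y)%:C).

(** * The derivatives d = d_1 - i d_2 and its conjugate *)

Section ComplexNumbers.
Context (R : realType).
Implicit Types z w : R[i].

Lemma ReD z w : Re (z + w) = Re z + Re w. Proof. by case: z => a b; case: w => c d. Qed.
Lemma ImD z w : Im (z + w) = Im z + Im w. Proof. by case: z => a b; case: w => c d. Qed.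
Lemma ReN z : Re (- z) = - Re z. Proof. by case: z => a b. Qed.
Lemma ImN z : Im (- z) = - Im z. Proof. by case: z => a b. Qed.
Lemma ReM z w : Re (z * w) = Re z * Re w - Im z * Im w.
Proof. by case: z => a b; case: w => c d. Qed.
Lemma ImM z w : Im (z * w) = Re z * Im w + Im z * Re w.
Proof. by case: z => a b; case: w => c d. Qed.
Lemma Re_conjc z : Re (conjc z) = Re z. Proof. by case: z. Qed.
Lemma Im_conjc z : Im (conjc z) = - Im z. Proof. by case: z. Qed.
Definition ReImE := (ReD, ImD, ReN, ImN, ReM, ImM, Re_conjc, Im_conjc).

Lemma complex_ext z w : Re z = Re w -> Im z = Im w -> z = w.
Proof. by case: z => a b; case: w => c d /= -> ->. Qed.

Lemma conjcM z w : conjc (z * w) = conjc z * conjc w. Proof. exact: rmorphM. Qed.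
Lemma conjcD z w : conjc (z + w) = conjc z + conjc w. Proof. exact: rmorphD. Qed.
Lemma conjcN z : conjc (- z) = - conjc z. Proof. exact: rmorphN. Qed.
Lemma conjcV z : conjc z^-1 = (conjc z)^-1. Proof. exact: fmorphV. Qed.
Lemma conjcR (a : R) : conjc a%:C = a%:C. Proof. exact: conjc_real. Qed.
Lemma conjc1_ : conjc (1 : R[i]) = 1. Proof. exact: conjc1. Qed.
Definition conjcE := (conjcD, conjcN, conjcM, conjcV, conjcR, conjc1_, @conjcK R).

(** The norm of the type [R[i]] takes values in [R[i]]; estimates are carried out with this
    real-valued modulus instead. *)
Definition nc z : R := Normc.normc z.

Lemma nc_ge0 z : 0 <= nc z. Proof. by case: z => a b; exact: sqrtr_ge0. Qed.
Lemma ncM z w : nc (z * w) = nc z * nc w. Proof. exact: Normc.normcM. Qed.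
Lemma ncD z w : nc (z + w) <= nc z + nc w. Proof. exact: le_normcD. Qed.
Lemma ncN z : nc (- z) = nc z. Proof. exact: normcN. Qed.
Lemma ncB z w : nc (z - w) <= nc z + nc w. Proof. by rewrite -(ncN w) ncD. Qed.
Lemma ncJ z : nc (conjc z) = nc z.
Proof. by case: z => a b; rewrite /nc /Normc.normc /= sqrrN. Qed.
Lemma ncR (a : R) : nc a%:C = `|a|.
Proof. by rewrite /nc /Normc.normc /= expr0n addr0 sqrtr_sqr. Qed.
Lemma ncV z : nc z^-1 = (nc z)^-1. Proof. exact: Normc.normcV. Qed.
Lemma nc_sqr z : nc z ^+ 2 = Re z ^+ 2 + Im z ^+ 2.
Proof. by case: z => a b; rewrite /nc sqr_sqrtr// addr_ge0// sqr_ge0. Qed.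
Lemma nc_conj z : z * conjc z = (nc z ^+ 2)%:C.
Proof. by rewrite nc_sqr; apply: complex_ext; rewrite !ReImE /=; ring. Qed.
Lemma nc_Re z : `|Re z| <= nc z.
Proof.
rewrite -(ler_pXn2r (n := 2)) ?nnegrE ?nc_ge0// nc_sqr real_normK ?num_real//.
by rewrite lerDl sqr_ge0.
Qed.
Lemma nc_Im z : `|Im z| <= nc z.
Proof.
rewrite -(ler_pXn2r (n := 2)) ?nnegrE ?nc_ge0// nc_sqr real_normK ?num_real//.
by rewrite lerDr sqr_ge0.
Qed.
Lemma nc_le z (a b : R) : `|Re z| <= a -> `|Im z| <= b -> nc z <= a + b.
Proof.
move=> ha hb; have a0 := le_trans (normr_ge0 _) ha; have b0 := le_trans (normr_ge0 _) hb.
have E : z = (Re z)%:C + 'i * (Im z)%:C by apply: complex_ext; rewrite !ReImE /=; ring.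
rewrite E; apply: le_trans (ncD _ _) _; rewrite ncM !ncR.
have -> : nc 'i = 1 :> R by rewrite /nc /Normc.normc expr0n add0r expr1n sqrtr1.
by rewrite mul1r lerD.
Qed.
Lemma nc0_eq0 z : nc z = 0 -> z = 0. Proof. exact: Normc.eq0_normc. Qed.

End ComplexNumbers.

(* A boolean index and a sealed constant keep unification from comparing the
   numerals of 'I_2 and from unfolding derivatives into limits. *)
Definition idx (b : bool) : 'I_2 := if b then 1 else 0.
Arguments idx : simpl never.

HB.lock Definition pd (R : realType) (b : bool) (f : 'rV[R]_2 -> R) (x : 'rV[R]_2) : R :=
  partial (idx b) f x.

Lemma sum_I2 (R : realType) (F : 'I_2 -> R) : \sum_i F i = F (idx false) + F (idx true).
Proof. by rewrite big_ord_recl big_ord1; congr (F _ + F _); apply: val_inj. Qed.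

Lemma quad_I2 (R : realType) (H : 'I_2 -> 'I_2 -> R) :
  (forall a : 'rV[R]_2, \sum_i \sum_j a 0 i * a 0 j * H i j <= 0) ->
  forall s t, s * s * H (idx false) (idx false) + s * t * H (idx false) (idx true) + (t * s * H (idx true) (idx false) + t * t * H (idx true) (idx true)) <= 0.
Proof.
by move=> h s t; have := h (\row_j (if j == idx false then s else t)); rewrite !sum_I2 !mxE.
Qed.

(** Without the factor 1/2 this is twice the Wirtinger derivative: [dz xc] is 2, and [dz] composed
    with [db] is the Laplacian. *)
HB.lock Definition dz (R : realType) (F : 'rV[R]_2 -> R[i]) (x : 'rV[R]_2) : R[i] :=
  (pd false (fun y => Re (F y)) x + pd true (fun y => Im (F y)) x) +i*
  (pd false (fun y => Im (F y)) x - pd true (fun y => Re (F y)) x).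

HB.lock Definition db (R : realType) (F : 'rV[R]_2 -> R[i]) (x : 'rV[R]_2) : R[i] :=
  (pd false (fun y => Re (F y)) x - pd true (fun y => Im (F y)) x) +i*
  (pd false (fun y => Im (F y)) x + pd true (fun y => Re (F y)) x).

Section ComplexFunctions.
Context (R : realType).
Local Notation V := 'rV[R]_2.
Implicit Types (F G : V -> R[i]) (f g : V -> R) (U : set V) (x : V) (k : nat) (z : R[i]).

Definition CC k U F := C_class k U (fun y => Re (F y)) /\ C_class k U (fun y => Im (F y)).

Definition cdiff F x := differentiable (fun y => Re (F y)) x /\ differentiable (fun y => Im (F y)) x.

Lemma dzE F x : dz F x =
  (pd false (fun y => Re (F y)) x + pd true (fun y => Im (F y)) x) +i*
  (pd false (fun y => Im (F y)) x - pd true (fun y => Re (F y)) x).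
Proof. by rewrite dz.unlock. Qed.

Lemma dbE F x : db F x =
  (pd false (fun y => Re (F y)) x - pd true (fun y => Im (F y)) x) +i*
  (pd false (fun y => Im (F y)) x + pd true (fun y => Re (F y)) x).
Proof. by rewrite db.unlock. Qed.

Lemma dzfE F : dz F = fun x =>
  (pd false (fun y => Re (F y)) x + pd true (fun y => Im (F y)) x) +i*
  (pd false (fun y => Im (F y)) x - pd true (fun y => Re (F y)) x).
Proof. by apply/funext => x; exact: dzE. Qed.

Lemma dbfE F : db F = fun x =>
  (pd false (fun y => Re (F y)) x - pd true (fun y => Im (F y)) x) +i*
  (pd false (fun y => Im (F y)) x + pd true (fun y => Re (F y)) x).
Proof. by apply/funext => x; exact: dbE. Qed.

Lemma pdfE b f : pd b f = partial (idx b) f.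
Proof. by apply/funext => x; rewrite pd.unlock. Qed.

Lemma pd_cst b (c : R) x : pd b (fun=> c) x = 0.
Proof. by rewrite pdfE partial_cst. Qed.
Lemma pdD b f g x : differentiable f x -> differentiable g x ->
  pd b (fun y => f y + g y) x = pd b f x + pd b g x.
Proof. by move=> df dg; rewrite !pdfE; exact: partialD. Qed.
Lemma pdN b f x : differentiable f x -> pd b (fun y => - f y) x = - pd b f x.
Proof. by move=> df; rewrite !pdfE; exact: partialN. Qed.
Lemma pdB b f g x : differentiable f x -> differentiable g x ->
  pd b (fun y => f y - g y) x = pd b f x - pd b g x.
Proof.
move=> df dg; rewrite -(pdN b dg); exact: (pdD b df (differentiableN dg)).
Qed.
Lemma pdM b f g x : differentiable f x -> differentiable g x ->
  pd b (fun y => f y * g y) x = pd b f x * g x + f x * pd b g x.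
Proof. by move=> df dg; rewrite !pdfE; exact: partialM. Qed.
Lemma pd_comp b (h : R -> R) (dh : R) f x : differentiable f x ->
  is_derive (f x) 1 h dh -> pd b (fun y => h (f y)) x = dh * pd b f x.
Proof. by move=> df dh'; rewrite !pdfE; exact: partial_comp. Qed.
Lemma eq_pd b U f g x : open U -> (forall y, U y -> f y = g y) -> U x -> pd b f x = pd b g x.
Proof. by move=> oU fg Ux; rewrite !pdfE; exact: eq_partial fg _ Ux. Qed.
Lemma C_class_pd k U b f : C_class k.+1 U f -> C_class k U (pd b f).
Proof. by move=> [_ H]; rewrite pdfE; exact: H. Qed.
Lemma C_class_diff k U f x : C_class k.+1 U f -> U x -> differentiable f x.
Proof. by move=> [H _]; exact: H. Qed.
Lemma pdC U f x : open U -> C_class 2 U f -> U x ->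
  pd false (pd true f) x = pd true (pd false f) x.
Proof. by move=> oU cf Ux; rewrite !pdfE; exact: partialC cf Ux. Qed.

Lemma CC_cdiff k U F x : CC k.+1 U F -> U x -> cdiff F x.
Proof. by move=> [[df _] [dg _]] Ux; split; [exact: df|exact: dg]. Qed.

Lemma dz_ext U F G x : open U -> (forall y, U y -> F y = G y) -> U x -> dz F x = dz G x.
Proof.
move=> oU FG Ux; rewrite !dzE.
rewrite !(eq_pd _ (f := fun y => Re (F y)) (g := fun y => Re (G y)) oU _ Ux);
  try by move=> y /FG->.
by rewrite !(eq_pd _ (f := fun y => Im (F y)) (g := fun y => Im (G y)) oU _ Ux) =>
  // y /FG->.
Qed.

Lemma db_ext U F G x : open U -> (forall y, U y -> F y = G y) -> U x -> db F x = db G x.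
Proof.
move=> oU FG Ux; rewrite !dbE.
rewrite !(eq_pd _ (f := fun y => Re (F y)) (g := fun y => Re (G y)) oU _ Ux);
  try by move=> y /FG->.
by rewrite !(eq_pd _ (f := fun y => Im (F y)) (g := fun y => Im (G y)) oU _ Ux) =>
  // y /FG->.
Qed.

Lemma CC_le k l U F : (k <= l)%N -> CC l U F -> CC k U F.
Proof. by move=> kl [cf cg]; split; [exact: C_class_le cf|exact: C_class_le cg]. Qed.

Lemma CC_sub k U U' F : (forall y, U' y -> U y) -> CC k U F -> CC k U' F.
Proof. by move=> h [cf cg]; split; [exact: C_class_sub cf|exact: C_class_sub cg]. Qed.

Lemma CC_cst k U z : CC k U (fun=> z). Proof. by split; exact: C_class_cst. Qed.

Lemma CC_real k U f : C_class k U f -> CC k U (fun y => (f y)%:C).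
Proof. by move=> cf; split=> //; exact: C_class_cst. Qed.

Lemma CCD k U F G : open U -> CC k U F -> CC k U G -> CC k U (fun y => F y + G y).
Proof.
move=> oU [f1 f2] [g1 g2]; split.
  by apply: (C_class_ext oU _ (C_classD oU f1 g1)) => y _; rewrite ReD.
by apply: (C_class_ext oU _ (C_classD oU f2 g2)) => y _; rewrite ImD.
Qed.

Lemma CCN k U F : open U -> CC k U F -> CC k U (fun y => - F y).
Proof.
move=> oU [f1 f2]; split.
  by apply: (C_class_ext oU _ (C_classN oU f1)) => y _; rewrite ReN.
by apply: (C_class_ext oU _ (C_classN oU f2)) => y _; rewrite ImN.
Qed.

Lemma CCM k U F G : open U -> CC k U F -> CC k U G -> CC k U (fun y => F y * G y).
Proof.
move=> oU [f1 f2] [g1 g2]; split.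
  by apply: (C_class_ext oU _ (C_classB oU (C_classM oU f1 g1) (C_classM oU f2 g2))) => y _; rewrite ReM.
by apply: (C_class_ext oU _ (C_classD oU (C_classM oU f1 g2) (C_classM oU f2 g1))) => y _; rewrite ImM.
Qed.

Lemma CC_conj k U F : open U -> CC k U F -> CC k U (fun y => conjc (F y)).
Proof.
move=> oU [f1 f2]; split.
  by apply: (C_class_ext oU _ f1) => y _; rewrite Re_conjc.
by apply: (C_class_ext oU _ (C_classN oU f2)) => y _; rewrite Im_conjc.
Qed.

Lemma CC_dz k U F : open U -> CC k.+1 U F -> CC k U (dz F).
Proof.
move=> oU [f g]; have f' b := C_class_pd b f; have g' b := C_class_pd b g.
rewrite dzfE; split.
  exact: (C_classD oU (f' false) (g' true)).
exact: (C_classB oU (g' false) (f' true)).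
Qed.

Lemma CC_db k U F : open U -> CC k.+1 U F -> CC k U (db F).
Proof.
move=> oU [f g]; have f' b := C_class_pd b f; have g' b := C_class_pd b g.
rewrite dbfE; split.
  exact: (C_classB oU (f' false) (g' true)).
exact: (C_classD oU (g' false) (f' true)).
Qed.

Lemma cdiff_cst z x : cdiff (fun=> z) x.
Proof. by split; exact: differentiable_cst. Qed.

Lemma dz_cst z x : dz (fun=> z) x = 0.
Proof. by rewrite dzE !pd_cst addr0 subr0. Qed.
Lemma db_cst z x : db (fun=> z) x = 0.
Proof. by rewrite dbE !pd_cst addr0 subr0. Qed.

Lemma pd_ReD i F G x : cdiff F x -> cdiff G x ->
  pd i (fun y => Re (F y + G y)) x =
  pd i (fun y => Re (F y)) x + pd i (fun y => Re (G y)) x.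
Proof.
move=> [f1 f2] [g1 g2]; rewrite -pdD//; congr pd.
by apply/funext => y; rewrite ReD.
Qed.
Lemma pd_ImD i F G x : cdiff F x -> cdiff G x ->
  pd i (fun y => Im (F y + G y)) x =
  pd i (fun y => Im (F y)) x + pd i (fun y => Im (G y)) x.
Proof.
move=> [f1 f2] [g1 g2]; rewrite -pdD//; congr pd.
by apply/funext => y; rewrite ImD.
Qed.
Lemma pd_ReM i F G x : cdiff F x -> cdiff G x ->
  pd i (fun y => Re (F y * G y)) x =
  pd i (fun y => Re (F y)) x * Re (G x) + Re (F x) * pd i (fun y => Re (G y)) x
  - (pd i (fun y => Im (F y)) x * Im (G x) + Im (F x) * pd i (fun y => Im (G y)) x).
Proof.
move=> [f1 f2] [g1 g2]; rewrite -!pdM// -pdN; last exact: differentiableM.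
rewrite -pdD; [|exact: differentiableM|by apply: differentiableN; exact: differentiableM].
by congr pd; apply/funext => y; rewrite ReM.
Qed.
Lemma pd_ImM i F G x : cdiff F x -> cdiff G x ->
  pd i (fun y => Im (F y * G y)) x =
  pd i (fun y => Re (F y)) x * Im (G x) + Re (F x) * pd i (fun y => Im (G y)) x
  + (pd i (fun y => Im (F y)) x * Re (G x) + Im (F x) * pd i (fun y => Re (G y)) x).
Proof.
move=> [f1 f2] [g1 g2]; rewrite -!pdM//.
rewrite -pdD; [|exact: differentiableM|exact: differentiableM].
by congr pd; apply/funext => y; rewrite ImM.
Qed.
Lemma pd_Im_conj i F x : cdiff F x ->
  pd i (fun y => Im (conjc (F y))) x = - pd i (fun y => Im (F y)) x.
Proof.
move=> [f1 f2]; rewrite -pdN//; congr pd.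
by apply/funext => y; rewrite Im_conjc.
Qed.
Lemma pd_Re_conj i F x :
  pd i (fun y => Re (conjc (F y))) x = pd i (fun y => Re (F y)) x.
Proof. by congr pd; apply/funext => y; rewrite Re_conjc. Qed.

Lemma dzD F G x : cdiff F x -> cdiff G x -> dz (fun y => F y + G y) x = dz F x + dz G x.
Proof.
move=> cF cG; apply: complex_ext; rewrite !ReImE !dzE /=
  !(pd_ReD _ cF cG) !(pd_ImD _ cF cG); ring.
Qed.
Lemma dbD F G x : cdiff F x -> cdiff G x -> db (fun y => F y + G y) x = db F x + db G x.
Proof.
move=> cF cG; apply: complex_ext; rewrite !ReImE !dbE /=
  !(pd_ReD _ cF cG) !(pd_ImD _ cF cG); ring.
Qed.
Lemma dzM F G x : cdiff F x -> cdiff G x ->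
  dz (fun y => F y * G y) x = dz F x * G x + F x * dz G x.
Proof.
move=> cF cG; apply: complex_ext; rewrite !ReImE !dzE /=
  !(pd_ReM _ cF cG) !(pd_ImM _ cF cG); ring.
Qed.
Lemma dbM F G x : cdiff F x -> cdiff G x ->
  db (fun y => F y * G y) x = db F x * G x + F x * db G x.
Proof.
move=> cF cG; apply: complex_ext; rewrite !ReImE !dbE /=
  !(pd_ReM _ cF cG) !(pd_ImM _ cF cG); ring.
Qed.
Lemma dzN F x : cdiff F x -> dz (fun y => - F y) x = - dz F x.
Proof.
move=> dF; rewrite (_ : (fun y => - F y) = (fun y => -1 * F y)); last first.
  by apply/funext => t; rewrite mulN1r.
by rewrite (dzM (cdiff_cst _ _) dF) dz_cst mul0r add0r mulN1r.
Qed.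
Lemma dbN F x : cdiff F x -> db (fun y => - F y) x = - db F x.
Proof.
move=> dF; rewrite (_ : (fun y => - F y) = (fun y => -1 * F y)); last first.
  by apply/funext => t; rewrite mulN1r.
by rewrite (dbM (cdiff_cst _ _) dF) db_cst mul0r add0r mulN1r.
Qed.
Lemma dz_conj F x : cdiff F x -> dz (fun y => conjc (F y)) x = conjc (db F x).
Proof.
move=> cF; apply: complex_ext; rewrite !ReImE !dzE !dbE /=
  !pd_Re_conj !(pd_Im_conj _ cF); ring.
Qed.
Lemma db_conj F x : cdiff F x -> db (fun y => conjc (F y)) x = conjc (dz F x).
Proof.
move=> cF; apply: complex_ext; rewrite !ReImE !dzE !dbE /=
  !pd_Re_conj !(pd_Im_conj _ cF); ring.
Qed.

Lemma dz_real f x : dz (fun y => (f y)%:C) x = pd false f x +i* - pd true f x.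
Proof. by rewrite !dzE /= !pd_cst addr0 add0r. Qed.
Lemma db_real f x : db (fun y => (f y)%:C) x = conjc (dz (fun y => (f y)%:C) x).
Proof. by rewrite dz_real !dbE /= !pd_cst subr0 add0r opprK. Qed.

Lemma dzdbC U F x : open U -> CC 2 U F -> U x -> dz (db F) x = db (dz F) x.
Proof.
move=> oU [cf cg] Ux.
have df b := C_class_diff (C_class_pd b cf) Ux.
have dg b := C_class_diff (C_class_pd b cg) Ux.
have Sf := pdC oU cf Ux; have Sg := pdC oU cg Ux.
rewrite (dzfE F) (dbfE F) dzE dbE /= !pdB// !pdD// Sf Sg.
by congr (_ +i* _); ring.
Qed.

End ComplexFunctions.

(** * The operators DD, DB and ell *)

Section Operators.
Context (R : realType).
Local Notation V := 'rV[R]_2.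
Implicit Types (F G : V -> R[i]) (f : V -> R) (U : set V) (x : V) (k : nat) (z : R[i]).

(* For z = tan (Th / 2) w the equation says that DD z w is of order zero, and ell z, the
   linearised operator, is elliptic because |z| < 1; DB z is the conjugate of DD z. *)
Definition DD z F x := db F x - conjc z * dz F x.
Definition DB z F x := dz F x - z * db F x.
Definition ell z F x := DB z (db F) x - conjc z * DB z (dz F) x.

Lemma DB_ext U F G z x : open U -> (forall y, U y -> F y = G y) -> U x -> DB z F x = DB z G x.
Proof. by move=> oU FG Ux; rewrite /DB (dz_ext oU FG Ux) (db_ext oU FG Ux). Qed.
Lemma DD_cst z c x : DD z (fun=> c) x = 0.
Proof. by rewrite /DD dz_cst db_cst mulr0 subr0. Qed.
Lemma DB_cst z c x : DB z (fun=> c) x = 0.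
Proof. by rewrite /DB dz_cst db_cst mulr0 subr0. Qed.

Lemma DDD z F G x : cdiff F x -> cdiff G x -> DD z (fun y => F y + G y) x = DD z F x + DD z G x.
Proof. by move=> cF cG; rewrite /DD dzD// dbD//; ring. Qed.
Lemma DBD z F G x : cdiff F x -> cdiff G x -> DB z (fun y => F y + G y) x = DB z F x + DB z G x.
Proof. by move=> cF cG; rewrite /DB dzD// dbD//; ring. Qed.
Lemma DBN z F x : cdiff F x -> DB z (fun y => - F y) x = - DB z F x.
Proof. by move=> cF; rewrite /DB dzN// dbN//; ring. Qed.
Lemma DDM z F G x : cdiff F x -> cdiff G x ->
  DD z (fun y => F y * G y) x = DD z F x * G x + F x * DD z G x.
Proof. by move=> cF cG; rewrite /DD dzM// dbM//; ring. Qed.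
Lemma DBM z F G x : cdiff F x -> cdiff G x ->
  DB z (fun y => F y * G y) x = DB z F x * G x + F x * DB z G x.
Proof. by move=> cF cG; rewrite /DB dzM// dbM//; ring. Qed.
Lemma DD_conj z F x : cdiff F x -> DD z (fun y => conjc (F y)) x = conjc (DB z F x).
Proof. by move=> cF; rewrite /DD /DB dz_conj// db_conj// !conjcE. Qed.
Lemma DB_conj z F x : cdiff F x -> DB z (fun y => conjc (F y)) x = conjc (DD z F x).
Proof. by move=> cF; rewrite /DD /DB dz_conj// db_conj// !conjcE. Qed.
Lemma DB_real z f x : DB z (fun y => (f y)%:C) x = conjc (DD z (fun y => (f y)%:C) x).
Proof. by rewrite /DD /DB !db_real !conjcE. Qed.

Lemma ell_cst z c x : ell z (fun=> c) x = 0.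
Proof.
rewrite /ell (_ : db (fun=> c) = fun=> 0); last by apply/funext => y; exact: db_cst.
rewrite (_ : dz (fun=> c) = fun=> 0); last by apply/funext => y; exact: dz_cst.
by rewrite DB_cst mulr0 subr0.
Qed.

Lemma ellD U z F G x : open U -> CC 2 U F -> CC 2 U G -> U x ->
  ell z (fun y => F y + G y) x = ell z F x + ell z G x.
Proof.
move=> oU cF cG Ux; rewrite /ell.
have dF y : U y -> cdiff F y := CC_cdiff cF (x := y).
have dG y : U y -> cdiff G y := CC_cdiff cG (x := y).
have d1 := CC_cdiff (CC_db oU cF) Ux; have d2 := CC_cdiff (CC_db oU cG) Ux.
have d3 := CC_cdiff (CC_dz oU cF) Ux; have d4 := CC_cdiff (CC_dz oU cG) Ux.
have E1 : DB z (db (fun y => F y + G y)) x = DB z (fun y => db F y + db G y) x.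
  by apply: (DB_ext z oU _ Ux) => y Uy; exact: (dbD (dF y Uy) (dG y Uy)).
have E2 : DB z (dz (fun y => F y + G y)) x = DB z (fun y => dz F y + dz G y) x.
  by apply: (DB_ext z oU _ Ux) => y Uy; exact: (dzD (dF y Uy) (dG y Uy)).
rewrite E1 E2 (DBD z d1 d2) (DBD z d3 d4).
by move: (DB z _ x) (DB z _ x) (DB z _ x) (DB z _ x) => a b c d; clear; ring.
Qed.

(** The coefficient [z] is a number, not a function, so [ell z] has no first-order part and the
    Leibniz rule produces only the two cross terms. *)
Lemma ellM U z F G x : open U -> CC 2 U F -> CC 2 U G -> U x ->
  ell z (fun y => F y * G y) x = ell z F x * G x + F x * ell z G x
    + (DD z F x * DB z G x + DB z F x * DD z G x).
Proof.
move=> oU cF cG Ux; rewrite /ell.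
have dF y : U y -> cdiff F y := CC_cdiff cF (x := y).
have dG y : U y -> cdiff G y := CC_cdiff cG (x := y).
have e1 := CC_db oU cF; have e2 := CC_db oU cG.
have e3 := CC_dz oU cF; have e4 := CC_dz oU cG.
have d1 := CC_cdiff e1 Ux; have d2 := CC_cdiff e2 Ux.
have d3 := CC_cdiff e3 Ux; have d4 := CC_cdiff e4 Ux.
have f1 := CC_le (leqnSn 1) cF; have f2 := CC_le (leqnSn 1) cG.
have d5 := CC_cdiff (CCM oU e1 f2) Ux; have d6 := CC_cdiff (CCM oU f1 e2) Ux.
have d7 := CC_cdiff (CCM oU e3 f2) Ux; have d8 := CC_cdiff (CCM oU f1 e4) Ux.
have E1 : DB z (db (fun y => F y * G y)) x = DB z (fun y => db F y * G y + F y * db G y) x.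
  by apply: (DB_ext z oU _ Ux) => y Uy; exact: (dbM (dF y Uy) (dG y Uy)).
have E2 : DB z (dz (fun y => F y * G y)) x = DB z (fun y => dz F y * G y + F y * dz G y) x.
  by apply: (DB_ext z oU _ Ux) => y Uy; exact: (dzM (dF y Uy) (dG y Uy)).
rewrite E1 E2 (DBD z d5 d6) (DBD z d7 d8).
rewrite (DBM z d1 (dG _ Ux)) (DBM z (dF _ Ux) d2) (DBM z d3 (dG _ Ux)) (DBM z (dF _ Ux) d4).
rewrite /DD; move: (DB z (db F) x) (DB z (db G) x) (DB z (dz F) x) (DB z (dz G) x).
move: (DB z F x) (DB z G x) (F x) (G x) (db F x) (db G x) (dz F x) (dz G x) (conjc z).
by clear; move=> *; ring.
Qed.

Lemma ell_conj U z F x : open U -> CC 2 U F -> U x ->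
  ell z (fun y => conjc (F y)) x = conjc (ell z F x).
Proof.
move=> oU cF Ux; rewrite /ell.
have dF y : U y -> cdiff F y := CC_cdiff cF (x := y).
have d1 := CC_cdiff (CC_db oU cF) Ux; have d3 := CC_cdiff (CC_dz oU cF) Ux.
have E1 : DB z (db (fun y => conjc (F y))) x = DB z (fun y => conjc (dz F y)) x.
  by apply: (DB_ext z oU _ Ux) => y Uy; exact: (db_conj (dF y Uy)).
have E2 : DB z (dz (fun y => conjc (F y))) x = DB z (fun y => conjc (db F y)) x.
  by apply: (DB_ext z oU _ Ux) => y Uy; exact: (dz_conj (dF y Uy)).
rewrite E1 E2 (DB_conj z d1) (DB_conj z d3) /DD /DB !conjcE (dzdbC oU cF Ux).
move: (conjc (db (dz F) x)) (conjc (dz (dz F) x)) (conjc (db (db F) x)) (conjc z) => a b c d.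
by clear; ring.
Qed.

Lemma dz_ln U f x : open U -> (forall y, U y -> 0 < f y) -> C_class 1 U f -> U x ->
  dz (fun y => (ln (f y))%:C) x = ((f x)^-1)%:C * dz (fun y => (f y)%:C) x.
Proof.
move=> oU f0 [df _] Ux; rewrite !dz_real.
rewrite !(fun b => pd_comp b (df _ Ux) (is_derive1_ln (f0 _ Ux))).
by apply: complex_ext; rewrite !ReImE /=; ring.
Qed.

(** Obtained from [H = exp L], that is [dz H = H * dz L], by the product rule, and then solved for
    [L]; this avoids differentiating the inverse of [f]. *)
Lemma ell_ln U z f x : open U -> (forall y, U y -> 0 < f y) -> C_class 2 U f -> U x ->
  DD z (fun y => (ln (f y))%:C) x = ((f x)^-1)%:C * DD z (fun y => (f y)%:C) x /\
  ell z (fun y => (ln (f y))%:C) x =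
    ((f x)^-1)%:C * ell z (fun y => (f y)%:C) x
    - ((f x)^-1)%:C ^+ 2 * (DD z (fun y => (f y)%:C) x * DB z (fun y => (f y)%:C) x).
Proof.
move=> oU f0 cf Ux; pose L y := (ln (f y))%:C; pose H y := (f y)%:C.
have cL : CC 2 U L by apply: CC_real; exact: C_class_ln.
have cH : CC 2 U H by exact: CC_real.
have cf1 := C_classW cf.
have ez y : U y -> dz H y = H y * dz L y.
  move=> Uy; rewrite /L (dz_ln oU f0 cf1 Uy) mulrA /H -rmorphM/= mulfV ?mul1r//.
  by rewrite gt_eqF// f0.
have eb y : U y -> db H y = H y * db L y.
  by move=> Uy; rewrite /L /H !db_real -/L -/H ez// !conjcE.
have Hx : H x != 0 by rewrite /H; apply/eqP => -[]; apply/eqP; rewrite gt_eqF// f0.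
have EV : ((f x)^-1)%:C = (H x)^-1 by rewrite /H fmorphV.
have EDD : DD z H x = H x * DD z L x by rewrite /DD ez// eb//; ring.
have EDD' : DD z L x = (H x)^-1 * DD z H x by rewrite EDD mulrA mulVf ?mul1r.
split; first by rewrite -/L -/H EV.
have dH := CC_cdiff cH Ux.
have d1 := CC_cdiff (CC_db oU cL) Ux; have d3 := CC_cdiff (CC_dz oU cL) Ux.
have EL : ell z H x = H x * ell z L x + DB z H x * DD z L x.
  rewrite {1}/ell (DB_ext z oU eb Ux) (DB_ext z oU ez Ux) !DBM//.
  rewrite /ell /DD; move: (DB z (db L) x) (DB z (dz L) x) (DB z H x) (H x) (db L x) (dz L x).
  by move: (conjc z) => *; clear; ring.
rewrite -/L -/H EV EL EDD'; field; exact: Hx.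
Qed.

(** With [z = p + i q], on real functions [ell z] is the sum of the second derivatives along the
    directions (1 - p, q) and (q, 1 + p), the real and imaginary parts of [DD z]. Both are
    nonpositive at a maximum. *)
Lemma ell_max U z f x : open U -> C_class 2 U f -> U x -> (forall y, U y -> f y <= f x) ->
  DD z (fun y => (f y)%:C) x = 0 /\ Re (ell z (fun y => (f y)%:C) x) <= 0.
Proof.
move=> oU cf Ux fmax; have [p0 pp] := partial_max oU cf Ux fmax.
have q0 b : pd b f x = 0 by rewrite pdfE.
split.
  by rewrite /DD db_real dz_real !q0 /=; apply: complex_ext; rewrite !ReImE /=; ring.
have qq s t : s * s * pd false (pd false f) x + s * t * pd true (pd false f) x
  + (t * s * pd false (pd true f) x + t * t * pd true (pd true f) x) <= 0.
  by rewrite !pdfE; exact: (quad_I2 pp).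
have Eb : db (fun y => (f y)%:C) = fun y => pd false f y +i* pd true f y.
  by apply/funext => y; rewrite db_real dz_real /= opprK.
have Ez : dz (fun y => (f y)%:C) = fun y => pd false f y +i* - pd true f y.
  by apply/funext => y; rewrite dz_real.
have dN b c : pd b (fun y => - pd c f y) x = - pd b (pd c f) x.
  by apply: pdN; exact: C_class_diff (C_class_pd c cf) Ux.
have := qq (Im z) (1 + Re z); have := qq (1 - Re z) (Im z).
rewrite /ell /DB Eb Ez !dzE !dbE /= !dN (pdC oU cf Ux).
move: (pd false (pd false f) x) (pd true (pd false f) x) (pd true (pd true f) x) => a b c.
rewrite !ReImE /=; move: (Re z) (Im z) => p q; clear; lra.
Qed.

End Operators.

(** * The equation in complex form *)

Section Algebra.
Context (K : fieldType).

(** Here [a], [b] stand for [dz w], [db w], and [ab], [bb] for their conjugates; [e1], [eb] and [t],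
    [tb] are the [dz] and [db] derivatives of [e] and [T]. The hypotheses on [t] and [tb] are
    [dz T = db G] with [G = w (1 + e T)], and its conjugate; the last two are the derivatives of the
    equation for [T]. *)
Lemma first_order_algebra (w wb a ab b bb e e1 eb T t tb : K) :
  1 - e ^+ 2 * (w * wb) != 0 ->
  T * (1 - e ^+ 2 * (w * wb)) = e * (1 + w * wb) ->
  t = b * (1 + e * T) + w * (eb * T + e * tb) ->
  tb = bb * (1 + e * T) + wb * (e1 * T + e * t) ->
  t * (1 - e ^+ 2 * (w * wb)) - T * (2 * e * e1 * (w * wb) + e ^+ 2 * (a * wb + w * bb)) =
    e1 * (1 + w * wb) + e * (a * wb + w * bb) ->
  tb * (1 - e ^+ 2 * (w * wb)) - T * (2 * e * eb * (w * wb) + e ^+ 2 * (b * wb + w * ab)) =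
    eb * (1 + w * wb) + e * (b * wb + w * ab) ->
  (1 + e ^+ 2) * (b - e * wb * a) = (1 + w * wb) * (e1 - e * w * eb).
Proof.
set D := 1 - e ^+ 2 * (w * wb) => D0 hT ha hab hb1 hb2.
have ET : T = e * (1 + w * wb) / D by rewrite -hT mulfK.
have Et : t = (T * (2 * e * e1 * (w * wb) + e ^+ 2 * (a * wb + w * bb)) +
   (e1 * (1 + w * wb) + e * (a * wb + w * bb))) / D.
  by rewrite -hb1 addrC subrK mulfK.
have Etb : tb = (T * (2 * e * eb * (w * wb) + e ^+ 2 * (b * wb + w * ab)) +
   (eb * (1 + w * wb) + e * (b * wb + w * ab))) / D.
  by rewrite -hb2 addrC subrK mulfK.
have Z1 : (t - (b * (1 + e * T) + w * (eb * T + e * tb))) * D ^+ 2 = 0 by rewrite -ha subrr mul0r.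
have Z2 : (tb - (bb * (1 + e * T) + wb * (e1 * T + e * t))) * D ^+ 2 = 0 by rewrite -hab subrr mul0r.
apply/eqP; rewrite -subr_eq0 -(mulIr_eq0 _ (mulIf D0)); apply/eqP.
(* The two compatibility relations, the second one weighted by [e * w], eliminate [bb] and [ab];
   after multiplication by [D ^+ 2] what remains is [D] times the claim. *)
rewrite -[RHS](_ : - ((t - (b * (1 + e * T) + w * (eb * T + e * tb))) * D ^+ 2)
  - e * w * ((tb - (bb * (1 + e * T) + wb * (e1 * T + e * t))) * D ^+ 2) = 0); last first.
  by rewrite Z1 Z2; ring.
rewrite Et Etb ET; move: D0; rewrite /D => D0; field; exact: D0.
Qed.

End Algebra.

(* In terms of d = d_1 - i d_2 and its conjugate: P is the gradient of u, T half its
   Laplacian, G = (u_11 - u_22) / 2 - i u_12, e = tan (Th / 2), and the equation for the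
   eigenvalues becomes rational in w = G / (1 + e T). *)
Record phase_system (R : realType) (U : set 'rV[R]_2) (T e Th : 'rV[R]_2 -> R)
    (G w P : 'rV[R]_2 -> R[i]) : Prop := PhaseSystem {
  ps_open : open U;
  ps_T : C_class 2 U T;
  ps_e : C_class 2 U e;
  ps_Th : C_class 2 U Th;
  ps_G : CC 2 U G;
  ps_w : CC 2 U w;
  ps_P : CC 2 U P;
  ps_dzP : forall y, U y -> dz P y = 2 * (T y)%:C;
  ps_dbP : forall y, U y -> db P y = 2 * conjc (G y);
  ps_dze : forall y, U y -> dz (cplx e) y = ((1 + e y ^+ 2) / 2)%:C * dz (cplx Th) y;
  ps_Gw : forall y, U y -> G y = w y * (1 + (e y)%:C * (T y)%:C);
  ps_Tw : forall y, U y ->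
    (T y)%:C * (1 - (e y)%:C ^+ 2 * (w y * conjc (w y))) = (e y)%:C * (1 + w y * conjc (w y));
  ps_lt1 : forall y, U y -> nc ((e y)%:C * w y) < 1 }.

Section FirstOrderEquation.
Context (R : realType).
Local Notation V := 'rV[R]_2.
Variables (U : set V) (T e Th : V -> R) (G w P : V -> R[i]).
Hypothesis S : phase_system U T e Th G w P.
Local Notation Tc := (fun y => (T y)%:C).
Local Notation ec := (fun y => (e y)%:C).
Local Notation Thc := (fun y => (Th y)%:C).
Local Notation wb := (fun y => conjc (w y)).
Let oU := ps_open S.
Let cT := ps_T S. Let ce := ps_e S. Let cTh := ps_Th S.
Let cG := ps_G S. Let cw := ps_w S. Let cP := ps_P S.
Let hP : forall y, U y -> dz P y = 2 * Tc y := ps_dzP S.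
Let hPG : forall y, U y -> db P y = 2 * conjc (G y) := ps_dbP S.
Let he : forall y, U y -> dz ec y = ((1 + e y ^+ 2) / 2)%:C * dz Thc y := ps_dze S.
Let hGw : forall y, U y -> G y = w y * (1 + ec y * Tc y) := ps_Gw S.
Let hT : forall y, U y ->
  Tc y * (1 - ec y ^+ 2 * (w y * wb y)) = ec y * (1 + w y * wb y) := ps_Tw S.

Lemma one_minus_zeta (y : V) : 1 - ec y ^+ 2 * (w y * wb y) = (1 - nc (ec y * w y) ^+ 2)%:C.
Proof.
rewrite rmorphB rmorph1/= -nc_conj conjcM conjcR; congr (1 - _); ring.
Qed.

Let hD : forall y, U y -> 1 - ec y ^+ 2 * (w y * wb y) != 0.
Proof.
move=> y Uy; rewrite one_minus_zeta; apply/eqP => -[] /eqP.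
have := ps_lt1 S Uy; rewrite -(@expr_lt1 _ 2) ?nc_ge0// subr_eq0 => /lt_eqF.
by rewrite eq_sym => ->.
Qed.

Let ccT : CC 2 U Tc := CC_real cT.
Let cce : CC 2 U ec := CC_real ce.
Let ccTh : CC 2 U Thc := CC_real cTh.
Let cwb : CC 2 U wb := CC_conj oU cw.
Let d k F y (cF : CC k.+1 U F) (Uy : U y) := CC_cdiff cF Uy.

Lemma cplx2_neq0 : (2 : R[i]) != 0.
Proof. by rewrite pnatr_eq0. Qed.

(** The integrability condition that [T] and [G] come from one function [u]: the mixed derivatives
    of [P] agree. *)
Lemma dzT_dbG y : U y -> dz Tc y = db G y.
Proof.
move=> Uy; have h1 : db (dz P) y = 2 * conjc (dz Tc y).
  rewrite (db_ext oU hP Uy) dbM; [|exact: cdiff_cst|exact: d ccT Uy].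
  by rewrite db_cst mul0r add0r db_real.
have h2 : dz (db P) y = 2 * conjc (db G y).
  rewrite (dz_ext oU hPG Uy) dzM; [|exact: cdiff_cst|exact: d (CC_conj oU cG) Uy].
  by rewrite dz_cst mul0r add0r dz_conj//; exact: d cG Uy.
have := dzdbC oU cP Uy; rewrite h1 h2 => /(mulfI cplx2_neq0) /(congr1 conjc).
by rewrite !conjcK.
Qed.

Lemma db_e y : U y -> db ec y = ((1 + e y ^+ 2) / 2)%:C * db Thc y.
Proof. by move=> Uy; rewrite !db_real he// !conjcE. Qed.

Lemma cplx_half_one_plus_sqr (a : R) : ((1 + a ^+ 2) / 2)%:C = (1 + a%:C ^+ 2) / 2 :> R[i].
Proof. by rewrite rmorphM rmorphD rmorph1 rmorphXn fmorphV rmorph_nat. Qed.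

Lemma one_plus_e2_neq0 y : 1 + ec y ^+ 2 != 0.
Proof.
rewrite -rmorphXn -(rmorph1 (real_complex R)) -rmorphD/=.
by apply/eqP => -[]; apply/eqP; rewrite gt_eqF// ltr_pwDl// sqr_ge0.
Qed.

(** [T] is eliminated between the integrability condition and the differentiated equation. The
    factor [1 + e ^+ 2] that appears on the left is the one in the derivative of [e = tan (Th / 2)],
    so it cancels. *)
Lemma first_order y : U y ->
  db w y - ec y * wb y * dz w y =
  (1 + w y * wb y) / 2 * (dz Thc y - ec y * w y * db Thc y).
Proof.
move=> Uy; have dw := d cw Uy; have dwb := d cwb Uy; have dT := d ccT Uy; have de := d cce Uy.
have deT := d (CCM oU cce ccT) Uy; have dww := d (CCM oU cw cwb) Uy.
have dee := d (CCM oU cce cce) Uy; have deeww := d (CCM oU (CCM oU cce cce) (CCM oU cw cwb)) Uy.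
have h1T : CC 2 U (fun y => 1 + ec y * Tc y) := CCD oU (CC_cst 2 U 1) (CCM oU cce ccT).
have h1w : CC 2 U (fun y => 1 + w y * wb y) := CCD oU (CC_cst 2 U 1) (CCM oU cw cwb).
have hN : CC 2 U (fun y => - (ec y * ec y * (w y * wb y))) :=
  CCN oU (CCM oU (CCM oU cce cce) (CCM oU cw cwb)).
have h1D : CC 2 U (fun y => 1 + - (ec y * ec y * (w y * wb y))) := CCD oU (CC_cst 2 U 1) hN.
have dN : cdiff (fun y => - (ec y * ec y * (w y * wb y))) y := d hN Uy.
have dc : cdiff (fun=> 1 : R[i]) y by exact: cdiff_cst.
have hT' y' : U y' -> Tc y' * (1 + - (ec y' * ec y' * (w y' * wb y'))) =
    ec y' * (1 + w y' * wb y') by move=> Uy'; rewrite -hT// expr2.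
have ha : dz Tc y = db w y * (1 + ec y * Tc y) + w y * (db ec y * Tc y + ec y * db Tc y).
  rewrite (dzT_dbG Uy) (db_ext oU hGw Uy) (dbM dw (d h1T Uy)) (dbD dc deT) db_cst add0r.
  by rewrite (dbM de dT).
have hab : db Tc y = conjc (db w y) * (1 + ec y * Tc y) + wb y * (dz ec y * Tc y + ec y * dz Tc y).
  by rewrite db_real {1}ha !conjcE !db_real !conjcK.
have hb1 := dz_ext oU hT' Uy.
rewrite (dzM dT (d h1D Uy)) (dzM de (d h1w Uy)) (dzD dc dN) (dzD dc dww) (dzN deeww) in hb1.
rewrite (dzM dee dww) (dzM de de) (dzM dw dwb) dz_cst (dz_conj dw) in hb1.
have hb2 := db_ext oU hT' Uy.
rewrite (dbM dT (d h1D Uy)) (dbM de (d h1w Uy)) (dbD dc dN) (dbD dc dww) (dbN deeww) in hb2.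
rewrite (dbM dee dww) (dbM de de) (dbM dw dwb) db_cst (db_conj dw) in hb2.
have E := first_order_algebra (a := dz w y) (ab := conjc (dz w y)) (hD Uy) (hT Uy) ha hab.
apply: (mulfI (one_plus_e2_neq0 y)); rewrite {}E.
- by rewrite (he Uy) (db_e Uy) cplx_half_one_plus_sqr; field.
- apply/eqP; rewrite -subr_eq0; apply/eqP.
  by move/eqP: hb1; rewrite -subr_eq0 => /eqP <-; ring.
- apply/eqP; rewrite -subr_eq0; apply/eqP.
  by move/eqP: hb2; rewrite -subr_eq0 => /eqP <-; ring.
Qed.

Local Notation Zf := (fun y => ec y * w y).
Let cZ : CC 2 U Zf := CCM oU cce cw.
Local Notation Bf := (fun y => w y * db Thc y + ec y * dz Thc y).

Lemma conjc_half (z : R[i]) : conjc (z / 2) = conjc z / 2.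
Proof. by rewrite conjcM conjcV conjc_nat. Qed.

Lemma one_minus_zeta2_neq0 y : U y -> 1 - Zf y * conjc (Zf y) != 0.
Proof.
move=> Uy; have := hD Uy; rewrite conjcM conjcR (_ : ec y ^+ 2 * (w y * wb y) =
  ec y * w y * (ec y * wb y)) //; ring.
Qed.

Lemma DD_w y : U y -> DD (Zf y) w y = (1 + w y * wb y) / 2 * DB (Zf y) Thc y.
Proof. by move=> Uy; rewrite /DD /DB -first_order// conjcM conjcR. Qed.

Lemma DD_e y : U y -> DD (Zf y) ec y = ((1 + e y ^+ 2) / 2)%:C * DD (Zf y) Thc y.
Proof. by move=> Uy; rewrite /DD he// db_e//; ring. Qed.

Lemma DB_e y : U y -> DB (Zf y) ec y = ((1 + e y ^+ 2) / 2)%:C * DB (Zf y) Thc y.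
Proof. by move=> Uy; rewrite /DB he// db_e//; ring. Qed.

(** The contributions of [DD e] and [DD w] combine so that [1 - |zeta|^2] factors out: this
    derivative degenerates together with the ellipticity, and the lower bound for [1 - |zeta|] rests
    on that. *)
Lemma DD_zeta y : U y ->
  DD (Zf y) Zf y = (1 - Zf y * conjc (Zf y)) / 2 * Bf y.
Proof.
move=> Uy; rewrite (DDM _ (d cce Uy) (d cw Uy)) DD_w// DD_e// cplx_half_one_plus_sqr /DD /DB.
by rewrite !conjcE; field.
Qed.

(** A Beltrami equation for the gradient of [u], with coefficient [conjc zeta]. Its consequences
    below express both [DD P] and [DB P] through [w] and [e] alone, without the Laplacian. *)
Lemma db_P y : U y -> db P y = conjc (Zf y) * dz P y + 2 * wb y.
Proof.
move=> Uy; rewrite hPG// hP// hGw// !conjcE.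
rewrite (_ : 2 * (wb y * (1 + ec y * Tc y)) = ec y * wb y * (2 * Tc y) + 2 * wb y)//; ring.
Qed.

Lemma DD_P y : U y -> DD (Zf y) P y = 2 * wb y.
Proof. by move=> Uy; rewrite /DD db_P//; ring. Qed.

Lemma DB_P y : U y -> DB (Zf y) P y = 2 * ec y.
Proof.
move=> Uy; rewrite /DB hP// hPG// hGw// !conjcE.
transitivity (2 * (Tc y * (1 - ec y ^+ 2 * (w y * wb y)) - ec y * (w y * wb y))); first by ring.
by rewrite hT//; ring.
Qed.

Lemma DB_conj_zeta y : U y ->
  DB (Zf y) (fun y => conjc (Zf y)) y =
  (1 - Zf y * conjc (Zf y)) / 2 * (wb y * dz Thc y + ec y * db Thc y).
Proof.
move=> Uy; rewrite (DB_conj _ (d cZ Uy)) DD_zeta//.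
rewrite [LHS]conjcM [X in X * _ = _]conjc_half.
by rewrite [db Thc y]db_real !conjcE; ring.
Qed.

(** Only the derivative of the coefficient in [db_P] and that of [w] survive. The former has the
    factor [1 - |zeta|^2], which multiplied by [dz P = 2 T] gives [2 e (1 + |w|^2)]; so nothing
    blows up where ellipticity is lost. *)
Lemma ell_P y : U y ->
  ell (Zf y) P y = ec y * (1 + w y * wb y) * (wb y * dz Thc y + ec y * db Thc y)
    + 2 * conjc (DD (Zf y) w y).
Proof.
move=> Uy; rewrite /ell (DB_ext _ oU db_P Uy).
have cZb := CC_conj oU cZ; have dP := d (CC_dz oU cP) Uy.
have d1 := d (CC_le (leqnSn 1) cZb) Uy.
have d2 : cdiff (fun=> 2 : R[i]) y := cdiff_cst _ _.
have dwb := d cwb Uy.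
rewrite (DBD _ (d (CCM oU (CC_le (leqnSn 1) cZb) (CC_dz oU cP)) Uy) (d (CCM oU (CC_cst 2 U 2) cwb) Uy)).
rewrite (DBM _ d1 dP) (DBM _ d2 dwb) DB_cst (DB_conj _ (d cw Uy)) DB_conj_zeta// hP//.
rewrite -hT//; move: (DB (Zf y) (dz P) y) (DD (Zf y) w y) (dz Thc y) (db Thc y) => a b c f.
by rewrite !conjcE; field.
Qed.

(** The first-order system is differentiated once more. Recovering [dz w] from [DB w] and [DD w]
    costs a division by [1 - |zeta|^2], but [dz w] is multiplied by [DB (conjc zeta)], which
    contains the same factor. *)
Lemma ell_w y : U y ->
  ell (Zf y) w y =
    (wb y * dz Thc y + ec y * db Thc y) / 2 * (DB (Zf y) w y + Zf y * DD (Zf y) w y)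
    + (DB (Zf y) w y * wb y + w y * conjc (DD (Zf y) w y)) / 2 * DB (Zf y) Thc y
    + (1 + w y * wb y) / 2 * (DB (Zf y) (dz Thc) y
        - DB (Zf y) Zf y * db Thc y - Zf y * DB (Zf y) (db Thc) y).
Proof.
move=> Uy.
have E y' : U y' -> db w y' = conjc (Zf y') * dz w y' +
   2^-1 * (1 + w y' * wb y') * (dz Thc y' + - (Zf y' * db Thc y')).
  by move=> Uy'; have := first_order Uy'; rewrite !conjcE => H;
     rewrite -[LHS](subrK (ec y' * wb y' * dz w y')) H; ring.
have cZb := CC_conj oU cZ; have c1 k F (cF : CC k.+1 U F) := CC_le (leqnSn k) cF.
have cdw := CC_dz oU cw; have cdT := CC_dz oU ccTh; have cbT := CC_db oU ccTh.
have c2 : CC 1 U (fun y => 1 + w y * wb y) := CCD oU (CC_cst 1 U 1) (CCM oU (c1 _ _ cw) (c1 _ _ cwb)).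
have c3 : CC 1 U (fun y => 2^-1 * (1 + w y * wb y)) := CCM oU (CC_cst 1 U 2^-1) c2.
have c4 : CC 1 U (fun y => Zf y * db Thc y) := CCM oU (c1 _ _ cZ) cbT.
have c5 : CC 1 U (fun y => dz Thc y + - (Zf y * db Thc y)) := CCD oU cdT (CCN oU c4).
rewrite {1}/ell (DB_ext _ oU E Uy).
rewrite (DBD _ (d (CCM oU (c1 _ _ cZb) cdw) Uy) (d (CCM oU c3 c5) Uy)).
rewrite (DBM _ (d cZb Uy) (d cdw Uy)) (DBM _ (d c3 Uy) (d c5 Uy)).
rewrite (DBM _ (cdiff_cst _ _) (d c2 Uy)) DB_cst (DBD _ (cdiff_cst _ _) (d (CCM oU cw cwb) Uy)) DB_cst.
rewrite (DBM _ (d cw Uy) (d cwb Uy)) (DB_conj _ (d cw Uy)).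
rewrite (DBD _ (d cdT Uy) (d (CCN oU c4) Uy)) (DBN _ (d c4 Uy)) (DBM _ (d cZ Uy) (d cbT Uy)).
rewrite DB_conj_zeta//.
have Ez : dz w y = (DB (Zf y) w y + Zf y * DD (Zf y) w y) / (1 - Zf y * conjc (Zf y)).
  by apply: (mulIf (one_minus_zeta2_neq0 Uy)); rewrite mulfVK ?one_minus_zeta2_neq0// /DB /DD; ring.
rewrite {}Ez; have := one_minus_zeta2_neq0 Uy; rewrite [DB (Zf y) Thc y]/DB.
move: (DB _ (dz w) y) (DB _ (dz Thc) y) (DB _ (db Thc) y) (DB _ Zf y) (DB _ w y) (DD _ w y) => a1 a2 a3 a4 a5 a6.
move: (dz Thc y) (db Thc y) => a7 a8; rewrite !conjcE => h; field; exact: h.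
Qed.

(** Same mechanism as for [ell_w], starting from [DD_zeta]. The second derivatives of [Th] keep the
    factor [1 - |zeta|^2]; all other terms contain a first derivative of [zeta] or that factor. *)
Lemma ell_zeta y : U y ->
  ell (Zf y) Zf y =
    (wb y * dz Thc y + ec y * db Thc y) / 2 * (DB (Zf y) Zf y + Zf y * DD (Zf y) Zf y)
    - (DB (Zf y) Zf y * conjc (Zf y) + Zf y * conjc (DD (Zf y) Zf y)) / 2 * Bf y
    + (1 - Zf y * conjc (Zf y)) / 2 * (DB (Zf y) w y * db Thc y + w y * DB (Zf y) (db Thc) y
       + DB (Zf y) ec y * dz Thc y + ec y * DB (Zf y) (dz Thc) y).
Proof.
move=> Uy.
have E y' : U y' -> db Zf y' = conjc (Zf y') * dz Zf y' +
   2^-1 * (1 + - (Zf y' * conjc (Zf y'))) * (w y' * db Thc y' + ec y' * dz Thc y').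
  move=> Uy'; have := DD_zeta Uy'; rewrite {1}/DD => H.
  by rewrite -[LHS](subrK (conjc (Zf y') * dz Zf y')) H; ring.
have cZb := CC_conj oU cZ; have c1 k F (cF : CC k.+1 U F) := CC_le (leqnSn k) cF.
have cdw := CC_dz oU cZ; have cdT := CC_dz oU ccTh; have cbT := CC_db oU ccTh.
have cZZ := CCM oU (c1 _ _ cZ) (c1 _ _ cZb).
have c2 : CC 1 U (fun y => 1 + - (Zf y * conjc (Zf y))) := CCD oU (CC_cst 1 U 1) (CCN oU cZZ).
have c3 : CC 1 U (fun y => 2^-1 * (1 + - (Zf y * conjc (Zf y)))) := CCM oU (CC_cst 1 U 2^-1) c2.
have c4 := CCM oU (c1 _ _ cw) cbT; have c4' := CCM oU (c1 _ _ cce) cdT.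
have c5 := CCD oU c4 c4'.
rewrite {1}/ell (DB_ext _ oU E Uy).
rewrite (DBD _ (d (CCM oU (c1 _ _ cZb) cdw) Uy) (d (CCM oU c3 c5) Uy)).
rewrite (DBM _ (d cZb Uy) (d cdw Uy)) (DBM _ (d c3 Uy) (d c5 Uy)).
rewrite (DBM _ (cdiff_cst _ _) (d c2 Uy)) DB_cst (DBD _ (cdiff_cst _ _) (d (CCN oU cZZ) Uy)) DB_cst.
rewrite (DBN _ (d cZZ Uy)) (DBM _ (d cZ Uy) (d cZb Uy)) (DB_conj _ (d cZ Uy)).
rewrite (DBD _ (d c4 Uy) (d c4' Uy)) (DBM _ (d cw Uy) (d cbT Uy)) (DBM _ (d cce Uy) (d cdT Uy)).
rewrite -(DB_conj _ (d cZ Uy)) DB_conj_zeta//.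
have Ez : dz Zf y = (DB (Zf y) Zf y + Zf y * DD (Zf y) Zf y) / (1 - Zf y * conjc (Zf y)).
  by apply: (mulIf (one_minus_zeta2_neq0 Uy)); rewrite mulfVK ?one_minus_zeta2_neq0// /DB /DD; ring.
rewrite {}Ez; have := one_minus_zeta2_neq0 Uy.
move: (DB _ (dz Zf) y) (DB _ (dz Thc) y) (DB _ (db Thc) y) (DB _ Zf y) (DB _ w y) (DD _ Zf y) (DB _ ec y) => a1 a2 a3 a4 a5 a6 a9.
move: (dz Thc y) (db Thc y) => a7 a8; rewrite !conjcE => h; field; exact: h.
Qed.

End FirstOrderEquation.

(** * The maximum of the test function for w *)

(** The numbers stand for moduli at the maximum: [W] of [w], [D] of [DB w], [X] of [DD w], [L] of
    [ell w], [LP] of [ell P], [NV] of the [DD] derivative of [|w|^2], and [et] is [rho^2 - |x|^2].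
    The good term [4 * W ^+ 2] comes from [|Du|^2]; the terms in [eps] with a factor [W ^+ 2] add up
    to 28 = 12 + 16 and 80 = 64 + 16, and use up one of the four. *)
Lemma w_bound_inequality (R : realType) (W E D X L LP et rho A K eps NV : R) :
  1 <= W -> 0 <= E -> E * W <= 1 -> 0 <= eps -> 0 <= K -> 0 <= A -> 0 <= D -> 0 <= X ->
  0 < et -> 0 < rho -> 0 <= NV ->
  X <= (1 + W ^+ 2) * eps ->
  L <= W * (3 * eps * D + 6 * W ^+ 2 * eps ^+ 2 + 4 * K * W) ->
  LP <= 8 * W ^+ 2 * eps ->
  NV <= (1 + W ^+ 2) * (8 * rho / et + 4 * A * W) ->
  W * D <= NV + X * W -> NV <= W * (X + D) ->
  (- 2 * W * L + X ^+ 2 + D ^+ 2) / (1 + W ^+ 2) - NV ^+ 2 / (1 + W ^+ 2) ^+ 2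
    - 2 * (8 / et + 16 * rho ^+ 2 / et ^+ 2) + 4 * W ^+ 2 - 2 * A * LP <= 0 ->
  28 * eps ^+ 2 + 80 * A * eps <= 1 ->
  3 * (W * et) ^+ 2 <= 128 * eps * rho * (W * et) + 8 * K * et * (W * et) + 16 * et + 32 * rho ^+ 2.
Proof.
move=> W1 E0 EW e0 K0 A0 D0 X0 et0 rho0 NV0 hX hL hLP hNV hWD hNV2 main small.
set q := 1 + W ^+ 2 in hX hNV main *.
have q0 : 0 < q by rewrite /q ltr_pwDl// sqr_ge0.
have W0 : 0 < W by apply: lt_le_trans W1.
have qW : q <= 2 * W ^+ 2 by rewrite /q; nra.
have N2 : NV ^+ 2 <= W ^+ 2 * (X + D) ^+ 2.
  by rewrite -exprMn ler_pXn2r// nnegrE// mulr_ge0 ?addr_ge0// ltW.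
(* The squares of the derivatives of [w] almost cancel against the square of the gradient: up to a
   square, the difference is [- 2 * (X * D * q)], and [X <= q * eps] makes it a small multiple of
   [D]. *)
have I1 : - (8 * eps * D + 12 * W ^+ 2 * eps ^+ 2 + 8 * K * W) <=
    (- 2 * W * L + X ^+ 2 + D ^+ 2) / q - NV ^+ 2 / q ^+ 2.
  have -> : (- 2 * W * L + X ^+ 2 + D ^+ 2) / q - NV ^+ 2 / q ^+ 2 =
     ((- 2 * W * L + X ^+ 2 + D ^+ 2) * q - NV ^+ 2) / q ^+ 2.
    by field; rewrite gt_eqF.
  rewrite ler_pdivlMr ?exprn_gt0//.
  have s1 : 0 <= eps * D by rewrite mulr_ge0.
  have s2 : 0 <= W ^+ 2 * eps ^+ 2 by rewrite mulr_ge0 ?sqr_ge0.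
  have s3 : 0 <= K * W by rewrite mulr_ge0// ltW.
  set Y := 3 * eps * D + 6 * W ^+ 2 * eps ^+ 2 + 4 * K * W in hL *.
  have Y0 : 0 <= Y by rewrite /Y; lra.
  have h1 : - 2 * W * L * q >= - 2 * q * q * Y.
    have : W * L <= q * Y.
      apply: (le_trans (y := W * (W * Y))); first by rewrite ler_pM2l.
      by rewrite mulrA ler_wpM2r// /q -expr2 lerDr.
    rewrite -(ler_pM2r q0) (_ : - 2 * W * L * q = - 2 * (W * L * q)); last by ring.
    rewrite (_ : - 2 * q * q * Y = - 2 * (q * Y * q)); last by ring.
    by move: (W * L * q) (q * Y * q) => a b; clear; lra.
  have h2 : - 2 * eps * D * q ^+ 2 <= (X ^+ 2 + D ^+ 2) * q - NV ^+ 2.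
    have k1 : X * D * q <= eps * D * q ^+ 2.
      rewrite expr2 mulrA ler_pM2r//.
      have -> : eps * D * q = q * eps * D by ring.
      by rewrite ler_wpM2r.
    have k2 : (X ^+ 2 + D ^+ 2) * q - W ^+ 2 * (X + D) ^+ 2 = (X + D) ^+ 2 - 2 * (X * D * q).
      by rewrite /q; ring.
    have k3 := sqr_ge0 (X + D).
    rewrite (_ : - 2 * eps * D * q ^+ 2 = - 2 * (eps * D * q ^+ 2)); last by ring.
    clear -k1 k2 k3 N2; move: k1 k2 k3 N2.
    move: (eps * D * q ^+ 2) (X * D * q) ((X ^+ 2 + D ^+ 2) * q) => a b c.
    move: (W ^+ 2 * (X + D) ^+ 2) ((X + D) ^+ 2) (NV ^+ 2) => a' b' c'; clear; lra.
  have -> : - (8 * eps * D + 12 * W ^+ 2 * eps ^+ 2 + 8 * K * W) * q ^+ 2 =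
    - 2 * q * q * Y + - 2 * eps * D * q ^+ 2 by rewrite /Y; ring.
  have -> : (- 2 * W * L + X ^+ 2 + D ^+ 2) * q - NV ^+ 2 = - 2 * W * L * q +
     ((X ^+ 2 + D ^+ 2) * q - NV ^+ 2) by ring.
  exact: lerD.
have r0 : 0 <= rho / et by rewrite divr_ge0// ltW.
(* The critical point condition, contained in the bound for [NV], controls the derivative of [w]
   that the first-order system leaves free. *)
have I2 : D <= 2 * W ^+ 2 * eps + 2 * W * (8 * rho / et + 4 * A * W).
  rewrite -(ler_pM2l W0); apply: le_trans hWD _.
  have b1 : X * W <= 2 * W ^+ 2 * eps * W.
    by rewrite ler_pM2r//; apply: le_trans hX _; rewrite ler_wpM2r.
  have b2 : NV <= 2 * W ^+ 2 * (8 * rho / et + 4 * A * W).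
    apply: le_trans hNV _; rewrite ler_wpM2r//.
    by rewrite addr_ge0// ?mulr_ge0// ?mulr_ge0// ?invr_ge0// ltW.
  by rewrite (_ : W * (_ + _) = 2 * W ^+ 2 * eps * W + 2 * W ^+ 2 * (8 * rho / et + 4 * A * W));
    [lra|ring].
have I3 : eps * D <= 2 * W ^+ 2 * eps ^+ 2 + 16 * eps * W * (rho / et) + 8 * A * W ^+ 2 * eps.
  apply: le_trans (ler_wpM2l e0 I2) _.
  by rewrite le_eqVlt; apply/orP; left; apply/eqP; ring.
have I4 : A * LP <= 8 * A * W ^+ 2 * eps.
  apply: le_trans (ler_wpM2l A0 hLP) _.
  by rewrite le_eqVlt; apply/orP; left; apply/eqP; ring.
have I5 : W ^+ 2 * (28 * eps ^+ 2 + 80 * A * eps) <= W ^+ 2.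
  by rewrite -[leRHS]mulr1 ler_wpM2l// sqr_ge0.
have F : 3 * W ^+ 2 <= 128 * eps * W * (rho / et) + 8 * K * W + 16 / et + 32 * (rho ^+ 2 / et ^+ 2).
  have e1 : 16 * rho ^+ 2 / et ^+ 2 = 16 * (rho ^+ 2 / et ^+ 2) by rewrite mulrA.
  move: main I1 I3 I4 I5; rewrite e1; clear -R.
  set a := _ / q; set b := _ / q ^+ 2; set c := 8 / et; set d := rho ^+ 2 / et ^+ 2.
  have -> : 16 / et = 2 * c by rewrite /c; ring.
  move: a b c d (rho / et) => a b c d r.
  nra.
have : 3 * (W * et) ^+ 2 <= et ^+ 2 * (128 * eps * W * (rho / et) + 8 * K * W + 16 / et + 32 * (rho ^+ 2 / et ^+ 2)).
  rewrite (_ : 3 * (W * et) ^+ 2 = et ^+ 2 * (3 * W ^+ 2)); last by ring.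
  by rewrite ler_wpM2l// sqr_ge0.
suff -> : et ^+ 2 * (128 * eps * W * (rho / et) + 8 * K * W + 16 / et + 32 * (rho ^+ 2 / et ^+ 2))
  = 128 * eps * rho * (W * et) + 8 * K * et * (W * et) + 16 * et + 32 * rho ^+ 2 by [].
by field; rewrite gt_eqF.
Qed.

(** * The coordinate, squared moduli and logarithms under the operators *)

Section Coordinates.
Context (R : realType).
Local Notation V := 'rV[R]_2.
Implicit Types (F : V -> R[i]) (f g : V -> R) (U : set V) (x y : V) (z : R[i]).

Definition xc (y : V) : R[i] := (y 0 (idx false)) +i* (y 0 (idx true)).

Lemma pd_coord b c x : pd b (fun y => y 0 (idx c)) x = (b == c)%:R :> R.
Proof. by rewrite pdfE partial_coord; case: b; case: c. Qed.

Lemma CC_xc k U : CC k U xc.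
Proof. by split; exact: C_class_coord. Qed.

Lemma dz_xc x : dz xc x = 2.
Proof. by rewrite dzE /= !pd_coord /=; apply: complex_ext => /=; rewrite ?subrr ?addr0//. Qed.

Lemma db_xc x : db xc x = 0.
Proof. by rewrite dbE /= !pd_coord /=; apply: complex_ext => /=; rewrite ?subrr ?addr0//. Qed.

Lemma DD_xc z x : DD z xc x = - (2 * conjc z).
Proof. by rewrite /DD dz_xc db_xc; ring. Qed.

Lemma DB_xc z x : DB z xc x = 2.
Proof. by rewrite /DB dz_xc db_xc; ring. Qed.

Lemma ell_xc z x : ell z xc x = 0.
Proof.
rewrite /ell (_ : db xc = fun=> 0); last by apply/funext => y; exact: db_xc.
rewrite (_ : dz xc = fun=> 2); last by apply/funext => y; exact: dz_xc.
by rewrite !DB_cst mulr0 subr0.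
Qed.

Lemma enorm_xc y : enorm y = nc (xc y).
Proof. by rewrite /enorm big_ord1 sum_I2. Qed.

Lemma C_class_nc2 k U F : open U -> CC k U F -> C_class k U (fun y => nc (F y) ^+ 2).
Proof.
move=> oU [f1 f2]; have := C_classD oU (C_classM oU f1 f1) (C_classM oU f2 f2).
by apply: C_class_ext => // y _; rewrite nc_sqr.
Qed.

Lemma nc2_cplx F : cplx (fun y => nc (F y) ^+ 2) = fun y => F y * conjc (F y).
Proof. by apply/funext => y; rewrite nc_conj. Qed.

Lemma DD_nc2 U z F x : open U -> CC 2 U F -> U x ->
  DD z (cplx (fun y => nc (F y) ^+ 2)) x = DD z F x * conjc (F x) + F x * conjc (DB z F x).
Proof.
move=> oU cF Ux; rewrite nc2_cplx; have dF := CC_cdiff cF Ux.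
by rewrite (DDM _ dF (CC_cdiff (CC_conj oU cF) Ux)) DD_conj.
Qed.

Lemma ell_nc2 U z F x : open U -> CC 2 U F -> U x ->
  ell z (cplx (fun y => nc (F y) ^+ 2)) x =
   ell z F x * conjc (F x) + conjc (ell z F x * conjc (F x))
   + ((nc (DD z F x) ^+ 2)%:C + (nc (DB z F x) ^+ 2)%:C).
Proof.
move=> oU cF Ux; rewrite nc2_cplx; have dF := CC_cdiff cF Ux.
rewrite (ellM _ oU cF (CC_conj oU cF) Ux) (ell_conj _ oU cF Ux) DD_conj// DB_conj//.
by rewrite -!nc_conj !conjcE [F x * _]mulrC.
Qed.

Lemma cplxD f g : cplx (fun y => f y + g y) = fun y => (f y)%:C + (g y)%:C.
Proof. by apply/funext => y; rewrite rmorphD. Qed.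

Lemma nc_nat n : nc (n%:R : R[i]) = n%:R.
Proof. by rewrite -(rmorph_nat (real_complex R)) ncR normr_nat. Qed.

Lemma Re_real (a : R) : Re a%:C = a. Proof. by []. Qed.
Lemma ReMr (a : R) z : Re (a%:C * z) = a * Re z.
Proof. by rewrite ReM /= mul0r subr0. Qed.

Lemma Re_sum4 (a b c t : R[i]) : Re (a + (b + c) + t) = Re a + (Re b + Re c) + Re t.
Proof. by rewrite !ReD. Qed.

Lemma nc_twice_diff_le (a b c : R[i]) :
  nc (2 * (conjc a * conjc b) - 2 * c) <= 2 * (nc a * nc b) + 2 * nc c.
Proof. by apply: le_trans (ncB _ _) _; rewrite !ncM nc_nat !ncJ. Qed.

Lemma ell_ln_Re U z f x : open U -> (forall y, U y -> 0 < f y) -> C_class 2 U f -> U x ->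
  Re (ell z (cplx (fun y => ln (f y))) x) =
  Re (ell z (cplx f) x) / f x - nc (DD z (cplx f) x) ^+ 2 / f x ^+ 2.
Proof.
move=> oU f0 cf Ux; rewrite (ell_ln z oU f0 cf Ux).2 DB_real nc_conj -rmorphXn/=.
by rewrite ReD ReN !ReMr Re_real exprVn mulrC [X in _ - X]mulrC.
Qed.

End Coordinates.

(** The term with [E' * D'] would carry [W' ^+ 2]; [E' * W' <= 1] removes one power of [W'], so that
    it joins the terms linear in [W' * ep * D']. *)
Lemma ell_w_inequality (R : realType) (W' E' D' X' ep K' : R) : 1 <= W' -> 0 <= E' -> E' * W' <= 1 -> 0 <= ep ->
  0 <= D' -> 0 <= K' -> X' <= (1 + W' ^+ 2) * ep ->
  W' * ep * (D' + X') + (D' * W' + W' * X') * ep +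
  (1 + W' ^+ 2) / 2 * (4 * K' + (2 * ep * W' + E' * D') * ep) <=
  W' * (3 * ep * D' + 6 * W' ^+ 2 * ep ^+ 2 + 4 * K' * W').
Proof.
move=> w1 e0 ew ep0 d0 k0 hx.
have w0 : 0 <= W' by lra.
have q : (1 + W' ^+ 2) / 2 <= W' ^+ 2 by nra.
have x2 : X' <= 2 * W' ^+ 2 * ep.
  by apply: le_trans hx _; rewrite ler_wpM2r//; nra.
have t1 : W' * ep * X' <= W' * ep * (2 * W' ^+ 2 * ep) by rewrite ler_wpM2l// mulr_ge0.
have t2 : (1 + W' ^+ 2) / 2 * (4 * K' + (2 * ep * W' + E' * D') * ep) <=
   W' ^+ 2 * (4 * K' + (2 * ep * W' + E' * D') * ep).
  by rewrite ler_wpM2r// addr_ge0// ?mulr_ge0// addr_ge0// ?mulr_ge0.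
have t3 : E' * W' * (W' * ep * D') <= W' * ep * D'.
  by rewrite -[leRHS]mul1r ler_wpM2r// !mulr_ge0.
have -> : W' * (3 * ep * D' + 6 * W' ^+ 2 * ep ^+ 2 + 4 * K' * W') =
  3 * (W' * ep * D') + 2 * (W' * ep * (2 * W' ^+ 2 * ep)) + W' ^+ 2 * (4 * K' + 2 * ep * W' * ep) by ring.
have -> : W' * ep * (D' + X') + (D' * W' + W' * X') * ep = 2 * (W' * ep * D') + 2 * (W' * ep * X') by ring.
have e1 : W' ^+ 2 * (4 * K' + (2 * ep * W' + E' * D') * ep) =
  W' ^+ 2 * (4 * K' + 2 * ep * W' * ep) + E' * W' * (W' * ep * D') by ring.
rewrite e1 in t2; clear -t1 t2 t3; move: t1 t2 t3.
move: ((1 + W' ^+ 2) / 2 * (4 * K' + (2 * ep * W' + E' * D') * ep)) => a1.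
move: (W' ^+ 2 * (4 * K' + 2 * ep * W' * ep)) (E' * W' * (W' * ep * D')) (W' * ep * D') => a2 a3 a4.
by move: (W' * ep * X') (W' * ep * (2 * W' ^+ 2 * ep)) => a5 a6; lra.
Qed.

Lemma add2_le4_trans (R : realType) (a b rho : R) : a <= b -> b <= rho -> 2 * a + 2 * b <= 4 * rho.
Proof. lra. Qed.
Lemma add2_le4 (R : realType) (a b c : R) : a <= c -> b <= c -> 2 * a + 2 * b <= 4 * c.
Proof. lra. Qed.
Lemma mul4_add4_le8 (R : realType) (a : R) : a <= 1 -> 4 * a + 4 <= 8.
Proof. lra. Qed.
Lemma ell_test_inequality (R : realType) (p q s t p' q' w2 E2 re B : R) :
  p' <= p -> - q' <= s - t -> - B <= re -> 0 <= E2 ->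
  p - q + (s - t + (s - t)) + (2 * re + (4 * w2 + 4 * E2)) <= 0 ->
  p' - q - 2 * q' + 4 * w2 - 2 * B <= 0.
Proof. lra. Qed.

(** * Pointwise bounds and the maximum principle for [w] *)

Section StepA.
Context (R : realType).
Local Notation V := 'rV[R]_2.
Variables (U : set V) (T e Th : V -> R) (G w P : V -> R[i]).
Hypothesis S : phase_system U T e Th G w P.
Variables (rho A K eps : R) (x : V).
Local Notation z := ((e x)%:C * w x).
Local Notation W := (nc (w x)).
Local Notation E := `|e x|.
Hypotheses (Ux : U x) (W1 : 1 <= W) (eps0 : 0 <= eps) (K0 : 0 <= K).
Hypotheses (hA : nc (P x) <= A) (hth : nc (dz (cplx Th) x) <= eps).
Hypotheses (hK1 : nc (DB z (dz (cplx Th)) x) <= 2 * K) (hK2 : nc (DB z (db (cplx Th)) x) <= 2 * K).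
Local Notation X := (nc (DD z w x)).
Local Notation D := (nc (DB z w x)).

Lemma abs_e_nc_w_le1 : E * W <= 1.
Proof. by have := ltW (ps_lt1 S Ux); rewrite ncM ncR. Qed.

Lemma abs_e_le1 : E <= 1.
Proof. by apply: le_trans abs_e_nc_w_le1; rewrite ler_peMr. Qed.

Lemma zeta_le1 : nc z <= 1. Proof. exact: ltW (ps_lt1 S Ux). Qed.

Lemma db_phase_small : nc (db (cplx Th) x) <= eps.
Proof. by rewrite db_real ncJ. Qed.

Lemma DB_phase_small : nc (DB z (cplx Th) x) <= 2 * eps.
Proof.
apply: le_trans (ncB _ _) _; rewrite ncM mulr_natl mulr2n; apply: lerD => //.
by rewrite -[leRHS]mul1r ler_pM ?nc_ge0// ?zeta_le1// db_phase_small.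
Qed.

Lemma nc_half (c : R[i]) : nc (c / 2) = nc c / 2.
Proof. by rewrite ncM ncV nc_nat. Qed.

Lemma nc_one_plus_nc2 : nc (1 + w x * conjc (w x)) = 1 + W ^+ 2.
Proof.
rewrite nc_conj (_ : 1 + _ = (1 + W ^+ 2)%:C); last by rewrite rmorphD rmorph1.
by rewrite ncR ger0_norm// addr_ge0// sqr_ge0.
Qed.

Lemma DD_w_small : X <= (1 + W ^+ 2) * eps.
Proof.
rewrite (DD_w S Ux) ncM nc_half nc_one_plus_nc2.
apply: le_trans (ler_wpM2l _ DB_phase_small) _; first by rewrite divr_ge0// addr_ge0// sqr_ge0.
by rewrite le_eqVlt; apply/orP; left; apply/eqP; field.
Qed.

Lemma phase_source_small : nc (conjc (w x) * dz (cplx Th) x + (e x)%:C * db (cplx Th) x) <= 2 * W * eps.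
Proof.
apply: le_trans (ncD _ _) _; rewrite !ncM ncJ ncR -mulrA mulr_natl mulr2n; apply: lerD.
  by rewrite ler_wpM2l// nc_ge0.
by apply: ler_pM; rewrite ?nc_ge0 ?db_phase_small//; exact: le_trans abs_e_le1 W1.
Qed.

Lemma DB_e_small : nc (DB z (cplx e) x) <= 2 * eps.
Proof.
rewrite (DB_e S Ux) ncM ncR.
have c1 : `|(1 + e x ^+ 2) / 2| <= 1.
  rewrite ger0_norm; last by rewrite divr_ge0// addr_ge0// sqr_ge0.
  rewrite ler_pdivrMr// mul1r -[leRHS]/(1 + 1) lerD2l -real_normK ?num_real//.
  by rewrite expr_le1// abs_e_le1.
by rewrite -[leRHS]mul1r ler_pM ?nc_ge0// DB_phase_small.
Qed.

Lemma DB_zeta_small : nc (DB z (fun y => (e y)%:C * w y) x) <= 2 * eps * W + E * D.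
Proof.
rewrite (DBM _ (CC_cdiff (CC_real (ps_e S)) Ux) (CC_cdiff (ps_w S) Ux)).
apply: le_trans (ncD _ _) _; rewrite !ncM ncR; apply: lerD => //.
by rewrite ler_wpM2r ?nc_ge0// DB_e_small.
Qed.

Lemma ell_w_small : nc (ell z w x) <= W * (3 * eps * D + 6 * W ^+ 2 * eps ^+ 2 + 4 * K * W).
Proof.
apply: le_trans _ (ell_w_inequality W1 (normr_ge0 (e x)) abs_e_nc_w_le1 eps0 (nc_ge0 _) K0 DD_w_small).
rewrite (ell_w S Ux).
apply: le_trans (ncD _ _) (lerD (le_trans (ncD _ _) (lerD _ _)) _).
- rewrite ncM nc_half; apply: ler_pM; rewrite ?divr_ge0 ?nc_ge0//.
    by rewrite ler_pdivrMr// (_ : W * eps * 2 = 2 * W * eps) ?phase_source_small//; ring.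
  apply: le_trans (ncD _ _) _; rewrite lerD2l ncM -[leRHS]mul1r.
  by rewrite ler_wpM2r ?nc_ge0// zeta_le1.
- rewrite ncM nc_half (_ : _ * eps = ((D * W + W * X) / 2) * (2 * eps)); last by field.
  apply: ler_pM; rewrite ?divr_ge0 ?nc_ge0 ?DB_phase_small// ler_pM2r ?invr_gt0//.
  by apply: le_trans (ncD _ _) _; rewrite !ncM !ncJ.
- rewrite ncM nc_half nc_one_plus_nc2 ler_wpM2l//; first by rewrite divr_ge0// addr_ge0// sqr_ge0.
  apply: le_trans (ncB _ _) _; rewrite (_ : 4 * K = 2 * K + 2 * K); last by ring.
  rewrite [leRHS]addrAC; apply: lerD.
    apply: le_trans (ncB _ _) _; apply: lerD => //.
    by rewrite ncM; apply: ler_pM; rewrite ?nc_ge0 ?DB_zeta_small ?db_phase_small.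
  by rewrite ncM -[leRHS]mul1r; apply: ler_pM; rewrite ?nc_ge0 ?zeta_le1.
Qed.

Lemma ell_P_small : nc (ell z P x) <= 8 * W ^+ 2 * eps.
Proof.
have W0 : 0 <= W by exact: nc_ge0.
have hq : 1 + W ^+ 2 <= 2 * W ^+ 2.
  by rewrite mulr_natl mulr2n lerD2r -(expr1n _ 2) ler_pXn2r// nnegrE.
rewrite (ell_P S Ux); apply: le_trans (ncD _ _) _.
rewrite (_ : 8 * W ^+ 2 * eps = 4 * W ^+ 2 * eps + 2 * (2 * W ^+ 2 * eps)); last by ring.
apply: lerD.
  rewrite !ncM ncR nc_one_plus_nc2.
  apply: (@le_trans _ _ (E * (2 * W ^+ 2) * (2 * W * eps))).
    apply: ler_pM; rewrite ?mulr_ge0 ?nc_ge0 ?phase_source_small ?addr_ge0 ?sqr_ge0//.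
    by rewrite ler_wpM2l.
  rewrite (_ : _ * _ = (E * W) * (4 * W ^+ 2 * eps)); last by ring.
  by rewrite -[leRHS]mul1r ler_wpM2r ?abs_e_nc_w_le1// !mulr_ge0 ?sqr_ge0.
rewrite ncM nc_nat ncJ ler_pM2l//; apply: le_trans DD_w_small _.
by rewrite ler_wpM2r.
Qed.

Local Notation et := (rho ^+ 2 - nc (xc x) ^+ 2).

(** The maximum is that of the logarithm of the test function, to which the three factors contribute
    additively. What remains after evaluating the operators on each summand is
    [w_bound_inequality]. *)
Lemma w_bound_at_max :
  (forall y, U y -> nc (xc y) < rho) -> 28 * eps ^+ 2 + 80 * A * eps <= 1 ->
  (forall y, U y -> ln (1 + nc (w y) ^+ 2) + (ln (rho ^+ 2 - nc (xc y) ^+ 2)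
      + ln (rho ^+ 2 - nc (xc y) ^+ 2)) + nc (P y) ^+ 2 <=
    ln (1 + W ^+ 2) + (ln (rho ^+ 2 - nc (xc x) ^+ 2)
      + ln (rho ^+ 2 - nc (xc x) ^+ 2)) + nc (P x) ^+ 2) ->
  3 * (W * et) ^+ 2 <= 128 * eps * rho * (W * et) + 8 * K * et * (W * et) + 16 * et + 32 * rho ^+ 2.
Proof.
move=> hr small fmax.
have oU := ps_open S.
have A0 : 0 <= A by apply: le_trans hA; exact: nc_ge0.
have W0 : 0 <= W by exact: nc_ge0.
have rho0 : 0 < rho by apply: le_lt_trans (hr _ Ux); exact: nc_ge0.
pose h1 y := 1 + nc (w y) ^+ 2; pose h2 y := rho ^+ 2 - nc (xc y) ^+ 2.
pose h3 y := nc (P y) ^+ 2.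
have h10 y : U y -> 0 < h1 y by move=> _; rewrite ltr_pwDl// sqr_ge0.
have h20 y : U y -> 0 < h2 y.
  by move=> Uy; rewrite subr_gt0 ltr_pXn2r ?nnegrE ?nc_ge0 ?hr// ltW.
have c1 : C_class 2 U h1 := C_classD oU (C_class_cst 2 U 1) (C_class_nc2 oU (ps_w S)).
have cx := C_class_nc2 oU (@CC_xc R 2 U).
have c2 : C_class 2 U h2 := C_classB oU (C_class_cst 2 U (rho ^+ 2)) cx.
have c3 : C_class 2 U h3 := C_class_nc2 oU (ps_P S).
have k1 := C_class_ln oU h10 c1; have k2 := C_class_ln oU h20 c2.
have k22 := C_classD oU k2 k2; have k12 := C_classD oU k1 k22.
pose f y := ln (h1 y) + (ln (h2 y) + ln (h2 y)) + h3 y.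
have [DD0 ell0] := ell_max (f := f) z oU (C_classD oU k12 c3) Ux fmax.
have Ef : cplx f = fun y => (ln (h1 y))%:C + ((ln (h2 y))%:C + (ln (h2 y))%:C) + (h3 y)%:C.
  by apply/funext => y; rewrite /f !rmorphD.
rewrite {}Ef in DD0 ell0; move: DD0 ell0.
have K1 := CC_real k1; have K2 := CC_real k2; have K3 := CC_real c3.
have K22 := CCD oU K2 K2; have K12 := CCD oU K1 K22.
have dd k F (cF : CC k.+1 U F) := CC_cdiff cF Ux.
rewrite (DDD _ (dd _ _ K12) (dd _ _ K3)) (DDD _ (dd _ _ K1) (dd _ _ K22)) (DDD _ (dd _ _ K2) (dd _ _ K2)).
rewrite (ellD _ oU K12 K3 Ux) (ellD _ oU K1 K22 Ux) (ellD _ oU K2 K2 Ux) Re_sum4.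
rewrite (ell_ln_Re _ oU h10 c1 Ux) (ell_ln_Re _ oU h20 c2 Ux).
rewrite (ell_ln z oU h10 c1 Ux).1 (ell_ln z oU h20 c2 Ux).1.
have e1 : DD z (cplx h1) x = DD z w x * conjc (w x) + w x * conjc (DB z w x).
  rewrite /h1 cplxD (DDD _ (cdiff_cst _ _) (dd _ _ (CC_real (C_class_nc2 oU (ps_w S))))).
  by rewrite DD_cst add0r (DD_nc2 _ oU (ps_w S) Ux).
have e2 : Re (ell z (cplx h1) x) = 2 * Re (ell z w x * conjc (w x)) + (X ^+ 2 + D ^+ 2).
  rewrite /h1 cplxD (ellD _ oU (CC_cst _ _ _) (CC_real (C_class_nc2 oU (ps_w S))) Ux).
  rewrite ell_cst add0r (ell_nc2 _ oU (ps_w S) Ux) !ReD Re_conjc !Re_real.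
  by rewrite mulr_natl mulr2n.
have cNx : CC 2 U (cplx (fun y => - nc (xc y) ^+ 2)) := CC_real (C_classN oU cx).
have cNx' : cplx (fun y => - nc (xc y) ^+ 2) = fun y : V => (-1 : R)%:C * (nc (xc y) ^+ 2)%:C.
  by apply/funext => y; rewrite -rmorphM mulN1r.
have e3 : DD z (cplx h2) x = 2 * (conjc z * conjc (xc x)) - 2 * xc x.
  rewrite /h2 cplxD (DDD _ (cdiff_cst _ _) (dd _ _ cNx)) DD_cst add0r cNx'.
  rewrite (DDM _ (cdiff_cst _ _) (dd _ _ (CC_real cx))) DD_cst mul0r add0r.
  rewrite (DD_nc2 _ oU (@CC_xc R 2 U) Ux) DD_xc DB_xc conjc_nat rmorphN rmorph1.
  by move: (conjc z) (conjc (xc x)) (xc x) => a b c; clear; ring.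
have e4 : Re (ell z (cplx h2) x) = - (4 * nc z ^+ 2 + 4).
  rewrite /h2 cplxD (ellD _ oU (CC_cst _ _ _) cNx Ux) ell_cst add0r cNx'.
  rewrite (ellM _ oU (CC_cst 2 U _) (CC_real cx) Ux) ell_cst DD_cst DB_cst !mul0r !add0r addr0.
  rewrite ReMr (ell_nc2 _ oU (@CC_xc R 2 U) Ux) ell_xc mul0r conjc0 !add0r ReD !Re_real.
  rewrite DD_xc DB_xc ncN ncM !nc_nat ncJ; move: (nc z) => a; clear; ring.
have e5 : DD z (cplx h3) x = 2 * conjc (w x) * conjc (P x) + P x * (2 * (e x)%:C).
  by rewrite (DD_nc2 _ oU (ps_P S) Ux) (DD_P S Ux) (DB_P S Ux) conjcM conjc_nat conjcR.
have e6 : Re (ell z (cplx h3) x) = 2 * Re (ell z P x * conjc (P x)) + (4 * W ^+ 2 + 4 * E ^+ 2).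
  rewrite (ell_nc2 _ oU (ps_P S) Ux) !ReD Re_conjc !Re_real (DD_P S Ux) (DB_P S Ux).
  rewrite [nc (2 * conjc _)]ncM [nc (2 * _%:C)]ncM nc_nat ncJ ncR.
  by move: (Re _) (nc (w x)) `|e x| => a b c; ring.
rewrite e2 e4 e6 e1 e3 e5.
set NVc := DD z w x * conjc (w x) + w x * conjc (DB z w x) => DD0 ell0.
have n1 : nc (2 * (conjc z * conjc (xc x)) - 2 * xc x) <= 4 * rho.
  apply: le_trans (nc_twice_diff_le _ _ _) _.
  have hx : nc (xc x) <= rho by exact/ltW/hr.
  have hz : nc z * nc (xc x) <= nc (xc x) by rewrite -[leRHS]mul1r ler_wpM2r ?nc_ge0// zeta_le1.
  exact: add2_le4_trans.
have n2 : nc (2 * conjc (w x) * conjc (P x) + P x * (2 * (e x)%:C)) <= 4 * A * W.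
  apply: le_trans (ncD _ _) _; rewrite !ncM nc_nat !ncJ ncR.
  have t1 : W * nc (P x) <= A * W by rewrite [leRHS]mulrC ler_wpM2l.
  have t2 : nc (P x) * E <= A * W.
    by apply: ler_pM; rewrite ?nc_ge0//; exact: le_trans abs_e_le1 W1.
  rewrite -[2 * W * _]mulrA [nc (P x) * (2 * E)]mulrCA -[4 * A * W]mulrA.
  exact: add2_le4.
have et0 : 0 < et by exact: h20.
apply: (@w_bound_inequality R W E D X (nc (ell z w x)) (nc (ell z P x)) et rho A K eps (nc NVc)) => //.
- exact: abs_e_nc_w_le1.
- exact: nc_ge0.
- exact: nc_ge0.
- exact: nc_ge0.
- exact: DD_w_small.
- exact: ell_w_small.
- exact: ell_P_small.
- have Hq : 0 < 1 + W ^+ 2 := h10 _ Ux.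
  (* The vanishing gradient, solved for the part that comes from [|w|^2]. *)
  have EN : NVc = ((1 + W ^+ 2)%:C) * - (2 * (((et)^-1)%:C * (2 * (conjc z * conjc (xc x)) - 2 * xc x))
     + (2 * conjc (w x) * conjc (P x) + P x * (2 * (e x)%:C))).
    move: DD0; rewrite /h1 /h2 => DD0.
    have hc : (1 + W ^+ 2)%:C * ((1 + W ^+ 2)^-1)%:C = 1 :> R[i].
      by rewrite -rmorphM mulfV ?rmorph1// gt_eqF.
    transitivity ((1 + W ^+ 2)%:C * (((1 + W ^+ 2)^-1)%:C * NVc)); first by rewrite mulrA hc mul1r.
    congr (_ * _); apply/eqP; rewrite -subr_eq0 opprK -DD0.
    by apply/eqP; ring.
  rewrite EN ncM ncR ger0_norm ?(ltW Hq)// ler_pM2l// ncN.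
  apply: le_trans (ncD _ _) _; apply: lerD => //.
  rewrite !ncM nc_nat ncR ger0_norm ?invr_ge0 ?(ltW et0)//.
  rewrite (_ : 8 * rho / et = 2 * (et^-1 * (4 * rho))); last by ring.
  by rewrite ler_pM2l// ler_pM2l ?invr_gt0.
- rewrite -[D]ncJ -ncM (_ : w x * conjc (DB z w x) = NVc - DD z w x * conjc (w x)).
    by apply: le_trans (ncB _ _) _; rewrite ncM ncJ.
  by rewrite /NVc; ring.
- apply: le_trans (ncD _ _) _; rewrite !ncM !ncJ; move: (nc _) (nc _) (nc _) => a b c.
  by rewrite le_eqVlt; apply/orP; left; apply/eqP; ring.
- have r1 : - (W * nc (ell z w x)) <= Re (ell z w x * conjc (w x)).
    have := nc_Re (ell z w x * conjc (w x)); rewrite ncM ncJ ler_norml => /andP[+ _].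
    by rewrite mulrC.
  have r2 : - (A * nc (ell z P x)) <= Re (ell z P x * conjc (P x)).
    have := nc_Re (ell z P x * conjc (P x)); rewrite ncM ncJ ler_norml => /andP[+ _].
    by apply: le_trans; rewrite lerN2 mulrC ler_wpM2r// nc_ge0.
  have Hq : 0 < 1 + W ^+ 2 := h10 _ Ux.
  have r3 : (- 2 * W * nc (ell z w x) + X ^+ 2 + D ^+ 2) / (1 + W ^+ 2) <=
     (2 * Re (ell z w x * conjc (w x)) + (X ^+ 2 + D ^+ 2)) / h1 x.
    by rewrite ler_pM2r ?invr_gt0// -addrA lerD2r -mulrA mulNr -mulrN ler_pM2l.
  have r4 : - (8 / et + 16 * rho ^+ 2 / et ^+ 2) <=
     - (4 * nc z ^+ 2 + 4) / h2 x - nc (2 * (conjc z * conjc (xc x)) - 2 * xc x) ^+ 2 / h2 x ^+ 2.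
    rewrite mulNr -opprD lerN2; apply: lerD.
      rewrite ler_pM2r ?invr_gt0//.
      by apply: mul4_add4_le8; rewrite expr_le1 ?nc_ge0// zeta_le1.
    rewrite ler_pM2r ?invr_gt0 ?exprn_gt0// (_ : 16 * rho ^+ 2 = (4 * rho) ^+ 2); last by ring.
    by rewrite ler_pXn2r// nnegrE ?nc_ge0// mulr_ge0// ltW.
  have r5 : 0 <= E ^+ 2 by exact: sqr_ge0.
  rewrite -[2 * A * _]mulrA; exact: ell_test_inequality r3 r4 r2 r5 ell0.
Qed.

End StepA.

(** * The maximum of the test function for zeta *)

(** Here [n] is [|DD f| / f], [Y] is [e + 1/e], and [q], [p] are the squared moduli of [DD et] and
    [DD y]. A quarter of [n ^+ 2] pays for [C1 * n]; by [hN] the rest is at least, up to a constant,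
    3/8 of its left side, that is [864 et^2 / chi^2 + (3/2) m^2 y^2]. The cutoff costs exactly 864 =
    48 * 9 + 2 * 24 * 9 of the first quantity, the term with [C2] is covered by the second, and
    [m * p] is left over to bound [m]. *)
Lemma weight_le_inequality (R : realType) (n y Y et chi rho m C1 C2 T1 q p : R) :
  0 < chi -> 0 < rho -> chi = rho ^+ 2 - et ^+ 2 -> 0 <= C1 -> 0 <= C2 ->
  m ^+ 2 * y ^+ 2 * Y ^+ 2 + 2304 * et ^+ 2 / chi ^+ 2 <= (n + 1) ^+ 2 ->
  4 <= Y ^+ 2 -> T1 <= 1 -> q <= 9 -> 1 <= p -> 0 <= m ->
  n ^+ 2 - C1 * n - C1 - T1 - 24 * q / chi - 48 * et ^+ 2 * q / chi ^+ 2 + m * p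
     - m * (C2 * `|y|) <= 0 ->
  m <= C1 ^+ 2 + C1 + 2 + C2 ^+ 2 + 432 / rho ^+ 2.
Proof.
move=> chi0 rho0 Echi C10 C20 hN hY hT hq hp m0 main.
have r2 : 0 < rho ^+ 2 by rewrite exprn_gt0.
have c2 : 0 < chi ^+ 2 by rewrite exprn_gt0.
have k1 : 24 * q / chi <= 216 / chi.
  by rewrite ler_pM2r ?invr_gt0// (_ : 216 = 24 * 9); [rewrite ler_pM2l|ring].
have k2 : 48 * et ^+ 2 * q / chi ^+ 2 <= 432 * (et ^+ 2 / chi ^+ 2).
  rewrite mulrA ler_pM2r ?invr_gt0// (_ : 432 * et ^+ 2 = 48 * et ^+ 2 * 9); last by ring.
  by rewrite ler_wpM2l// mulr_ge0// sqr_ge0.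
(* With [r = rho ^+ 2] and [et ^+ 2 = r - chi] this is [2 r^2 - 3 chi r + 2 chi^2 >= 0], a form of
   negative discriminant: if [chi] is small then [et] is not. *)
have k3 : 216 / chi <= 432 * (et ^+ 2 / chi ^+ 2) + 432 / rho ^+ 2.
  rewrite -subr_ge0.
  have -> : 432 * (et ^+ 2 / chi ^+ 2) + 432 / rho ^+ 2 - 216 / chi =
    216 * (2 * et ^+ 2 * rho ^+ 2 + 2 * chi ^+ 2 - chi * rho ^+ 2) / (chi ^+ 2 * rho ^+ 2).
    by field; rewrite !gt_eqF.
  rewrite divr_ge0 ?mulr_ge0 ?ltW//.
  have -> : et ^+ 2 = rho ^+ 2 - chi by rewrite Echi; ring.
  move: r2; move: (rho ^+ 2) => r; clear => r2.
  have := sqr_ge0 (chi - 3 / 4 * r); have := sqr_ge0 r; nra.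
have k4 : m * p >= m by rewrite -[leLHS]mulr1 ler_wpM2l.
have k5 : m * (C2 * `|y|) <= 3 / 2 * (m ^+ 2 * y ^+ 2) + C2 ^+ 2.
  have := sqr_ge0 (m * `|y| - C2 / 2); have := sqr_ge0 (m * `|y|).
  have := sqr_ge0 C2.
  rewrite -(real_normK (num_real y)) -exprMn; move: `|y| => t; rewrite !expr2; clear; lra.
have k6 : 4 * (m ^+ 2 * y ^+ 2) <= m ^+ 2 * y ^+ 2 * Y ^+ 2.
  by rewrite mulrC ler_wpM2l// mulr_ge0// sqr_ge0.
have k7 : (n + 1) ^+ 2 <= 2 * n ^+ 2 + 2.
  by have := sqr_ge0 (n - 1); rewrite !expr2; clear; lra.
have k8 : C1 * n <= 1 / 4 * n ^+ 2 + C1 ^+ 2.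
  by have := sqr_ge0 (1 / 2 * n - C1); rewrite !expr2; clear; lra.
rewrite -[2304 * _ / _]mulrA in hN.
clear -main k1 k2 k3 k4 k5 k6 k7 k8 hN hT.
move: main k1 k2 k3 k4 k5 k6 k7 k8 hN hT.
move: (24 * q / chi) (48 * et ^+ 2 * q / chi ^+ 2) (et ^+ 2 / chi ^+ 2) => a1 a2 a3.
move: (216 / chi) (432 / rho ^+ 2) (m * (C2 * `|y|)) (m * p) => a4 a5 a6 a7.
move: (m ^+ 2 * y ^+ 2 * Y ^+ 2) (m ^+ 2 * y ^+ 2) (C1 * n) => a8 a9 a10.
move: (n ^+ 2) (C1 ^+ 2) (C2 ^+ 2) ((n + 1) ^+ 2) => a11 a12 a13 a14.
lra.
Qed.

Lemma nc_i (R : realType) : nc ('i : R[i]) = 1.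
Proof. by rewrite /nc /Normc.normc expr0n add0r expr1n sqrtr1. Qed.

(** * Real parts, cutoffs and linear combinations under the operators *)

Section LinearReal.
Context (R : realType).
Local Notation V := 'rV[R]_2.
Implicit Types (F : V -> R[i]) (f : V -> R) (U : set V) (x : V) (z c : R[i]).

Lemma C_class_Re k U c F : open U -> CC k U F -> C_class k U (fun y => Re (c * F y)).
Proof. by move=> oU cF; exact: (CCM oU (CC_cst k U c) cF).1. Qed.

Lemma Re_cplx c F : cplx (fun y => Re (c * F y)) =
  fun y => 2^-1 * (c * F y + conjc (c * F y)).
Proof.
by apply/funext => y; rewrite addcJ mulrA mulVf ?mul1r// cplx2_neq0.
Qed.

Lemma DD_Re U z c F x : open U -> CC 2 U F -> U x ->
  DD z (cplx (fun y => Re (c * F y))) x =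
  2^-1 * (c * DD z F x + conjc c * conjc (DB z F x)).
Proof.
move=> oU cF Ux; have ccF := CCM oU (CC_cst 2 U c) cF.
have dF := CC_cdiff cF Ux; have dcF := CC_cdiff ccF Ux.
have dcJ := CC_cdiff (CC_conj oU ccF) Ux.
rewrite Re_cplx (DDM _ (cdiff_cst _ _) (CC_cdiff (CCD oU ccF (CC_conj oU ccF)) Ux)) DD_cst mul0r add0r.
rewrite (DDD _ dcF dcJ) (DD_conj _ dcF) (DDM _ (cdiff_cst _ _) dF) (DBM _ (cdiff_cst _ _) dF).
by rewrite DD_cst DB_cst !mul0r !add0r conjcM.
Qed.

Lemma ell_Re U z c F x : open U -> CC 2 U F -> U x ->
  Re (ell z (cplx (fun y => Re (c * F y))) x) = Re (c * ell z F x).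
Proof.
move=> oU cF Ux; have ccF := CCM oU (CC_cst 2 U c) cF.
have cc2 := CC_conj oU ccF.
rewrite Re_cplx (ellM _ oU (CC_cst 2 U _) (CCD oU ccF cc2) Ux) ell_cst DD_cst DB_cst.
rewrite !mul0r !add0r addr0 (ellD _ oU ccF cc2 Ux) (ell_conj _ oU ccF Ux).
rewrite (ellM _ oU (CC_cst 2 U c) cF Ux) ell_cst DD_cst DB_cst !mul0r !add0r addr0 addcJ.
by rewrite mulrA mulVf ?mul1r ?Re_real// cplx2_neq0.
Qed.

Lemma C_class_cut k U rho f : open U -> C_class k U f -> C_class k U (fun y => rho ^+ 2 - f y ^+ 2).
Proof.
move=> oU cf; have := C_classB oU (C_class_cst k U (rho ^+ 2)) (C_classM oU cf cf).
by apply: C_class_ext => // y _; rewrite [f y ^+ 2]expr2.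
Qed.

Lemma DD_sqr U z f x : open U -> C_class 2 U f -> U x ->
  DD z (cplx (fun y => f y ^+ 2)) x = (2 * f x)%:C * DD z (cplx f) x.
Proof.
move=> oU cf Ux; have d := CC_cdiff (CC_real cf) Ux.
have -> : cplx (fun y => f y ^+ 2) = fun y => (f y)%:C * (f y)%:C.
  by apply/funext => y; rewrite rmorphXn expr2.
rewrite (DDM _ d d) rmorphM rmorph_nat; ring.
Qed.

Lemma ell_sqr U z f x : open U -> C_class 2 U f -> U x ->
  Re (ell z (cplx (fun y => f y ^+ 2)) x) =
    2 * (f x * Re (ell z (cplx f) x)) + 2 * nc (DD z (cplx f) x) ^+ 2.
Proof.
move=> oU cf Ux; have c := CC_real cf.
have -> : cplx (fun y => f y ^+ 2) = fun y => (f y)%:C * (f y)%:C.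
  by apply/funext => y; rewrite rmorphXn expr2.
rewrite (ellM _ oU c c Ux) DB_real [conjc _ * _]mulrC nc_conj [ell _ _ _ * _]mulrC.
by rewrite ReD ReD ReD !ReMr !Re_real; ring.
Qed.

Lemma DD_cut U z rho f x : open U -> C_class 2 U f -> U x ->
  DD z (cplx (fun y => rho ^+ 2 - f y ^+ 2)) x = - ((2 * f x)%:C * DD z (cplx f) x).
Proof.
move=> oU cf Ux; have c2 := CC_real (C_classM oU cf cf).
have -> : cplx (fun y => rho ^+ 2 - f y ^+ 2) = fun y => (rho ^+ 2)%:C + (-1) * (f y ^+ 2)%:C.
  by apply/funext => y; rewrite rmorphB/= mulN1r.
have cs : CC 2 U (cplx (fun y => f y ^+ 2)) by [].
have d := CC_cdiff cs Ux.
rewrite (DDD _ (cdiff_cst _ _) (CC_cdiff (CCM oU (CC_cst 2 U (-1)) cs) Ux)) DD_cst add0r.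
by rewrite (DDM _ (cdiff_cst _ _) d) DD_cst mul0r add0r mulN1r (DD_sqr _ oU cf Ux).
Qed.

Lemma ell_cut U z rho f x : open U -> C_class 2 U f -> U x -> Re (ell z (cplx f) x) = 0 ->
  Re (ell z (cplx (fun y => rho ^+ 2 - f y ^+ 2)) x) = - (2 * nc (DD z (cplx f) x) ^+ 2).
Proof.
move=> oU cf Ux e0; have c2 := CC_real (C_classM oU cf cf).
have -> : cplx (fun y => rho ^+ 2 - f y ^+ 2) = fun y => (rho ^+ 2)%:C + (-1) * (f y ^+ 2)%:C.
  by apply/funext => y; rewrite rmorphB/= mulN1r.
have cs : CC 2 U (cplx (fun y => f y ^+ 2)) by [].
rewrite (ellD _ oU (CC_cst 2 U _) (CCM oU (CC_cst 2 U (-1)) cs) Ux) ell_cst add0r.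
rewrite (ellM _ oU (CC_cst 2 U _) cs Ux) ell_cst DD_cst DB_cst !mul0r !add0r addr0.
by rewrite mulN1r ReN (ell_sqr _ oU cf Ux) e0 mulr0 mulr0 add0r.
Qed.

End LinearReal.

Section Scale.
Context (R : realType).
Local Notation V := 'rV[R]_2.
Implicit Types (f g : V -> R) (U : set V) (x : V) (z : R[i]).

Lemma DD_comb U z (a b : R) f g x : open U -> C_class 2 U f -> C_class 2 U g -> U x ->
  DD z (cplx (fun y => a * f y + b * g y)) x =
  a%:C * DD z (cplx f) x + b%:C * DD z (cplx g) x.
Proof.
move=> oU cf cg Ux; have ccf := CC_real cf; have ccg := CC_real cg.
have -> : cplx (fun y => a * f y + b * g y) = fun y => a%:C * (f y)%:C + b%:C * (g y)%:C.
  by apply/funext => y; rewrite rmorphD !rmorphM.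
have caf := CCM oU (CC_cst 2 U a%:C) ccf; have cbg := CCM oU (CC_cst 2 U b%:C) ccg.
rewrite (DDD _ (CC_cdiff caf Ux) (CC_cdiff cbg Ux)).
rewrite (DDM _ (cdiff_cst _ _) (CC_cdiff ccf Ux)) (DDM _ (cdiff_cst _ _) (CC_cdiff ccg Ux)).
by rewrite !DD_cst !mul0r !add0r.
Qed.

Lemma ell_comb U z (a b : R) f g x : open U -> C_class 2 U f -> C_class 2 U g -> U x ->
  Re (ell z (cplx (fun y => a * f y + b * g y)) x) =
  a * Re (ell z (cplx f) x) + b * Re (ell z (cplx g) x).
Proof.
move=> oU cf cg Ux; have ccf := CC_real cf; have ccg := CC_real cg.
have -> : cplx (fun y => a * f y + b * g y) = fun y => a%:C * (f y)%:C + b%:C * (g y)%:C.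
  by apply/funext => y; rewrite rmorphD !rmorphM.
have caf := CCM oU (CC_cst 2 U a%:C) ccf; have cbg := CCM oU (CC_cst 2 U b%:C) ccg.
rewrite (ellD _ oU caf cbg Ux) (ellM _ oU (CC_cst 2 U _) ccf Ux) (ellM _ oU (CC_cst 2 U _) ccg Ux).
by rewrite !ell_cst !DD_cst !DB_cst !mul0r !add0r !addr0 ReD !ReMr.
Qed.

End Scale.

(** In these constants [Kb] bounds [|e|] and [1 / |e|], hence also [|w|], and [K] bounds the first
    derivatives of the phase; its second-order terms are bounded by [2 * K]. *)
Definition source_const (R : realType) (Kb K : R) : R := 2 * Kb * K.
Definition second_order_const (R : realType) (Kb K : R) : R :=
  source_const Kb K ^+ 2 + Kb ^+ 2 * K ^+ 2 * (1 + Kb ^+ 2) + 4 * Kb * K + (1 + Kb ^+ 2) * K ^+ 2.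
Definition ell_f_const (R : realType) (Kb K : R) : R :=
  4 * source_const Kb K + (2 * source_const Kb K ^+ 2 + second_order_const Kb K).
Definition ell_P_const (R : realType) (Kb K : R) : R :=
  Kb * (1 + Kb ^+ 2) * source_const Kb K + 2 * ((1 + Kb ^+ 2) * K).

Lemma ell_one_minus_Re_inequality (R : realType) (Kb K b f D X NDf L : R) :
  0 <= b -> 0 <= f -> 0 <= Kb -> 0 <= K -> 0 <= D -> 0 <= NDf ->
  b = source_const Kb K -> f <= 2 -> X <= f * b -> D <= 2 * NDf + X ->
  L <= b * (D + X) + f * ((Kb * (D + (1 + Kb ^+ 2) * K * Kb)) * K + Kb * (2 * K)
    + (1 + Kb ^+ 2) * K * K + Kb * (2 * K)) ->
  L <= ell_f_const Kb K * (f + NDf).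
Proof.
move=> source_const_ge0 f0 kb0 k0 d0 n0 bE f2 hX hD hL; apply: le_trans hL _.
rewrite /ell_f_const /second_order_const -bE.
have -> : b * (D + X) + f * (Kb * (D + (1 + Kb ^+ 2) * K * Kb) * K + Kb * (2 * K) +
    (1 + Kb ^+ 2) * K * K + Kb * (2 * K)) =
  b * D + b * X + f * (Kb * K * D) + f * (Kb ^+ 2 * K ^+ 2 * (1 + Kb ^+ 2) + 4 * Kb * K + (1 + Kb ^+ 2) * K ^+ 2) by ring.
set M := Kb ^+ 2 * K ^+ 2 * (1 + Kb ^+ 2) + 4 * Kb * K + (1 + Kb ^+ 2) * K ^+ 2.
have -> : 4 * b + (2 * b ^+ 2 + (b ^+ 2 + Kb ^+ 2 * K ^+ 2 * (1 + Kb ^+ 2) + 4 * Kb * K + (1 + Kb ^+ 2) * K ^+ 2))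
  = 4 * b + 3 * b ^+ 2 + M by rewrite /M; ring.
have M0 : 0 <= M.
  by rewrite /M addr_ge0// ?addr_ge0// ?mulr_ge0// ?addr_ge0// ?mulr_ge0// ?sqr_ge0.
have t1 : f * (Kb * K * D) <= b * D.
  rewrite bE /source_const (_ : 2 * Kb * K * D = 2 * (Kb * K * D)); last by ring.
  by rewrite ler_wpM2r// !mulr_ge0.
have t2 : b * X <= b * (f * b) by rewrite ler_wpM2l.
have t3 : b * D <= b * (2 * NDf + f * b).
  by rewrite ler_wpM2l//; apply: le_trans hD _; rewrite lerD2l.
have t5 : 0 <= b ^+ 2 * NDf by rewrite mulr_ge0// sqr_ge0.
have t6 : 0 <= M * NDf by rewrite mulr_ge0.
have t7 : 0 <= b * f by rewrite mulr_ge0.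
rewrite (_ : (4 * b + 3 * b ^+ 2 + M) * (f + NDf) = 4 * (b * f) + 4 * (b * NDf)
  + 3 * (b * (f * b)) + 3 * (b ^+ 2 * NDf) + f * M + M * NDf); last by ring.
rewrite (_ : b * (2 * NDf + f * b) = 2 * (b * NDf) + b * (f * b)) in t3; last by ring.
clear -t1 t2 t3 t5 t6 t7; move: t1 t2 t3 t5 t6 t7.
move: (f * (Kb * K * D)) (b * D) (b * X) (b * (f * b)) (b * NDf) (b ^+ 2 * NDf) => a1 a2 a3 a4 a5 a6.
by move: (M * NDf) (b * f) (f * M) => a7 a8 a9; lra.
Qed.

(** For [h = |1 - conjc al * zeta|], the modulus of [DD] of Re (gamma x). The assumption
    [h <= k0 * chi] cancels the powers of [chi] in the denominators, so this cutoff costs only a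
    constant; 72 = 24 + 48. *)
Lemma cut_error_le1 (R : realType) (h xi chi rho k0 : R) : 0 <= h -> 0 < chi -> chi <= rho ^+ 2 ->
  xi ^+ 2 <= rho ^+ 2 -> 0 <= k0 -> h <= k0 * chi -> 72 * k0 ^+ 2 * rho ^+ 2 <= 1 ->
  24 * h ^+ 2 / chi + 48 * xi ^+ 2 * h ^+ 2 / chi ^+ 2 <= 1.
Proof.
move=> h0 c0 cr xr k00 hk; apply: le_trans.
have h2 : h ^+ 2 <= (k0 * chi) ^+ 2 by rewrite ler_pXn2r// nnegrE// mulr_ge0// ltW.
have c2 : 0 < chi ^+ 2 by rewrite exprn_gt0.
rewrite (_ : 72 * k0 ^+ 2 * rho ^+ 2 = 24 * (k0 ^+ 2 * rho ^+ 2) + 48 * rho ^+ 2 * k0 ^+ 2); last by ring.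
apply: lerD.
  rewrite -mulrA ler_pM2l// ler_pdivrMr//; apply: le_trans h2 _.
  rewrite exprMn (_ : k0 ^+ 2 * rho ^+ 2 * chi = k0 ^+ 2 * (rho ^+ 2 * chi)); last by ring.
  by rewrite ler_wpM2l ?sqr_ge0// [chi ^+ 2]expr2 ler_wpM2r// ltW.
rewrite ler_pdivrMr//; apply: (@le_trans _ _ (48 * (xi ^+ 2 * (k0 * chi) ^+ 2))).
  rewrite (_ : 48 * xi ^+ 2 * h ^+ 2 = 48 * (xi ^+ 2 * h ^+ 2)); last by ring.
  by rewrite ler_pM2l// ler_wpM2l// sqr_ge0.
rewrite exprMn (_ : 48 * rho ^+ 2 * k0 ^+ 2 * chi ^+ 2 = 48 * rho ^+ 2 * (k0 ^+ 2 * chi ^+ 2)); last by ring.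
rewrite (_ : 48 * rho ^+ 2 * (k0 ^+ 2 * chi ^+ 2) = 48 * (rho ^+ 2 * (k0 ^+ 2 * chi ^+ 2))); last by ring.
by rewrite ler_pM2l// ler_wpM2r// mulr_ge0// sqr_ge0.
Qed.

Lemma test_function_inequality (R : realType) (ef nf n C1 m T1 q et chi ry p C2 y a1 a2 : R) :
  0 <= m -> ef <= C1 * (1 + n) -> nf = n ^+ 2 -> - (C2 * `|y|) <= ry ->
  - T1 <= a1 -> - (24 * q / chi + 48 * et ^+ 2 * q / chi ^+ 2) <= a2 ->
  -1 * (ef - nf) + 1 * (a1 + 1 * (a2 + m / 2 * (2 * ry + 2 * p))) <= 0 ->
  n ^+ 2 - C1 * n - C1 - T1 - 24 * q / chi - 48 * et ^+ 2 * q / chi ^+ 2 + m * p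
     - m * (C2 * `|y|) <= 0.
Proof.
move=> m0 h1 -> h3 h4 h5; have h6 := ler_wpM2l m0 h3.
rewrite (_ : m / 2 * (2 * ry + 2 * p) = m * ry + m * p); last by field.
rewrite mulrN in h6; rewrite mulrDr mulr1 in h1.
clear -h1 h4 h5 h6; move: h1 h4 h5 h6.
move: (m * (C2 * `|y|)) (24 * q / chi) (48 * et ^+ 2 * q / chi ^+ 2) (C1 * n) (n ^+ 2) (m * ry) (m * p) => *.
lra.
Qed.

Lemma cut_term_sum (R : realType) (xi chi D : R) : 0 < chi ->
  12 * (- (2 * D ^+ 2) / chi - (2 * `|xi| * D) ^+ 2 / chi ^+ 2) =
  - (24 * D ^+ 2 / chi + 48 * xi ^+ 2 * D ^+ 2 / chi ^+ 2).
Proof.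
move=> c0; rewrite !exprMn real_normK ?num_real//; field; by rewrite gt_eqF.
Qed.

(** * Pointwise bounds and the maximum principle for [zeta] *)

Section StepB.
Context (R : realType).
Local Notation V := 'rV[R]_2.
Variables (U : set V) (T e Th : V -> R) (G w P : V -> R[i]).
Hypothesis S : phase_system U T e Th G w P.
Variables (K Kb : R) (al ga : R[i]) (x : V).
Local Notation Z := (fun y => (e y)%:C * w y).
Local Notation z := ((e x)%:C * w x).
Local Notation W := (nc (w x)).
Local Notation E := `|e x|.
Hypotheses (Ux : U x) (Kb1 : 1 <= Kb) (K0 : 0 <= K).
Hypotheses (e0 : e x != 0) (hE : E <= Kb) (hEi : E^-1 <= Kb).
Hypothesis hth : nc (dz (cplx Th) x) <= K.
Hypothesis hK1 : nc (DB z (dz (cplx Th)) x) <= 2 * K.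
Hypothesis hK2 : nc (DB z (db (cplx Th)) x) <= 2 * K.
Hypotheses (ga2 : ga ^+ 2 = al) (ga1 : nc ga = 1).
Local Notation X := (DD z Z x).
Local Notation d := (DB z Z x).
Local Notation f := (fun y => 1 - Re (conjc al * Z y)).
Local Notation b := (source_const Kb K).
Let oU := ps_open S.

Lemma nc_alpha : nc al = 1. Proof. by rewrite -ga2 expr2 ncM ga1 mulr1. Qed.

Lemma gamma_unitary : ga * conjc ga = 1.
Proof. by rewrite nc_conj ga1 expr1n rmorph1. Qed.

Lemma CC_zeta : CC 2 U Z. Proof. exact: CCM oU (CC_real (ps_e S)) (ps_w S). Qed.

Lemma Kb_ge0 : 0 <= Kb. Proof. exact: le_trans ler01 Kb1. Qed.
Lemma source_const_ge0 : 0 <= b. Proof. by rewrite /source_const !mulr_ge0// Kb_ge0. Qed.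

Lemma nc_w_le : W <= Kb.
Proof.
have : E * W <= 1 by have := ltW (ps_lt1 S Ux); rewrite ncM ncR.
rewrite mulrC -ler_pdivlMr ?normr_gt0// mul1r => h; exact: le_trans h hEi.
Qed.

Lemma one_minus_Re_gt0 y : U y -> 0 < f y.
Proof.
move=> Uy; rewrite subr_gt0; apply: le_lt_trans (ler_norm _) _.
apply: le_lt_trans (nc_Re _) _; rewrite ncM ncJ nc_alpha mul1r; exact: (ps_lt1 S Uy).
Qed.

Lemma one_minus_Re_le2 : f x <= 2.
Proof.
rewrite /= -[leRHS]/(1 + 1) lerD2l; apply: le_trans (ler_norm _) _; rewrite normrN.
apply: le_trans (nc_Re _) _; rewrite ncM ncJ nc_alpha mul1r; exact: ltW (ps_lt1 S Ux).
Qed.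

(** With [t = conjc al * zeta] one has [2 (1 - Re t) = (1 - |t|^2) + |1 - t|^2]. So [f] dominates
    both the loss of ellipticity and, in the next lemma, the squared distance from [zeta] to
    [al]. *)
Lemma one_minus_zeta2_le : 1 - nc z ^+ 2 <= 2 * f x.
Proof.
have -> : 2 * f x = 1 - nc z ^+ 2 + nc (1 - conjc al * z) ^+ 2.
  rewrite [nc (1 - _) ^+ 2]nc_sqr.
  have -> : nc z ^+ 2 = nc (conjc al * z) ^+ 2 by rewrite [in RHS]ncM ncJ nc_alpha mul1r.
  rewrite nc_sqr; move: (conjc al * z) => t.
  by rewrite ReD ImD ReN ImN /=; ring.
by rewrite lerDl sqr_ge0.
Qed.

Lemma one_minus_sqr_norm_le : nc (1 - conjc al * z) ^+ 2 <= 2 * f x.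
Proof.
have -> : 2 * f x = 1 - nc z ^+ 2 + nc (1 - conjc al * z) ^+ 2.
  rewrite [nc (1 - _) ^+ 2]nc_sqr.
  have -> : nc z ^+ 2 = nc (conjc al * z) ^+ 2 by rewrite [in RHS]ncM ncJ nc_alpha mul1r.
  rewrite nc_sqr; move: (conjc al * z) => t.
  by rewrite ReD ImD ReN ImN /=; ring.
by rewrite lerDr subr_ge0 expr_le1 ?nc_ge0//; exact: ltW (ps_lt1 S Ux).
Qed.

Lemma db_phase_le : nc (db (cplx Th) x) <= K.
Proof. by rewrite db_real ncJ. Qed.

Lemma phase_source_le : nc (conjc (w x) * dz (cplx Th) x + (e x)%:C * db (cplx Th) x) <= b.
Proof.
rewrite /source_const -mulrA mulr_natl mulr2n; apply: le_trans (ncD _ _) _.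
by rewrite !ncM ncJ ncR; apply: lerD; apply: ler_pM; rewrite ?nc_ge0 ?nc_w_le ?db_phase_le.
Qed.

Lemma phase_source_conj_le : nc (w x * db (cplx Th) x + (e x)%:C * dz (cplx Th) x) <= b.
Proof.
rewrite /source_const -mulrA mulr_natl mulr2n; apply: le_trans (ncD _ _) _.
by rewrite !ncM ncR; apply: lerD; apply: ler_pM; rewrite ?nc_ge0 ?nc_w_le ?db_phase_le.
Qed.

Lemma half_one_minus_zeta2_le : nc ((1 - z * conjc z) / 2) <= f x.
Proof.
have z1 : 0 <= 1 - nc z ^+ 2 by rewrite subr_ge0 expr_le1 ?nc_ge0//; exact: ltW (ps_lt1 S Ux).
rewrite nc_half nc_conj (_ : 1 - _ = (1 - nc z ^+ 2)%:C); last by rewrite rmorphB rmorph1.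
rewrite ncR ger0_norm// ler_pdivrMr// [leRHS]mulrC; exact: one_minus_zeta2_le.
Qed.

Lemma DD_zeta_le : nc X <= f x * b.
Proof.
by rewrite (DD_zeta S Ux) ncM; apply: ler_pM; rewrite ?nc_ge0 ?half_one_minus_zeta2_le ?phase_source_conj_le.
Qed.

Lemma DB_phase_le : nc (DB z (cplx Th) x) <= 2 * K.
Proof.
apply: le_trans (ncB _ _) _; rewrite mulr_natl mulr2n; apply: lerD => //.
by rewrite ncM -[leRHS]mul1r ler_pM ?nc_ge0 ?db_phase_le// ltW// (ps_lt1 S).
Qed.

Lemma DB_e_le : nc (DB z (cplx e) x) <= (1 + Kb ^+ 2) * K.
Proof.
rewrite (DB_e S Ux) ncM ncR (_ : (1 + Kb ^+ 2) * K = (1 + Kb ^+ 2) / 2 * (2 * K)); last by field.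
apply: ler_pM; rewrite ?nc_ge0 ?DB_phase_le//.
rewrite ger0_norm; last by rewrite divr_ge0// addr_ge0// sqr_ge0.
by rewrite ler_pM2r ?invr_gt0// lerD2l -real_normK ?num_real// ler_pXn2r// nnegrE ?Kb_ge0.
Qed.

Lemma DB_w_le : nc (DB z w x) <= Kb * (nc d + (1 + Kb ^+ 2) * K * Kb).
Proof.
have Ed : (e x)%:C * DB z w x = d - DB z (cplx e) x * w x.
  by rewrite (DBM _ (CC_cdiff (CC_real (ps_e S)) Ux) (CC_cdiff (ps_w S) Ux)); ring.
have ec0 : (e x)%:C != 0 :> R[i] by apply/eqP => -[]; apply/eqP.
rewrite -[DB z w x](mulKf ec0) Ed ncM ncV ncR; apply: ler_pM; rewrite ?invr_ge0 ?nc_ge0//.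
apply: le_trans (ncB _ _) _; rewrite lerD2l ncM.
by apply: ler_pM; rewrite ?nc_ge0 ?DB_e_le ?nc_w_le.
Qed.

Lemma DD_one_minus_Re : DD z (cplx f) x = - (2^-1 * (conjc al * X + al * conjc d)).
Proof.
have cR := C_class_Re (conjc al) oU CC_zeta.
have -> : cplx f = cplx (fun y => 1 * 1 + (-1) * Re (conjc al * Z y)).
  by apply/funext => y; rewrite mul1r mulN1r.
rewrite (DD_comb _ _ _ oU (C_class_cst 2 U 1) cR Ux) DD_cst mulr0 add0r rmorphN rmorph1 mulN1r.
by rewrite (DD_Re _ _ oU CC_zeta Ux) conjcK.
Qed.

Lemma ell_one_minus_Re : Re (ell z (cplx f) x) = - Re (conjc al * ell z Z x).
Proof.
have cR := C_class_Re (conjc al) oU CC_zeta.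
have -> : cplx f = cplx (fun y => 1 * 1 + (-1) * Re (conjc al * Z y)).
  by apply/funext => y; rewrite mul1r mulN1r.
rewrite (ell_comb _ _ _ oU (C_class_cst 2 U 1) cR Ux) ell_cst mulr0 add0r mulN1r.
by rewrite (ell_Re _ _ oU CC_zeta Ux).
Qed.

(** Each term of [ell_zeta] carries [1 - |zeta|^2 <= 2 f] or a first derivative of [zeta]. Of these,
    [DD zeta] is at most a multiple of [f], and [DB zeta] is recovered from [DD f] and [DD zeta].
    Divided by [f], the error is thus linear in the logarithmic gradient, and the square of the
    latter can absorb it. *)
Lemma ell_one_minus_Re_le : Re (ell z (cplx f) x) <= ell_f_const Kb K * (f x + nc (DD z (cplx f) x)).
Proof.
have f0 := ltW (one_minus_Re_gt0 Ux).
rewrite ell_one_minus_Re; apply: le_trans (ler_norm _) _; rewrite normrN.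
apply: le_trans (nc_Re _) _; rewrite ncM ncJ nc_alpha mul1r.
apply: (@ell_one_minus_Re_inequality R Kb K b (f x) (nc d) (nc X)) => //.
- exact: source_const_ge0.
- exact: Kb_ge0.
- exact: nc_ge0.
- exact: nc_ge0.
- exact: one_minus_Re_le2.
- exact: DD_zeta_le.
- rewrite DD_one_minus_Re ncN ncM ncV nc_nat mulrA mulfV// mul1r.
  have -> : nc d = nc (al * conjc d) by rewrite ncM nc_alpha ncJ mul1r.
  have -> : nc X = nc (conjc al * X) by rewrite ncM ncJ nc_alpha mul1r.
  rewrite [X in nc X <= _](_ : _ = (conjc al * X + al * conjc d) - conjc al * X); last by ring.
  exact: ncB.
rewrite (ell_zeta S Ux).
have zl : nc z <= 1 := ltW (ps_lt1 S Ux).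
have bz := source_const_ge0.
apply: le_trans (ncD _ _) (lerD (le_trans (ncB _ _) _) _).
  rewrite (_ : b * (nc d + nc X) = b / 2 * (nc d + nc X) + (nc d + nc X) / 2 * b); last by field.
  rewrite !ncM; apply: lerD.
    rewrite ncV nc_nat; apply: ler_pM; rewrite ?mulr_ge0 ?invr_ge0 ?nc_ge0//.
      by rewrite ler_pM2r ?invr_gt0// phase_source_le.
    apply: le_trans (ncD _ _) _; rewrite lerD2l ncM -[leRHS]mul1r.
    by rewrite ler_wpM2r ?nc_ge0.
  rewrite ncV nc_nat; apply: ler_pM; rewrite ?mulr_ge0 ?invr_ge0 ?nc_ge0 ?phase_source_conj_le//.
  rewrite ler_pM2r ?invr_gt0//; apply: le_trans (ncD _ _) _; apply: lerD.
    by rewrite ncM ncJ -[leRHS]mulr1 ler_wpM2l ?nc_ge0.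
  by rewrite ncM ncJ -[leRHS]mul1r ler_wpM2r ?nc_ge0.
rewrite ncM; apply: ler_pM; rewrite ?nc_ge0 ?half_one_minus_zeta2_le//.
apply: le_trans (ncD _ _) (lerD (le_trans (ncD _ _) (lerD (le_trans (ncD _ _) (lerD _ _)) _)) _).
- by rewrite ncM; apply: ler_pM; rewrite ?nc_ge0 ?DB_w_le ?db_phase_le.
- by rewrite ncM; apply: ler_pM; rewrite ?nc_ge0 ?nc_w_le.
- by rewrite ncM; apply: ler_pM; rewrite ?nc_ge0 ?DB_e_le.
- by rewrite ncM ncR; apply: ler_pM; rewrite ?nc_ge0.
Qed.

Lemma ell_P_le : nc (ell z P x) <= ell_P_const Kb K.
Proof.
have h1 : 1 + W ^+ 2 <= 1 + Kb ^+ 2 by rewrite lerD2l ler_pXn2r ?nnegrE ?nc_ge0 ?Kb_ge0 ?nc_w_le.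
rewrite (ell_P S Ux) /ell_P_const; apply: le_trans (ncD _ _) (lerD _ _).
  rewrite !ncM ncR nc_one_plus_nc2; apply: ler_pM; rewrite ?mulr_ge0 ?addr_ge0 ?sqr_ge0 ?nc_ge0 ?phase_source_le//.
  by apply: ler_pM; rewrite ?addr_ge0 ?sqr_ge0.
rewrite ncM nc_nat ncJ ler_pM2l// (DD_w S Ux) ncM nc_half nc_one_plus_nc2.
rewrite (_ : (1 + Kb ^+ 2) * K = (1 + Kb ^+ 2) / 2 * (2 * K)); last by field.
by apply: ler_pM; rewrite ?divr_ge0 ?addr_ge0 ?sqr_ge0 ?nc_ge0 ?DB_phase_le// ler_pM2r ?invr_gt0.
Qed.

Local Notation H := (1 - conjc al * z).
Local Notation xi := (fun y => Re (ga * xc y)).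
Local Notation et := (fun y => Re (- ('i * ga) * xc y)).
Local Notation yp := (fun y => Re (ga * P y)).
Local Notation Y := (e x + (e x)^-1).

Lemma conj_gamma_alpha : conjc ga * al = ga.
Proof. by rewrite -ga2 expr2 mulrA [conjc ga * ga]mulrC gamma_unitary mul1r. Qed.

(** Since [ga ^+ 2 = al], a common phase [conjc ga] comes out of the derivatives of [xi], [et] and
    [yp]. Up to it and to terms with [conjc H] they are 0, [2 i] and the real number [Y]. *)
Lemma DD_xi : DD z (cplx xi) x = conjc ga * conjc H.
Proof.
rewrite (DD_Re _ _ oU (@CC_xc R 2 U) Ux) DD_xc DB_xc conjc_nat.
rewrite (_ : conjc H = 1 - al * conjc z); last by rewrite !conjcE.
by rewrite mulrBr mulrA conj_gamma_alpha; field.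
Qed.

Lemma conj_i : conjc ('i : R[i]) = - 'i.
Proof. by apply: complex_ext => /=; rewrite ?oppr0. Qed.

Lemma DD_et : DD z (cplx et) x = 'i * (conjc ga * (2 - conjc H)).
Proof.
rewrite (DD_Re _ _ oU (@CC_xc R 2 U) Ux) DD_xc DB_xc conjc_nat [conjc (- _)]conjcN [conjc ('i * _)]conjcM conj_i.
rewrite (_ : conjc H = 1 - al * conjc z); last by rewrite !conjcE.
have -> : conjc ga * (2 - (1 - al * conjc z)) = conjc ga + conjc ga * al * conjc z by ring.
rewrite conj_gamma_alpha; move: (conjc z) (conjc ga) => p q; by field.
Qed.

Lemma ec_neq0 : (e x)%:C != 0 :> R[i].
Proof. by apply/eqP => -[]; apply/eqP. Qed.

Lemma DD_yp : DD z (cplx yp) x = conjc ga * (Y%:C - (e x)^-1%:C * conjc H).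
Proof.
have -> : conjc H = 1 - al * ((e x)%:C * conjc (w x)) by rewrite !conjcE.
have -> : Y%:C = (e x)%:C + (e x)%:C^-1 :> R[i] by rewrite rmorphD fmorphV.
have -> : ((e x)^-1)%:C = (e x)%:C^-1 :> R[i] by rewrite fmorphV.
rewrite (DD_Re _ _ oU (ps_P S) Ux) (DD_P S Ux) (DB_P S Ux).
rewrite [conjc (2 * _)]conjcM conjc_nat conjcR.
rewrite -{1}conj_gamma_alpha; have := ec_neq0.
move: (conjc (w x)) (conjc ga) ((e x)%:C) => p q a a0.
by field; exact: a0.
Qed.

Variables (rho m k0 A : R).
Hypotheses (rho0 : 0 < rho) (m0 : 0 <= m) (k00 : 0 <= k0) (hA : nc (P x) <= A).
Hypothesis hrho : forall y, U y -> `|xi y| < rho /\ `|et y| < rho.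
Local Notation Phi := (fun y => -1 * ln (f y) + 1 * (12 * ln (rho ^+ 2 - xi y ^+ 2)
  + 1 * (12 * ln (rho ^+ 2 - et y ^+ 2) + m / 2 * (yp y ^+ 2)))).

(** The conditions on [k0] give, in this order, a first cutoff of bounded cost,
    [|2 - conjc H| <= 3], [|DD yp| >= 1], and a remainder of modulus at most 1 in the logarithmic
    gradient. The result will be contradicted by a large [m], so that at a maximum [H] cannot be
    small against both cutoffs. *)
Lemma weight_le_at_max :
  (forall y, U y -> Phi y <= Phi x) ->
  72 * k0 ^+ 2 * rho ^+ 2 <= 1 -> k0 * rho ^+ 2 <= 1 -> k0 * rho ^+ 2 * Kb <= 1 ->
  m * A * (k0 * rho ^+ 2 * Kb) + 48 * rho * k0 <= 1 ->
  nc H <= k0 * (rho ^+ 2 - xi x ^+ 2) -> nc H <= k0 * (rho ^+ 2 - et x ^+ 2) ->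
  m <= ell_f_const Kb K ^+ 2 + ell_f_const Kb K + 2 + ell_P_const Kb K ^+ 2 + 432 / rho ^+ 2.
Proof.
move=> fmax s1 s2 s3 s4 h1 h2.
pose L0 y := ln (f y); pose L1 y := ln (rho ^+ 2 - xi y ^+ 2).
pose L2 y := ln (rho ^+ 2 - et y ^+ 2); pose Q y := yp y ^+ 2.
have sq (a : R) : `|a| < rho -> 0 < rho ^+ 2 - a ^+ 2.
  by move=> ha; rewrite subr_gt0 -(real_normK (num_real a)) ltr_pXn2r// nnegrE// ltW.
have p1 y : U y -> 0 < rho ^+ 2 - xi y ^+ 2 by move=> /hrho[/sq].
have p2 y : U y -> 0 < rho ^+ 2 - et y ^+ 2 by move=> /hrho[_ /sq].
have cxi : C_class 2 U xi := C_class_Re ga oU (@CC_xc R 2 U).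
have cet : C_class 2 U et := C_class_Re (- ('i * ga)) oU (@CC_xc R 2 U).
have cyp : C_class 2 U yp := C_class_Re ga oU (ps_P S).
have cf : C_class 2 U f := C_classB oU (C_class_cst 2 U 1) (C_class_Re (conjc al) oU CC_zeta).
have ch1 := C_class_cut rho oU cxi; have ch2 := C_class_cut rho oU cet.
have c0 : C_class 2 U L0 := C_class_ln oU one_minus_Re_gt0 cf.
have c1 : C_class 2 U L1 := C_class_ln oU p1 ch1.
have c2 : C_class 2 U L2 := C_class_ln oU p2 ch2.
have cQ : C_class 2 U Q := C_classM oU cyp cyp.
have sc a b (f1 f2 : V -> R) : C_class 2 U f1 -> C_class 2 U f2 ->
   C_class 2 U (fun y => a * f1 y + b * f2 y).
  by move=> g1 g2; exact: (C_classD oU (C_classM oU (C_class_cst 2 U a) g1) (C_classM oU (C_class_cst 2 U b) g2)).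
have c2Q := sc 12 (m / 2) _ _ c2 cQ; have c12Q := sc 12 1 _ _ c1 c2Q.
have [] := ell_max z oU (sc (-1) 1 _ _ c0 c12Q) Ux fmax.
rewrite (DD_comb _ _ _ oU c0 c12Q Ux) (DD_comb _ _ _ oU c1 c2Q Ux) (DD_comb _ _ _ oU c2 cQ Ux).
rewrite (ell_comb _ _ _ oU c0 c12Q Ux) (ell_comb _ _ _ oU c1 c2Q Ux) (ell_comb _ _ _ oU c2 cQ Ux).
rewrite (ell_ln z oU one_minus_Re_gt0 cf Ux).1 (ell_ln z oU p1 ch1 Ux).1 (ell_ln z oU p2 ch2 Ux).1.
rewrite (ell_ln_Re z oU one_minus_Re_gt0 cf Ux) (ell_ln_Re z oU p1 ch1 Ux) (ell_ln_Re z oU p2 ch2 Ux).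
have exi : Re (ell z (cplx xi) x) = 0 by rewrite (ell_Re _ _ oU (@CC_xc R 2 U) Ux) ell_xc mulr0.
have eet : Re (ell z (cplx et) x) = 0 by rewrite (ell_Re _ _ oU (@CC_xc R 2 U) Ux) ell_xc mulr0.
rewrite (DD_cut _ _ oU cxi Ux) (DD_cut _ _ oU cet Ux) (DD_sqr _ oU cyp Ux).
rewrite (ell_cut _ oU cxi Ux exi) (ell_cut _ oU cet Ux eet) (ell_sqr _ oU cyp Ux).
rewrite (ell_Re _ _ oU (ps_P S) Ux) DD_xi DD_et DD_yp.
have f0 := one_minus_Re_gt0 Ux; have q1 := p1 _ Ux; have q2 := p2 _ Ux.
have {exi eet} r1 : rho ^+ 2 - xi x ^+ 2 <= rho ^+ 2 by rewrite gerBl sqr_ge0.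
have r2 : rho ^+ 2 - et x ^+ 2 <= rho ^+ 2 by rewrite gerBl sqr_ge0.
set chi1 := rho ^+ 2 - xi x ^+ 2 in h1 q1 r1 *.
set chi2 := rho ^+ 2 - et x ^+ 2 in h2 q2 r2 *.
set n := nc (DD z (cplx f) x) / f x => DD0 ell0.
have hH0 : 0 <= nc H by exact: nc_ge0.
have hxi : xi x ^+ 2 <= rho ^+ 2 by rewrite -subr_ge0 ltW.
have het : et x ^+ 2 <= rho ^+ 2 by rewrite -subr_ge0 ltW.
have nxi : `|xi x| <= rho := ltW (hrho Ux).1.
have net : `|et x| <= rho := ltW (hrho Ux).2.
have nyp : `|yp x| <= A.
  by apply: le_trans (nc_Re _) _; rewrite ncM ga1 mul1r.
have A0 : 0 <= A := le_trans (normr_ge0 _) nyp.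
have H1 : nc H <= 1.
  by apply: le_trans h1 (le_trans _ s2); rewrite ler_wpM2l.
have HE : nc H * E^-1 <= k0 * rho ^+ 2 * Kb.
  apply: ler_pM; rewrite ?invr_ge0//; apply: le_trans h1 _; by rewrite ler_wpM2l.
set B := k0 * rho ^+ 2 * Kb in s3 s4 HE *.
have nga : nc (conjc ga) = 1 by rewrite ncJ ga1.
(* Main part of the logarithmic gradient of [f], with real part from [yp] and imaginary part from
   the cutoff in [et]; the remainder [s] collects everything with a factor [conjc H]. The number 48
   is exponent 12, times 2 from the square, times 2 from [DD et]. *)
pose N0 : R[i] := m%:C * (yp x)%:C * Y%:C - 'i * (48 * ((et x)%:C * (chi2^-1)%:C)).
pose s : R[i] := - (m%:C * (yp x)%:C * ((e x)^-1)%:C * conjc H)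
  - 24 * ((xi x)%:C * (chi1^-1)%:C) * conjc H + 'i * (24 * ((et x)%:C * (chi2^-1)%:C) * conjc H).
have EN : ((f x)^-1)%:C * DD z (cplx f) x = conjc ga * (N0 + s).
  have RM (a b : R) : (a * b)%:C = a%:C * b%:C :> R[i] by exact: rmorphM.
  have R12 : 12%:C = 12 :> R[i] by exact: rmorph_nat.
  have R2 : 2%:C = 2 :> R[i] by exact: rmorph_nat.
  have RI : (2^-1)%:C = 2^-1 :> R[i] by rewrite fmorphV rmorph_nat.
  have R1 : (-1)%:C = -1 :> R[i] by rewrite rmorphN rmorph1.
  have R11 : 1%:C = 1 :> R[i] by rewrite rmorph1.
  move: DD0; rewrite !RM R12 R2 RI R1 R11 /N0 /s.
  move: (_ * DD z (cplx f) x) => N /eqP; rewrite mulN1r addrC subr_eq0 => /eqP <-.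
  move: ((chi1^-1)%:C) ((chi2^-1)%:C) (((e x)^-1)%:C) => t1 t2 t3; move: (Y%:C) => t4; by field.
have nN : nc (((f x)^-1)%:C * DD z (cplx f) x) = n.
  by rewrite ncM ncR ger0_norm ?invr_ge0 ?(ltW f0)// mulrC.
have nNs : nc (N0 + s) = n by rewrite -nN EN ncM nga mul1r.
have ns : nc s <= 1.
  apply: le_trans s4; apply: le_trans (ncD _ _) _.
  have -> : 48 * rho * k0 = 24 * (rho * k0) + 24 * (rho * k0) by ring.
  rewrite addrA; apply: lerD; first (apply: le_trans (ncB _ _) _; apply: lerD).
  - rewrite ncN !ncM !ncR ncJ (ger0_norm m0) normfV -!mulrA ler_wpM2l//.
    apply: ler_pM => //; first by rewrite mulr_ge0 ?invr_ge0.
    by rewrite [leLHS]mulrC.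
  - rewrite !ncM nc_nat !ncR ncJ -!mulrA ler_pM2l//; apply: ler_pM => //.
      by rewrite mulr_ge0.
    by rewrite ger0_norm ?invr_ge0 ?(ltW q1)// mulrC ler_pdivrMr.
  - rewrite !ncM nc_i mul1r nc_nat !ncR ncJ -!mulrA ler_pM2l//; apply: ler_pM => //.
      by rewrite mulr_ge0.
    by rewrite ger0_norm ?invr_ge0 ?(ltW q2)// mulrC ler_pdivrMr.
(* No cancellation is possible between the real and the imaginary part of [N0], so both squares are
   gained; 2304 is the square of 48. *)
have hN : m ^+ 2 * yp x ^+ 2 * Y ^+ 2 + 2304 * et x ^+ 2 / chi2 ^+ 2 <= (n + 1) ^+ 2.
  have -> : m ^+ 2 * yp x ^+ 2 * Y ^+ 2 + 2304 * et x ^+ 2 / chi2 ^+ 2 = nc N0 ^+ 2.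
    have -> : N0 = (m * yp x * Y) +i* (- (48 * (et x * chi2^-1))).
      have R48 : 48 = 48%:C :> R[i] by rewrite rmorph_nat.
      by rewrite /N0 R48; apply: complex_ext; rewrite !ReImE /=; ring.
    by rewrite nc_sqr /=; field; rewrite gt_eqF.
  rewrite ler_pXn2r ?nnegrE ?nc_ge0 ?addr_ge0 -?nNs ?nc_ge0//.
  apply: le_trans (lerD (lexx _) ns).
  rewrite [X in nc X <= _](_ : N0 = (N0 + s) - s); [exact: ncB|by ring].
have hY : 4 <= Y ^+ 2.
  have -> : Y ^+ 2 = 4 + (e x - (e x)^-1) ^+ 2 by field.
  by rewrite lerDl sqr_ge0.
have nY : 2 <= `|Y|.
  by rewrite -(ler_pXn2r (n := 2)) ?nnegrE// real_normK ?num_real// -natrX.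
have hq : nc ('i * (conjc ga * (2 - conjc H))) ^+ 2 <= 9.
  rewrite !ncM nc_i nga !mul1r (_ : 9 = 3 ^+ 2) ?ler_pXn2r ?nnegrE ?nc_ge0//; last by rewrite -natrX.
  apply: le_trans (ncB _ _) _; rewrite nc_nat ncJ -[leRHS]/(1 + 2) -[leRHS]addrC lerD2l//.
have hp : 1 <= nc (conjc ga * (Y%:C - ((e x)^-1)%:C * conjc H)) ^+ 2.
  rewrite ncM nga mul1r -(expr1n _ 2) ler_pXn2r ?nnegrE ?nc_ge0//.
  have : nc Y%:C <= nc (Y%:C - ((e x)^-1)%:C * conjc H) + nc (((e x)^-1)%:C * conjc H).
    rewrite [X in nc X <= _](_ : _ = (Y%:C - ((e x)^-1)%:C * conjc H) + ((e x)^-1)%:C * conjc H); last by ring.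
    exact: ncD.
  rewrite ncM !ncR ncJ normfV => hh.
  rewrite -(lerD2r 1); apply: le_trans nY (le_trans hh _); rewrite lerD2l.
  by rewrite mulrC; exact: le_trans HE s3.
have ry : - (ell_P_const Kb K * `|yp x|) <= yp x * Re (ga * ell z P x).
  have : `|yp x * Re (ga * ell z P x)| <= ell_P_const Kb K * `|yp x|.
    rewrite normrM mulrC ler_wpM2r//; apply: le_trans (nc_Re _) _.
    by rewrite ncM ga1 mul1r; exact: ell_P_le.
  by rewrite ler_norml => /andP[].
have hef : Re (ell z (cplx f) x) / f x <= ell_f_const Kb K * (1 + n).
  rewrite ler_pdivrMr// (_ : ell_f_const Kb K * (1 + n) * f x = ell_f_const Kb K * (f x + nc (DD z (cplx f) x))).
    exact: ell_one_minus_Re_le.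
  by rewrite /n; field; rewrite gt_eqF.
have hnf : nc (DD z (cplx f) x) ^+ 2 / f x ^+ 2 = n ^+ 2 by rewrite /n exprMn exprVn.
apply: (@weight_le_inequality R n (yp x) Y (et x) chi2 rho m (ell_f_const Kb K) (ell_P_const Kb K)
  (24 * nc H ^+ 2 / chi1 + 48 * xi x ^+ 2 * nc H ^+ 2 / chi1 ^+ 2)
  (nc ('i * (conjc ga * (2 - conjc H))) ^+ 2)
  (nc (conjc ga * (Y%:C - ((e x)^-1)%:C * conjc H)) ^+ 2)) => //.
- by rewrite /ell_f_const /second_order_const /source_const !addr_ge0 ?mulr_ge0 ?addr_ge0 ?sqr_ge0 ?mulr_ge0 ?Kb_ge0.
- by rewrite /ell_P_const /source_const !addr_ge0 ?mulr_ge0 ?addr_ge0 ?sqr_ge0 ?mulr_ge0 ?Kb_ge0.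
- by apply: (@cut_error_le1 R _ _ _ rho k0).
apply: (test_function_inequality m0 hef hnf ry _ _ ell0).
  by rewrite ncN !ncM nga !mul1r !ncR ncJ normrM [`|2|]ger0_norm// cut_term_sum.
by rewrite ncN ncM ncR normrM [`|2|]ger0_norm// cut_term_sum.
Qed.

End StepB.

(** * One-variable tools and maxima on compact sets *)

Section OneVariableTools.
Context (R : realType).
Implicit Types (f g : R -> R).

Lemma MVT_derive f g (a b : R) : a < b ->
  (forall t, a <= t <= b -> is_derive t (1:R) f (g t)) ->
  exists2 c, a < c < b & f b - f a = g c * (b - a).
Proof.
move=> ab H; have [||c cI E] := MVT ab (f := f) (df := g).
- by move=> t; rewrite in_itv/= => /andP[h1 h2]; apply: H; rewrite !ltW.
- apply: derivable_within_continuous => t; rewrite in_itv/= => h.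
  exact: (@ex_derive _ _ _ _ _ _ _ (H t h)).
by exists c => //; move: cI; rewrite in_itv.
Qed.

Lemma derive_le_le f g (a b : R) : a <= b ->
  (forall t, a <= t <= b -> is_derive t (1:R) f (g t)) ->
  (forall t, a <= t <= b -> g t <= 0) -> f b <= f a.
Proof.
rewrite le_eqVlt => /orP[/eqP-> //|ab] H hg.
have [c /andP[c1 c2] E] := MVT_derive ab H.
rewrite -subr_le0 E; apply: mulr_le0_ge0; first by apply: hg; rewrite !ltW.
by rewrite subr_ge0 ltW.
Qed.

Lemma lipschitz_derive f g (M a b : R) : a <= b ->
  (forall t, a <= t <= b -> is_derive t (1:R) f (g t)) ->
  (forall t, a <= t <= b -> `|g t| <= M) -> `|f b - f a| <= M * (b - a).
Proof.
rewrite le_eqVlt => /orP[/eqP->|ab] H hg; first by rewrite !subrr normr0 mulr0.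
have [c /andP[c1 c2] ->] := MVT_derive ab H.
rewrite normrM [`|b - a|]ger0_norm ?subr_ge0 ?(ltW ab)//.
by rewrite ler_wpM2r ?subr_ge0 ?(ltW ab)//; apply: hg; rewrite !ltW.
Qed.

Lemma taylor_le f g h (M b : R) : 0 <= b ->
  (forall t, 0 <= t <= b -> is_derive t (1:R) f (g t)) ->
  (forall t, 0 <= t <= b -> is_derive t (1:R) g (h t)) ->
  (forall t, 0 <= t <= b -> `|h t| <= M) ->
  f b <= f 0 + g 0 * b + M * b ^+ 2 / 2.
Proof.
move=> b0 fg gh hM.
have gl t : 0 <= t <= b -> g t <= g 0 + M * t.
  move=> /andP[t0 tb].
  have := @lipschitz_derive g h M 0 t t0; rewrite subr0 => /(_ _ _)/le_trans H.
  rewrite -lerBlDl; apply: le_trans (ler_norm _) _; apply: (H) => //.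
    by move=> s /andP[s0 st]; apply: gh; rewrite s0 (le_trans st).
  by move=> s /andP[s0 st]; apply: hM; rewrite s0 (le_trans st).
pose k t := f t - (g 0 * t + M / 2 * (t * t)).
have dk t : 0 <= t <= b -> is_derive t (1:R) k (g t - (g 0 + M * t)).
  move=> tb; have := fg t tb => dft.
  have e1 : is_derive t (1:R) (fun s : R => g 0 * s + M / 2 * (s * s)) (g 0 + M * t).
    have i1 : is_derive t (1:R) (fun s : R => g 0 * s) (g 0 *: 1) by exact: is_deriveZ.
    have i2 : is_derive t (1:R) (fun s : R => M / 2 * (s * s)) ((M / 2) *: (t *: 1 + t *: 1)).
      by apply: is_deriveZ; exact: is_deriveM.
    apply: (is_derive_eq (is_deriveD i1 i2)).
    by rewrite -![_ *: _]/(_ * _); field.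
  exact: is_deriveB.
have : k b <= k 0.
  apply: (derive_le_le b0 dk) => t tb; rewrite subr_le0; exact: gl.
rewrite /k mulr0 !mul0r mulr0 addr0 subr0 lerBlDr => H; apply: le_trans H _.
by rewrite le_eqVlt; apply/orP; left; apply/eqP; field.
Qed.

(** For nonnegative [f] this is the classical bound from a Taylor parabola, evaluated at its minimum
    [b = - g 0 / M]. Here the sign of [f] up to [b] comes from the zero condition: at a zero of [f]
    the derivative [g] would have climbed from [g 0] to 0 with slope at most [M], which takes at
    least the time [b]. *)
Lemma zero_derive_bound_pos f g h (M rho : R) : 0 < M ->
  (forall t, `|t| < rho -> is_derive t (1:R) f (g t)) ->
  (forall t, `|t| < rho -> is_derive t (1:R) g (h t)) ->
  (forall t, `|t| < rho -> `|h t| <= M) ->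
  (forall t, `|t| < rho -> f t = 0 -> g t = 0) ->
  0 < f 0 -> g 0 < 0 -> - g 0 < M * rho -> g 0 ^+ 2 <= 2 * M * f 0.
Proof.
move=> M0 fg gh hM fz f0 g0 gr.
pose b := - g 0 / M; have b0 : 0 < b by rewrite divr_gt0// oppr_gt0.
have br : b < rho by rewrite ltr_pdivrMr// mulrC.
have lt t : 0 <= t <= b -> `|t| < rho by move=> /andP[t0 tb]; rewrite ger0_norm// (le_lt_trans tb).
have T := taylor_le (ltW b0) (fun t H => fg t (lt t H)) (fun t H => gh t (lt t H)) (fun t H => hM t (lt t H)).
have fb : 0 <= f b.
  rewrite leNgt; apply/negP => fb.
  have cf : {within `[0, b], continuous f}.
    apply: derivable_within_continuous => t; rewrite in_itv/= => h'.
    exact: (@ex_derive _ _ _ _ _ _ _ (fg t (lt t h'))).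
  have [|c cI fc] := IVT (ltW b0) cf (v := 0).
    by rewrite ge_min le_max (ltW fb) (ltW f0) orbT.
  move: cI; rewrite in_itv/= => /andP[c0 cb].
  have cb' : c < b by rewrite lt_neqAle cb andbT; apply/eqP => E; rewrite E in fc; rewrite fc ltxx in fb.
  have c1 : `|c| < rho by apply: lt; rewrite c0 cb.
  have := fz c c1 fc.
  have := @lipschitz_derive g h M 0 c c0; rewrite subr0 => /(_ _ _)/le_trans H gc.
  have : g c - g 0 <= M * c.
    apply: le_trans (ler_norm _) _; apply: (H) => //.
      by move=> s /andP[s0 st]; apply: gh; apply: lt; rewrite s0 (le_trans st).
    by move=> s /andP[s0 st]; apply: hM; apply: lt; rewrite s0 (le_trans st).
  rewrite gc sub0r leNgt; rewrite /b ltr_pdivlMr// mulrC in cb'; by rewrite cb'.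
have : 0 <= f 0 + g 0 * b + M * b ^+ 2 / 2 by exact: le_trans fb T.
have -> : f 0 + g 0 * b + M * b ^+ 2 / 2 = (2 * M * f 0 - g 0 ^+ 2) / (2 * M).
  by rewrite /b; field; rewrite gt_eqF.
by rewrite pmulr_lge0 ?invr_gt0 ?mulr_gt0// subr_ge0.
Qed.

End OneVariableTools.

Section PlaneTools.
Context (R : realType).
Local Notation V := 'rV[R]_2.
Implicit Types (f : V -> R) (U : set V) (x y a : V).

Definition axis (b : bool) : V := delta_mx 0 (idx b).

Lemma is_derive_axis b f (c : R) x t : differentiable f (t *: (c *: axis b) + x) ->
  is_derive t (1:R) (fun s => f (s *: (c *: axis b) + x)) (c * pd b f (t *: (c *: axis b) + x)).
Proof.
move=> df; have := is_derive_line df; rewrite derive_partial//.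
rewrite (_ : \sum_i _ = c * pd b f (t *: (c *: axis b) + x))//.
rewrite (bigD1 (idx b))//= big1 ?addr0; first by rewrite pdfE !mxE !eqxx mulr1.
by move=> i ib; rewrite !mxE eqxx /= (negbTE ib) mulr0 mul0r.
Qed.

Lemma nc_axis b (c : R) : nc (xc (c *: axis b)) = `|c|.
Proof.
apply/eqP; rewrite -(@eqrXn2 _ 2) ?nc_ge0// nc_sqr real_normK ?num_real//.
by rewrite /xc /= !mxE !eqxx; case: b => /=; rewrite ?mulr1 ?mulr0 ?expr0n/= ?addr0 ?add0r.
Qed.

Lemma xcD x y : xc (x + y) = xc x + xc y.
Proof. by rewrite /xc !mxE. Qed.
Lemma xcZ (c : R) x : xc (c *: x) = c%:C * xc x.
Proof. by rewrite /xc !mxE; apply: complex_ext; rewrite !ReImE /=; ring. Qed.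
Lemma xc0 : xc (0 : V) = 0.
Proof. by rewrite /xc !mxE. Qed.

Lemma eball_nc (r : R) y : eball r y = (nc (xc y) < r) :> Prop.
Proof. by rewrite /eball /= enorm_xc. Qed.

Lemma eball_axis (r : R) b (c t : R) x : nc (xc x) + `|t| * `|c| < r -> eball r (t *: (c *: axis b) + x).
Proof.
rewrite eball_nc xcD addrC => h; apply: le_lt_trans (ncD _ _) (le_lt_trans _ h).
by rewrite lerD2r xcZ ncM ncR nc_axis.
Qed.

(* The partial derivative cannot vanish before distance |pd b f x| / M, hence neither can f,
   and Taylor's formula at that distance gives the bound. *)
Lemma partial_sqr_le (r rho M : R) f b x : 0 < M ->
  C_class 2 (eball r) f -> nc (xc x) + rho <= r -> 0 < rho ->
  (forall y, eball r y -> `|pd b (pd b f) y| <= M) ->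
  (forall y, eball r y -> f y = 0 -> pd b f y = 0) ->
  `|pd b f x| < M * rho -> pd b f x ^+ 2 <= 2 * M * `|f x|.
Proof.
move=> M0 cf xr rho0 hM fz small.
have oU := @open_eball R 1 r.
(* The signs [s] of the function and [c] of the direction reduce all cases to a positive function
   with negative derivative. *)
have main (s c : R) : `|s| = 1 -> `|c| = 1 -> 0 < s * f x -> s * c * pd b f x < 0 ->
   pd b f x ^+ 2 <= 2 * M * `|f x|.
  move=> s1 c1 f0 g0.
  have HU t : `|t| < rho -> eball r (t *: (c *: axis b) + x).
    by move=> tr; apply: eball_axis; rewrite c1 mulr1; apply: lt_le_trans xr; rewrite ltrD2l.
  have s0 : s != 0 by rewrite -normr_eq0 s1 oner_neq0.
  have c0 : c != 0 by rewrite -normr_eq0 c1 oner_neq0.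
  have E0 (h : V -> R) : h (0 *: (c *: axis b) + x) = h x by rewrite scale0r add0r.
  have := @zero_derive_bound_pos R (fun t => s * f (t *: (c *: axis b) + x))
    (fun t => s * (c * pd b f (t *: (c *: axis b) + x)))
    (fun t => s * (c * (c * pd b (pd b f) (t *: (c *: axis b) + x)))) M rho M0.
  have Ef : s * f x = `|f x| by rewrite -(gtr0_norm f0) normrM s1 mul1r.
  have E2 : (s * (c * pd b f x)) ^+ 2 = pd b f x ^+ 2.
    by rewrite !exprMn -[s ^+ 2](real_normK (num_real s)) -[c ^+ 2](real_normK (num_real c)) s1 c1 !expr1n !mul1r.
  rewrite !E0 E2 Ef; apply => //.
  - move=> t /HU Ut; apply: is_deriveZ; apply: is_derive_axis.
    exact: C_class_diff cf Ut.
  - move=> t /HU Ut; apply: is_deriveZ; apply: is_deriveZ; apply: is_derive_axis.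
    exact: C_class_diff (C_class_pd b cf) Ut.
  - by move=> t /HU Ut; rewrite !normrM s1 c1 !mul1r; exact: hM.
  - move=> t /HU Ut /eqP; rewrite mulf_eq0 (negbTE s0)/= => /eqP /(fz _ Ut) ->.
    by rewrite !mulr0.
  - by rewrite -Ef.
  - by rewrite mulrA.
  - by apply: le_lt_trans small; apply: le_trans (ler_norm _) _; rewrite normrN !normrM s1 c1 !mul1r.
have N1 : `|-1 : R| = 1 by rewrite normrN normr1.
have N0 : `|1 : R| = 1 by rewrite normr1.
have [fx0|fx0|fx0] := ltgtP (f x) 0; last first.
- rewrite fz// ?expr0n/= ?mulr_ge0 ?(ltW M0)// eball_nc; apply: lt_le_trans xr; by rewrite ltrDl.
- have [gx|gx|->] := ltgtP (pd b f x) 0.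
  + by apply: (main 1 1) => //; rewrite ?mul1r.
  + by apply: (main 1 (-1)) => //; rewrite ?mul1r ?mulN1r ?oppr_lt0.
  + by rewrite expr0n/= !mulr_ge0// ltW.
- have [gx|gx|->] := ltgtP (pd b f x) 0.
  + by apply: (main (-1) (-1)) => //; rewrite ?mulrNN ?mul1r ?mulN1r ?oppr_gt0.
  + by apply: (main (-1) 1) => //; rewrite ?mulr1 ?mulN1r ?oppr_lt0 ?oppr_gt0.
  + by rewrite expr0n/= !mulr_ge0// ltW.
Qed.

Lemma norm_le_enorm y : `|y| <= nc (xc y).
Proof.
rewrite -[`|y|]/(mx_norm y) mx_normrE; apply: bigmax_le; first exact: nc_ge0.
move=> [i j] _ /=; rewrite ord1.
have -> : j = idx (j != 0).
  by rewrite /idx; case: (unliftP 0 j) => [k ->|->] /=; rewrite ?eqxx// ord1; apply: val_inj.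
by case: (j != 0); [exact: (nc_Im (xc y))|exact: (nc_Re (xc y))].
Qed.

Lemma compact_closed_nc (K : set V) (rho : R) :
  closed K -> (forall y, K y -> nc (xc y) <= rho) -> compact K.
Proof.
move=> cK hK; apply: bounded_closed_compact => //.
exists rho; split; first exact: num_real.
by move=> M rM y /hK h /=; apply: le_trans (norm_le_enorm y) (le_trans h (ltW rM)).
Qed.

Lemma max_interior (K O : set V) f x0 : compact K -> O `<=` K ->
  (forall y, K y -> {for y, continuous f}) -> O x0 -> 0 < f x0 ->
  (forall y, K y -> ~ O y -> f y <= 0) ->
  exists2 x, O x & forall y, K y -> f y <= f x.
Proof.
move=> cK OK cf Ox0 f0 hK.
have [||x xK hx] := EVT_max_rV _ cK (f := f).
- by exists x0; exact: OK.
- by apply: continuous_in_subspaceT => y; rewrite inE; exact: cf.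
rewrite inE in xK.
have hx' y : K y -> f y <= f x by move=> Ky; apply: hx; rewrite inE.
exists x => //; apply: contrapT => nO.
by have := lt_le_trans f0 (le_trans (hx' _ (OK _ Ox0)) (hK _ xK nO)); rewrite ltxx.
Qed.

Lemma lipschitz_ball (r M : R) f x : C_class 1 (eball r) f -> eball r x ->
  (forall b y, nc (xc y) <= nc (xc x) -> `|pd b f y| <= M) -> `|f x - f 0| <= 2 * M * nc (xc x).
Proof.
move=> cf xr hM.
have oU := @open_eball R 1 r.
have hU t : 0 <= t <= 1 -> nc (xc (t *: x + 0)) <= nc (xc x).
  by move=> /andP[t0 t1]; rewrite addr0 xcZ ncM ncR ger0_norm// ler_piMl// nc_ge0.
have dU t : 0 <= t <= 1 -> differentiable f (t *: x + 0).
  by move=> /hU h; apply: C_class_diff cf _; rewrite eball_nc; apply: le_lt_trans h _; rewrite -eball_nc.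
have := @lipschitz_derive R (fun t => f (t *: x + 0)) (fun t => 'D_x f (t *: x + 0)) (2 * M * nc (xc x)) 0 1 ler01.
rewrite scale1r scale0r !addr0 subr0 mulr1; apply.
- by move=> t /dU; exact: is_derive_line.
- move=> t tI; rewrite (derive_partial _ (dU t tI)) sum_I2.
  rewrite -[partial _ f _]/(partial (idx false) f _) -!pdfE.
  apply: le_trans (ler_normD _ _) _; rewrite !normrM -mulrA mulr_natl mulr2n ![M * _]mulrC.
  apply: lerD; apply: ler_pM => //; [exact: (nc_Re (xc x))|exact: hM (hU t tI)|exact: (nc_Im (xc x))|exact: hM (hU t tI)].
Qed.

End PlaneTools.

(** * Reduction to the complex form *)

(* Half sum and half difference of the two arctangents: t is the tangent of the latter,
   and |t| will be |w|. *)
Lemma phase_angles (R : realType) (l1 l2 : R) :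
  let e := tan ((atan l1 + atan l2) / 2) in
  cos ((atan l1 + atan l2) / 2) != 0 /\
  exists t, [/\ 0 < 1 - e * t, 0 < 1 + e * t,
    l1 = (e + t) / (1 - e * t) & l2 = (e - t) / (1 + e * t)].
Proof.
move=> e; set h := (atan l1 + atan l2) / 2 in e *.
pose p := (atan l1 - atan l2) / 2.
have a1 := atan_gtNpi2 l1; have b1 := atan_ltpi2 l1.
have a2 := atan_gtNpi2 l2; have b2 := atan_ltpi2 l2.
have pi0 := pi_gt0 R.
have ch : 0 < cos h by apply: cos_gt0_pihalf; rewrite /h; apply/andP; split; lra.
have cp : 0 < cos p by apply: cos_gt0_pihalf; rewrite /p; apply/andP; split; lra.
have E1 : atan l1 = h + p by rewrite /h /p; field.
have E2 : atan l2 = h - p by rewrite /h /p; field.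
have c1 : 0 < cos (h + p) by rewrite -E1; apply: cos_gt0_pihalf; rewrite a1 b1.
have c2 : 0 < cos (h - p) by rewrite -E2; apply: cos_gt0_pihalf; rewrite a2 b2.
split; first by rewrite gt_eqF.
exists (tan p); split.
- have -> : 1 - e * tan p = cos (h + p) / (cos h * cos p).
    by rewrite cosD /e /tan; field; rewrite !gt_eqF.
  by rewrite divr_gt0// mulr_gt0.
- have -> : 1 + e * tan p = cos (h - p) / (cos h * cos p).
    by rewrite cosB /e /tan; field; rewrite !gt_eqF.
  by rewrite divr_gt0// mulr_gt0.
- by rewrite -[LHS]atanK E1 tanD// gt_eqF.
- by rewrite -[LHS]atanK E2 tanD ?cosN ?gt_eqF// tanN mulrN opprK.
Qed.

(** From [atan s <= s] for nonnegative [s]. It passes from [|Th|], which controls the gradient of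
    [Th], to [|e|], which is small where [|w|] is large. *)
Lemma abs_half_le_tan (R : realType) (t : R) : - pi < t < pi -> `|t| <= 2 * `|tan (t / 2)|.
Proof.
move=> /andP[t1 t2].
have H (s : R) : 0 <= s -> atan s <= s.
  move=> s0; have := @lipschitz_derive R (@atan R) (fun x => (1 + x ^+ 2)^-1) 1 0 s s0.
  rewrite atan0 !subr0 mul1r => L; apply: le_trans (ler_norm _) (L _ _) => x _.
  have h : 1 <= 1 + x ^+ 2 by rewrite lerDl sqr_ge0.
  by rewrite ger0_norm ?invr_ge0 ?(le_trans ler01 h)// invf_le1// (lt_le_trans ltr01 h).
have tI : t / 2 \in `](- (pi / 2)), (pi / 2)[ by rewrite in_itv/=; apply/andP; split; lra.
have Et : t = 2 * atan (tan (t / 2)) by rewrite tanK//; field.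
have main : `|atan (tan (t / 2))| <= `|tan (t / 2)|.
  have [h|h] := leP 0 (tan (t / 2)).
    have a0 : 0 <= atan (tan (t / 2)) by rewrite -(atan0 R) le_atan.
    by rewrite (ger0_norm a0) (ger0_norm h) H.
  have h' : 0 <= - tan (t / 2) by rewrite oppr_ge0 ltW.
  have a0 : 0 <= atan (- tan (t / 2)) by rewrite -(atan0 R) le_atan.
  by rewrite -normrN -atanN -[leRHS]normrN (ger0_norm a0) (ger0_norm h') H.
by rewrite {1}Et normrM ger0_norm// ler_pM2l.
Qed.

Lemma trace_det_char_poly (R : realType) (A : 'M[R]_2) (l1 l2 : R) :
  char_poly A = ('X - l1%:P) * ('X - l2%:P) ->
  A (idx false) (idx false) + A (idx true) (idx true) = l1 + l2 /\
  A (idx false) (idx false) * A (idx true) (idx true)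
    - A (idx false) (idx true) * A (idx true) (idx false) = l1 * l2.
Proof.
move=> E; split.
  have := @char_poly_trace R 2 A isT; rewrite E /= /mxtrace sum_I2 => H.
  apply/eqP; rewrite -eqr_opp -H.
  by rewrite mulrBl !mulrBr !coefB !coefXM !coefMX !coefCM !coefC !coefX /=; apply/eqP; ring.
have := @char_poly_det R 2 A; rewrite E => H.
have : \det A = l1 * l2.
  move: H; rewrite mulrBl !mulrBr !coefB !coefXM !coefMX !coefCM !coefC !coefX /=.
  by rewrite sqrrN expr1n mul1r => <-; ring.
rewrite (expand_det_row _ (idx false)) sum_I2 /cofactor !det_mx11 !mxE => <-.
have -> : lift (idx false) ord0 = idx true by apply: val_inj.
have -> : lift (idx true) ord0 = idx false by apply: val_inj.
by rewrite /idx /= !expr0 expr1 mul1r mulN1r mulrN.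
Qed.

(** Behind it is [1 + e T = (1 + e^2) / (1 - e^2 t^2)], while half the difference of the eigenvalues
    is [t (1 + e^2) / (1 - e^2 t^2)]: this is the reason for dividing by [1 + e T] in the definition
    of [w]. *)
Lemma phase_identities (R : realType) (e t l1 l2 : R) :
  0 < 1 - e * t -> 0 < 1 + e * t ->
  l1 = (e + t) / (1 - e * t) -> l2 = (e - t) / (1 + e * t) ->
  let T := (l1 + l2) / 2 in
  [/\ 0 < 1 + e * T, e ^+ 2 * t ^+ 2 < 1,
    ((l1 - l2) / 2) ^+ 2 = t ^+ 2 * (1 + e * T) ^+ 2 &
    T * (1 - e ^+ 2 * t ^+ 2) = e * (1 + t ^+ 2)].
Proof.
move=> p q -> -> T.
have pn : 1 - e * t != 0 by rewrite gt_eqF.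
have qn : 1 + e * t != 0 by rewrite gt_eqF.
have D : 0 < 1 - e ^+ 2 * t ^+ 2.
  by rewrite (_ : 1 - _ = (1 - e * t) * (1 + e * t)) ?mulr_gt0//; ring.
have E : 1 + e * T = (1 + e ^+ 2) / ((1 - e * t) * (1 + e * t)).
  by rewrite /T; field; rewrite pn qn.
split; last by rewrite /T; field; rewrite pn qn.
- by rewrite E divr_gt0 ?mulr_gt0// ltr_pwDl// sqr_ge0.
- by rewrite -subr_gt0.
- by rewrite E; field; rewrite pn qn.
Qed.

Section Reduction.
Context (R : realType).
Local Notation V := 'rV[R]_2.
Variables (U : set V) (Th u l1 l2 : V -> R).

Definition grad_c (y : V) : R[i] := pd false u y +i* pd true u y.
Definition half_lap (y : V) : R := (pd false (pd false u) y + pd true (pd true u) y) / 2.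
Definition hopf (y : V) : R[i] :=
  ((pd false (pd false u) y - pd true (pd true u) y) / 2) +i* - pd false (pd true u) y.
Definition tan_half (y : V) : R := tan (Th y / 2).
(** The denominator is positive on [U] by [reduction_pointwise], so no inverse of 0 is taken
    there. *)
Definition hopf_ratio (y : V) : R[i] := hopf y * ((1 + tan_half y * half_lap y)^-1)%:C.

Hypotheses (oU : open U) (cTh : C_class 2 U Th) (cu : smooth U u).
Hypothesis hchar : forall x, U x ->
  char_poly (hessian u x) = ('X - (l1 x)%:P) * ('X - (l2 x)%:P).
Hypothesis heq : forall x, U x -> atan (l1 x) + atan (l2 x) = Th x.

Lemma hessian_pd (y : V) a b : hessian u y (idx a) (idx b) = pd b (pd a u) y.
Proof. by rewrite !pdfE mxE. Qed.

(** The eigenvalue functions carry no regularity. They enter at one point at a time, through trace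
    and determinant, and the conclusions mention only expressions in [u] and [Th]. *)
Lemma reduction_pointwise y : U y ->
  [/\ cos (Th y / 2) != 0, 0 < 1 + tan_half y * half_lap y,
    tan_half y ^+ 2 * nc (hopf_ratio y) ^+ 2 < 1 &
    half_lap y * (1 - tan_half y ^+ 2 * nc (hopf_ratio y) ^+ 2) =
      tan_half y * (1 + nc (hopf_ratio y) ^+ 2)].
Proof.
move=> Uy; have [] := phase_angles (l1 y) (l2 y).
rewrite heq// -/(tan_half y) => c0 [t [p q E1 E2]]; split=> //;
  have [htr hdet] := trace_det_char_poly (hchar Uy);
  rewrite !hessian_pd in htr hdet;
  have [] := phase_identities p q E1 E2;
  (have -> : (l1 y + l2 y) / 2 = half_lap y by rewrite -htr);
  move=> h1 h2 h3 h4 //.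
(* Both sides are the discriminant, the squared half trace minus the determinant. *)
all: have Nh : nc (hopf y) ^+ 2 = ((l1 y - l2 y) / 2) ^+ 2.
  1,3: rewrite nc_sqr /hopf /= (pdC oU (cu 2) Uy);
    rewrite (pdC oU (cu 2) Uy) in hdet; move: htr hdet; clear;
    move: (pd _ _ y) (pd _ _ y) (pd _ _ y) (l1 y) (l2 y) => a b c p q h1 h2;
    have -> : ((p - q) / 2) ^+ 2 = (p + q) ^+ 2 / 4 - p * q by field.
  1,2: by rewrite -h1 -h2; field.
all: have Nw : nc (hopf_ratio y) ^+ 2 = t ^+ 2.
  1,3: by rewrite /hopf_ratio ncM ncR exprMn Nh h3 real_normK ?num_real// exprVn mulfK// expf_neq0// gt_eqF.
all: by rewrite Nw.
Qed.

(** Two derivatives of [hopf_ratio] take four of [u] but only two of [Th], which is why a phase of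
    class C^2 is enough. *)
Lemma phase_system_of_equation :
  phase_system U half_lap tan_half Th hopf hopf_ratio grad_c.
Proof.
have cu2 a b : C_class 2 U (pd a (pd b u)) := C_class_pd a (C_class_pd b (cu 4)).
have ch : C_class 2 U half_lap.
  exact: C_classM oU (C_classD oU (cu2 _ _) (cu2 _ _)) (C_class_cst 2 U 2^-1).
have ce : C_class 2 U tan_half.
  by apply: (C_class_tan2 oU _ cTh) => y /reduction_pointwise[].
have cG : CC 2 U hopf.
  split; last exact: C_classN oU (cu2 _ _).
  exact: C_classM oU (C_classB oU (cu2 _ _) (cu2 _ _)) (C_class_cst 2 U 2^-1).
have cw : CC 2 U hopf_ratio.
  have c1 := C_classD oU (C_class_cst 2 U 1) (C_classM oU ce ch).
  have n1 y : U y -> 1 + tan_half y * half_lap y != 0.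
    by move=> /reduction_pointwise[_ h _ _]; rewrite gt_eqF.
  exact: CCM oU cG (CC_real (C_classV oU n1 c1)).
have cP : CC 2 U grad_c by split; exact: C_class_pd (cu 3).
apply: (PhaseSystem oU ch ce cTh cG cw cP).
- move=> y Uy; rewrite dzE /grad_c /= (pdC oU (cu 2) Uy) subrr /half_lap.
  by apply: complex_ext; rewrite !ReImE /=; field.
- move=> y Uy; rewrite dbE /grad_c /= (pdC oU (cu 2) Uy) /hopf ?(pdC oU (cu 2) Uy).
  by apply: complex_ext; rewrite !ReImE /=; field.
- move=> y Uy; have [c0 _ _ _] := reduction_pointwise Uy.
  have dT := C_class_diff cTh Uy.
  rewrite !dz_real /tan_half !(pd_comp _ (h := fun s => tan (s / 2)) dT (is_derive_tan2 c0)).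
  by apply: complex_ext; rewrite !ReImE /=; ring.
- move=> y Uy; have [_ h _ _] := reduction_pointwise Uy.
  rewrite /hopf_ratio -rmorphM -(rmorph1 (real_complex R)) -rmorphD -mulrA -rmorphM mulVf ?rmorph1 ?mulr1// gt_eqF//.
- move=> y Uy; have [_ _ _ h] := reduction_pointwise Uy.
  rewrite nc_conj -!rmorphXn -!rmorphM -(rmorph1 (real_complex R)) -rmorphB -rmorphD -!rmorphM; congr (_%:C); exact: h.
- move=> y Uy; have [_ _ h _] := reduction_pointwise Uy.
  by rewrite ncM ncR -(@expr_lt1 _ 2) ?mulr_ge0 ?nc_ge0// exprMn real_normK ?num_real.
Qed.

End Reduction.

Lemma phase_system_sub (R : realType) (U U' : set 'rV[R]_2) T e Th G w P : open U' ->
  (forall y, U' y -> U y) -> phase_system U T e Th G w P -> phase_system U' T e Th G w P.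
Proof.
move=> oU' s [? ? ? ? ? ? ? ? ? ? ? ? ?]; split=> //; try (by move=> y /s; auto);
  solve [exact: C_class_sub s _ | exact: CC_sub s _].
Qed.

(** * Bounds from the norms *)

Section Norms.
Context (R : realType).
Local Notation V := 'rV[R]_2.
Variables (U : set V) (x0 : V).
Hypothesis Ux0 : U x0.
Implicit Types f : V -> R.

Lemma fine_addl (S1 S2 : \bar R) (a : R) : (0 <= S2)%E -> (S1 + S2 < +oo)%E ->
  (a%:E <= S1)%E -> a <= fine (S1 + S2).
Proof.
move=> h2 hs h1; have h : (a%:E <= S1 + S2)%E by apply: le_trans h1 _; rewrite leeDl.
rewrite -lee_fin fineK// fin_numElt hs andbT; exact: lt_le_trans (ltNyr a) h.
Qed.

Lemma sup_ge0 (F : V -> R) : (forall y, 0 <= F y) ->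
  (0 <= ereal_sup [set (F y)%:E | y in U])%E.
Proof.
move=> F0; apply: le_trans (_ : (F x0)%:E <= _)%E; first by rewrite lee_fin.
by apply: ereal_sup_ubound; exists x0.
Qed.

Lemma sup_ub (F : V -> R) y : U y -> ((F y)%:E <= ereal_sup [set (F y)%:E | y in U])%E.
Proof. by move=> Uy; apply: ereal_sup_ubound; exists y. Qed.

Lemma C1_norm_ge0 f : (0 <= C1_norm U f)%E.
Proof. by rewrite adde_ge0// sup_ge0// => y; exact: enorm_ge0. Qed.

Lemma enorm_grad f y : enorm (grad f y) = nc (grad_c f y).
Proof. by rewrite enorm_xc /xc /grad_c !mxE !pdfE. Qed.

Lemma grad_le_C1 f y : (C1_norm U f < +oo)%E -> U y -> nc (grad_c f y) <= fine (C1_norm U f).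
Proof.
rewrite /C1_norm addeC => h Uy; apply: fine_addl h _; first exact: sup_ge0.
by rewrite -enorm_grad; exact: (sup_ub (fun y => enorm (grad f y))).
Qed.

Lemma C1_le_C2 f : (C2_norm U f < +oo)%E -> (C1_norm U f < +oo)%E.
Proof.
by apply: le_lt_trans; rewrite leeDl// sup_ge0// => y; exact: enorm_ge0.
Qed.

Lemma grad_le_C2 f y : (C2_norm U f < +oo)%E -> U y -> nc (grad_c f y) <= fine (C2_norm U f).
Proof.
move=> h Uy; apply: fine_addl (h) _; first by apply: sup_ge0 => t; exact: enorm_ge0.
have h1 := C1_le_C2 h; rewrite -(fineK (x := C1_norm U f)) ?lee_fin; first exact: grad_le_C1.
by rewrite ge0_fin_numE// C1_norm_ge0.
Qed.

Lemma entry_le_enorm m n (A : 'M[R]_(m, n)) i j : `|A i j| <= enorm A.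
Proof.
rewrite -sqrtr_sqr ler_wsqrtr// (bigD1 i)//= (bigD1 j)//= -addrA lerDl.
by rewrite addr_ge0// sumr_ge0// => k _; rewrite ?sqr_ge0// sumr_ge0// => l _; rewrite sqr_ge0.
Qed.

Lemma pd2_le_C2 f a b y : (C2_norm U f < +oo)%E -> U y ->
  `|pd a (pd b f) y| <= fine (C2_norm U f).
Proof.
rewrite /C2_norm addeC => h Uy; apply: fine_addl h _; first exact: C1_norm_ge0.
apply: le_trans (sup_ub (fun y => enorm (hessian f y)) Uy).
by rewrite lee_fin -(hessian_pd f y b a) entry_le_enorm.
Qed.

End Norms.

Section SecondDerivativeBounds.
Context (R : realType).
Local Notation V := 'rV[R]_2.
Implicit Types (f : V -> R) (U : set V).

Lemma nc_dz_grad f y : nc (dz (cplx f) y) = nc (grad_c f y).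
Proof. by rewrite dz_real -ncJ /grad_c /= opprK. Qed.

Lemma nc_dz_le (F : V -> R[i]) y (M : R) : (forall a, `|pd a (fun y => Re (F y)) y| <= M) ->
  (forall a, `|pd a (fun y => Im (F y)) y| <= M) -> nc (dz F y) <= 4 * M /\ nc (db F y) <= 4 * M.
Proof.
move=> h1 h2; have -> : 4 * M = (M + M) + (M + M) by ring.
by split; [rewrite dzE|rewrite dbE]; apply: nc_le => /=;
  (apply: le_trans (ler_normD _ _) _ || apply: le_trans (ler_normB _ _) _); rewrite ?normrN lerD.
Qed.

(** The form [2 * (4 * M)] fits the hypotheses with [2 * K] of the two maximum arguments, which are
    applied with [K = 4 * b]. *)
Lemma DB_second_le f U y z (M : R) : open U -> C_class 2 U f -> U y -> nc z <= 1 ->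
  (forall a b, `|pd a (pd b f) y| <= M) ->
  nc (DB z (dz (cplx f)) y) <= 2 * (4 * M) /\ nc (DB z (db (cplx f)) y) <= 2 * (4 * M).
Proof.
move=> oU cf Uy z1 hM.
have cN b : C_class 1 U (pd b f) := C_class_pd b cf.
have NN a b : `|pd a (fun y => - pd b f y) y| <= M.
  by rewrite pdN ?normrN//; exact: C_class_diff (cN b) Uy.
have main F : nc (dz F y) <= 4 * M /\ nc (db F y) <= 4 * M -> nc (DB z F y) <= 2 * (4 * M).
  move=> [h1 h2]; rewrite /DB; apply: le_trans (ncB _ _) _.
  rewrite [2 * _]mulr_natl mulr2n lerD// ncM; apply: le_trans h2.
  by rewrite ler_piMl// nc_ge0.
split; apply: main; apply: nc_dz_le => a.
- by rewrite (_ : (fun y => Re _) = pd false f)//; apply/funext => t; rewrite dz_real.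
- by rewrite (_ : (fun y => Im _) = (fun y => - pd true f y))//; apply/funext => t; rewrite dz_real.
- by rewrite (_ : (fun y => Re _) = pd false f)//; apply/funext => t; rewrite db_real dz_real.
- by rewrite (_ : (fun y => Im _) = pd true f)//; apply/funext => t; rewrite db_real dz_real /= opprK.
Qed.

End SecondDerivativeBounds.

(** * Bound for w at the centre *)

(** Collects what the estimates use about a solution, so that each bound below can fix its constant
    from [A], [b] and [r] before the functions are given. *)
Record controlled (R : realType) (A b r : R) (T e Th : 'rV[R]_2 -> R)
    (G w P : 'rV[R]_2 -> R[i]) : Prop := Controlled {
  ct_sys : phase_system (eball r) T e Th G w P;
  ct_P : forall y, eball r y -> nc (P y) <= A;
  ct_dTh : forall y, eball r y -> nc (dz (cplx Th) y) <= b;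
  ct_ddTh : forall y i j, eball r y -> `|pd i (pd j Th) y| <= b;
  ct_pi : forall y, eball r y -> - pi < Th y < pi;
  ct_e : forall y, e y = tan (Th y / 2);
  ct_crit : forall y i, eball r y -> Th y = 0 -> pd i Th y = 0 }.

Lemma closed_nc (R : realType) (rho : R) : closed [set y : 'rV[R]_2 | nc (xc y) <= rho].
Proof.
rewrite (_ : [set y | _] = (fun y : 'rV[R]_2 => enorm y) @^-1` [set t | t <= rho]).
  by apply: closed_comp; [move=> y _; exact: continuous_enorm|exact: closed_le].
by apply/seteqP; split => y /=; rewrite enorm_xc.
Qed.

Lemma sqr_le_of_quadratic (R : realType) (q B C : R) : 3 * q ^+ 2 <= B * q + C -> q ^+ 2 <= B ^+ 2 + C.
Proof.
move=> h; have h1 : 0 <= (B / 2 - q) ^+ 2 by exact: sqr_ge0.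
have h2 := sqr_ge0 q; have h3 := sqr_ge0 B; rewrite sqrrB in h1.
have E : B / 2 * q *+ 2 = B * q by field.
rewrite E expr_div_n in h1; rewrite (_ : 2 ^+ 2 = 4 :> R) in h1; last by ring.
move: h h1 h2 h3; clear; move: (q ^+ 2) (B ^+ 2) (B * q) => a b c; lra.
Qed.

Lemma le_one_plus_of_sqr_le (R : realType) (x q : R) : 0 <= x -> x ^+ 2 <= q -> x <= 1 + q.
Proof. by move=> x0 h; apply: le_trans (_ : x <= 1 + x ^+ 2) _; [nra|lra]. Qed.

(** The gradient vanishes where [Th] does, so [partial_sqr_le] bounds its square by [|Th|], and
    [|Th| <= 2 |e|]. The summand [2 * b / r] makes [b < M * (r / 2)]: the distance that
    [partial_sqr_le] needs is available inside the ball. *)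
Lemma grad_sqr_le (R : realType) (A b r : R) (T e Th : 'rV[R]_2 -> R)
    (G w P : 'rV[R]_2 -> R[i]) y (D : controlled A b r T e Th G w P) : 0 <= b -> 0 < r -> nc (xc y) < r / 2 ->
  nc (dz (cplx Th) y) ^+ 2 <= 8 * (b + 2 * b / r + 1) * `|e y|.
Proof.
move=> b0 r0 yr; set M := b + 2 * b / r + 1.
have M0 : 0 < M by rewrite ltr_wpDl// addr_ge0// divr_ge0 ?mulr_ge0// ltW.
have yr' : eball r y by rewrite eball_nc; move: yr r0; clear; lra.
have cTh := ps_Th (ct_sys D).
have hM z i : eball r z -> `|pd i (pd i Th) z| <= M.
  move=> zr; apply: le_trans (ct_ddTh D i i zr) _.
  by rewrite /M -addrA lerDl addr_ge0// divr_ge0 ?mulr_ge0// ltW.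
have bM : b < M * (r / 2).
  rewrite (_ : M * (r / 2) = b + (b * r / 2 + r / 2)); last by rewrite /M; field; rewrite gt_eqF.
  by rewrite ltrDl ltr_wpDl ?divr_gt0// !mulr_ge0// ?invr_ge0// ltW.
have gj (j : bool) : pd j Th y ^+ 2 <= 2 * M * `|Th y|.
  apply: (partial_sqr_le (rho := r / 2) M0 cTh).
  - by move: yr; clear; lra.
  - by rewrite divr_gt0.
  - by move=> z; exact: hM.
  - by move=> z; exact: (ct_crit D).
  - apply: le_lt_trans bM; apply: le_trans (ct_dTh D yr').
    rewrite nc_dz_grad; case: j; [exact: (nc_Im (grad_c Th y))|exact: (nc_Re (grad_c Th y))].
have := abs_half_le_tan (ct_pi D yr'); rewrite -(ct_e D) => hTh.
rewrite nc_dz_grad nc_sqr /=; apply: le_trans (lerD (gj false) (gj true)) _.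
rewrite -mulrDr -mulr2n -[8 * M](_ : 2 * M * 4 = _); last by ring.
rewrite -[leRHS]mulrA ler_wpM2l ?mulr_ge0 ?(ltW M0)//.
by rewrite -mulr_natr; move: hTh; clear; lra.
Qed.

(** A dichotomy at the maximum point: if [|w|] is below [W1] there, the test function is bounded
    directly; otherwise [|e|], and with it the gradient of [Th], is small enough for
    [w_bound_at_max]. Either way its maximum, hence its value at 0, is bounded. *)
Lemma w_center_bound (R : realType) (A b r : R) : 0 <= A -> 0 <= b -> 0 < r ->
  exists2 C, 1 <= C & forall T e Th G w P,
    controlled A b r T e Th G w P -> nc (w 0) <= C.
Proof.
move=> A0 b0 r0.
pose rho := r / 2; have rho0 : 0 < rho by rewrite divr_gt0.
pose M := b + 2 * b / r + 1.
have M0 : 0 < M by rewrite ltr_wpDl// addr_ge0// divr_ge0 ?mulr_ge0// ltW.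
(* With 29 in place of 28 there is room to spare: [eps ^+ 2 <= eps] and
   [(29 + 80 * A) * eps = 1]. *)
pose eps := (29 + 80 * A)^-1.
have e0 : 0 < eps by rewrite invr_gt0 ltr_wpDr// mulr_ge0.
have e1 : eps <= 1.
  by rewrite invf_le1 ?ltr_wpDr ?mulr_ge0//; move: A0; clear; lra.
have small : 28 * eps ^+ 2 + 80 * A * eps <= 1.
  have E : (29 + 80 * A) * eps = 1 by rewrite mulfV// gt_eqF// ltr_wpDr// mulr_ge0.
  have : eps ^+ 2 <= eps by rewrite expr2 ler_piMr// ltW.
  by move: E e0; clear; nra.
(* If [|w| > W1], then [|e| |w| < 1] gives [8 * M * |e| <= eps ^+ 2], and the left side bounds the
   squared gradient of [Th]. *)
pose W1 := 1 + 8 * M / eps ^+ 2.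
(* The coefficient of [|w| et] in [w_bound_at_max] once [et <= rho ^+ 2] is used; the same estimate
   turns [16 et + 32 rho^2] into [48 rho^2]. *)
pose B := 128 * eps * rho + 8 * (4 * b) * rho ^+ 2.
have B0 : 0 <= B by rewrite addr_ge0// !mulr_ge0// ?sqr_ge0// ltW.
pose Q := (1 + W1 ^+ 2) * rho ^+ 4 + (rho ^+ 4 + (B ^+ 2 + 48 * rho ^+ 2)).
have Q1 : 0 <= (1 + W1 ^+ 2) * rho ^+ 4.
  by rewrite mulr_ge0 ?addr_ge0 ?sqr_ge0// exprn_ge0// ltW.
have Q2 : 0 <= rho ^+ 4 + (B ^+ 2 + 48 * rho ^+ 2).
  by rewrite !addr_ge0// ?exprn_ge0 ?mulr_ge0 ?exprn_ge0// ltW.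
have Q0 : 0 <= Q by exact: addr_ge0.
exists (1 + Q * expR (A ^+ 2) / rho ^+ 4).
  by rewrite lerDl !mulr_ge0 ?expR_ge0// invr_ge0 exprn_ge0// ltW.
move=> T e Th G w P D.
have S := ct_sys D.
have oU := ps_open S.
pose K := [set y : 'rV[R]_2 | nc (xc y) <= rho].
have Kr y : K y -> eball r y.
  by rewrite eball_nc /K /= /rho => h; move: h r0; clear; lra.
pose F y := (1 + nc (w y) ^+ 2) * ((rho ^+ 2 - nc (xc y) ^+ 2) ^+ 2) * expR (nc (P y) ^+ 2).
have cF : C_class 0 (eball r) F.
  have c1 := C_classD oU (C_class_cst 2 _ 1) (C_class_nc2 oU (ps_w S)).
  have c2 := C_classB oU (C_class_cst 2 _ (rho ^+ 2)) (C_class_nc2 oU (@CC_xc R 2 _)).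
  have c3 := C_class_nc2 oU (ps_P S).
  have c12 := C_class_le (isT : (0 <= 2)%N) (C_classM oU c1 (C_classM oU c2 c2)).
  move=> y Uy; apply: (@continuousM _ _ (fun y => (1 + nc (w y) ^+ 2) * ((rho ^+ 2 - nc (xc y) ^+ 2) ^+ 2))).
    exact: c12 y Uy.
  apply: (@continuous_comp _ _ _ (fun y => nc (P y) ^+ 2) (@expR R)).
    exact: (C_class_le (isT : (0 <= 2)%N) c3) y Uy.
  exact: continuous_expR.
have O0 : eball rho (0 : 'rV[R]_2) by rewrite eball_nc xc0 ncR normr0.
have OK y : eball rho y -> K y by rewrite eball_nc /K /=; exact: ltW.
have F0 : F 0 = (1 + nc (w 0) ^+ 2) * rho ^+ 4 * expR (nc (P 0) ^+ 2).
  by rewrite /F xc0 ncR normr0 expr0n/= subr0 -exprM.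
have F0p : 0 < F 0.
  by rewrite F0 !mulr_gt0 ?expR_gt0 ?exprn_gt0// ltr_pwDl// sqr_ge0.
have cK : compact K := compact_closed_nc (@closed_nc R rho) (fun y h => h).
have cFK y : K y -> {for y, continuous F} by move=> Ky; exact: cF y (Kr y Ky).
have bd y : K y -> ~ eball rho y -> F y <= 0.
  move=> Ky nOy; have yrho : nc (xc y) = rho.
    by apply/eqP; rewrite eq_le Ky leNgt; apply/negP; rewrite -eball_nc.
  by rewrite /F yrho subrr expr0n/= mulr0 mul0r.
have [x Ox xmax] := max_interior cK OK cFK O0 F0p bd.
have Ux := Kr x (OK x Ox).
have xr : nc (xc x) < rho by rewrite -eball_nc.
pose et := rho ^+ 2 - nc (xc x) ^+ 2.
have et0 : 0 < et by rewrite subr_gt0 ltr_pXn2r ?nnegrE ?nc_ge0// ltW.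
have et1 : et <= rho ^+ 2 by rewrite gerBl sqr_ge0.
have W0 := nc_ge0 (w x).
have key : (1 + nc (w x) ^+ 2) * et ^+ 2 <= Q.
  have e4 : et ^+ 2 <= rho ^+ 4 by rewrite (exprM rho 2 2) ler_pXn2r// nnegrE ?sqr_ge0// ltW.
  have [WW1|WW1] := leP (nc (w x)) W1.
    apply: le_trans (_ : (1 + W1 ^+ 2) * rho ^+ 4 <= Q); last by rewrite lerDl.
    have W10 : 0 <= W1 := le_trans W0 WW1.
    by rewrite ler_pM ?addr_ge0 ?sqr_ge0// lerD2l ler_pXn2r.
  have M8 : 0 <= 8 * M / eps ^+ 2 by rewrite !mulr_ge0 ?invr_ge0 ?sqr_ge0// ltW.
  have Wge1 : 1 <= nc (w x) by apply: le_trans (ltW WW1); rewrite lerDl.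
  have dth : nc (dz (cplx Th) x) <= eps.
    rewrite -(@ler_pXn2r _ 2)// ?nnegrE ?nc_ge0 ?(ltW e0)//.
    apply: le_trans (grad_sqr_le D b0 r0 xr) _; rewrite -/M.
    have EW := ps_lt1 S Ux; rewrite ncM ncR in EW.
    have h : 8 * M <= eps ^+ 2 * nc (w x).
      rewrite [leRHS]mulrC -ler_pdivrMr ?exprn_gt0//; apply: le_trans (ltW WW1).
      by rewrite lerDr.
    have h1 : 8 * M * `|e x| <= eps ^+ 2 * nc (w x) * `|e x| by rewrite ler_wpM2r.
    apply: le_trans h1 _; rewrite -mulrA ler_piMr ?sqr_ge0// mulrC; exact: ltW.
  have [h1 h2] := DB_second_le oU (ps_Th S) Ux (ltW (ps_lt1 S Ux)) (fun i j => ct_ddTh D i j Ux).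
  have S' := phase_system_sub (@open_eball R 1 rho) (fun y h => Kr y (OK y h)) S.
  have lnF y : eball rho y -> ln (F y) = ln (1 + nc (w y) ^+ 2) + (ln (rho ^+ 2 - nc (xc y) ^+ 2)
      + ln (rho ^+ 2 - nc (xc y) ^+ 2)) + nc (P y) ^+ 2.
    rewrite eball_nc => yr.
    have p1 : 0 < 1 + nc (w y) ^+ 2 by rewrite ltr_pwDl// sqr_ge0.
    have p2 : 0 < rho ^+ 2 - nc (xc y) ^+ 2.
      by rewrite subr_gt0 ltr_pXn2r ?nnegrE ?nc_ge0// ltW.
    by rewrite /F !lnM ?posrE ?expR_gt0 ?mulr_gt0// ?exprn_gt0// expRK.
  have Fp y : eball rho y -> 0 < F y.
    rewrite eball_nc => yr.
    have p1 : 0 < 1 + nc (w y) ^+ 2 by rewrite ltr_pwDl// sqr_ge0.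
    have p2 : 0 < rho ^+ 2 - nc (xc y) ^+ 2.
      by rewrite subr_gt0 ltr_pXn2r ?nnegrE ?nc_ge0// ltW.
    exact: mulr_gt0 (mulr_gt0 p1 (exprn_gt0 2 p2)) (expR_gt0 _).
  have lmax y : eball rho y -> ln (1 + nc (w y) ^+ 2) + (ln (rho ^+ 2 - nc (xc y) ^+ 2)
      + ln (rho ^+ 2 - nc (xc y) ^+ 2)) + nc (P y) ^+ 2 <= ln (1 + nc (w x) ^+ 2) +
      (ln (rho ^+ 2 - nc (xc x) ^+ 2) + ln (rho ^+ 2 - nc (xc x) ^+ 2)) + nc (P x) ^+ 2.
    by move=> Oy; rewrite -!lnF// ler_ln ?posrE ?Fp// xmax//; exact: OK.
  have b40 : 0 <= 4 * b by rewrite mulr_ge0.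
  have hball y : eball rho y -> nc (xc y) < rho by rewrite eball_nc.
  have := w_bound_at_max S' Ox Wge1 (ltW e0) b40 (ct_P D Ux) dth h1 h2 hball small lmax.
  rewrite -/et => H.
  have {}H : (nc (w x) * et) ^+ 2 <= B ^+ 2 + 48 * rho ^+ 2.
    apply: sqr_le_of_quadratic; apply: le_trans H _.
    have q0 : 0 <= nc (w x) * et by rewrite mulr_ge0// ltW.
    have t1 : 8 * (4 * b) * et * (nc (w x) * et) <= 8 * (4 * b) * rho ^+ 2 * (nc (w x) * et).
      by rewrite ler_wpM2r// ler_wpM2l// mulr_ge0.
    have -> : B * (nc (w x) * et) = 128 * eps * rho * (nc (w x) * et) +
        8 * (4 * b) * rho ^+ 2 * (nc (w x) * et) by rewrite -mulrDl.
    move: t1 et1; clear; move: (8 * (4 * b) * et * _) (8 * (4 * b) * rho ^+ 2 * _) => a c.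
    move: (128 * _ * _ * _) => d; lra.
  apply: le_trans (_ : rho ^+ 4 + (B ^+ 2 + 48 * rho ^+ 2) <= Q); last by rewrite lerDr.
  by rewrite mulrDl mul1r lerD// -exprMn.
have Px := ct_P D Ux.
have F1 : F x <= Q * expR (A ^+ 2).
  have l1 : 0 <= (1 + nc (w x) ^+ 2) * et ^+ 2 by rewrite mulr_ge0 ?addr_ge0 ?sqr_ge0.
  by apply: (ler_pM l1 (expR_ge0 _) key); rewrite ler_expR ler_pXn2r ?nnegrE ?nc_ge0.
apply: le_one_plus_of_sqr_le; first exact: nc_ge0.
rewrite ler_pdivlMr ?exprn_gt0//; apply: le_trans F1; apply: le_trans (xmax 0 (OK 0 O0)).
rewrite F0; apply: le_trans (_ : (1 + nc (w 0) ^+ 2) * rho ^+ 4 <= _).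
  by rewrite ler_wpM2r ?exprn_ge0 ?lerDr ?(ltW rho0).
have n0 : 0 <= (1 + nc (w 0) ^+ 2) * rho ^+ 4.
  by rewrite mulr_ge0 ?addr_ge0 ?sqr_ge0// exprn_ge0// ltW.
have x1 : 1 <= expR (nc (P 0) ^+ 2) by rewrite -(expR0 R) ler_expR sqr_ge0.
by rewrite -[leLHS]mulr1 ler_wpM2l.
Qed.

(** * The phase stays away from its extreme values *)

Lemma le_tan (R : realType) :
  {in `](- (pi / 2)), (pi / 2)[ &, {mono (@tan R) : x y / x <= y}}.
Proof. exact: le_mono_in (fun x y xi yi h => etrans (ltr_tan xi yi) h). Qed.

(** On this interval the derivative [(1 + tan^2) / 2] is at most 1, because [tan (pi / 4) = 1]. *)
Lemma tan_half_le (R : realType) (s : R) : 0 <= s <= pi / 2 -> tan (s / 2) <= s.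
Proof.
move=> /andP[s0 s1]; have pi0 := pi_gt0 R.
have itv (t : R) : 0 <= t <= s -> t / 2 \in `](- (pi / 2)), (pi / 2)[.
  move=> /andP[t0 t1]; rewrite in_itv/=; apply/andP; split; move: t0 t1 s1 pi0; clear; lra.
have c0 (t : R) : 0 <= t <= s -> cos (t / 2) != 0.
  by move=> /itv; rewrite in_itv/= => h; rewrite gt_eqF// cos_gt0_pihalf.
have tg (t : R) : 0 <= t <= s -> 0 <= tan (t / 2) <= 1.
  move=> h; have [h0 h1] := andP h; have it := itv t h.
  have i0 : (0 : R) \in `](- (pi / 2)), (pi / 2)[.
    by rewrite in_itv/=; apply/andP; split; move: pi0; clear; lra.
  have i4 : (pi / 4 : R) \in `](- (pi / 2)), (pi / 2)[.
    by rewrite in_itv/=; apply/andP; split; move: pi0; clear; lra.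
  apply/andP; split; first by rewrite -[leLHS](tan0 R) le_tan// divr_ge0.
  by rewrite -[leRHS](tan_piquarter R) le_tan//; move: h1 s1; clear; lra.
have := @lipschitz_derive R (fun t => tan (t / 2)) (fun t => (1 + tan (t / 2) ^+ 2) / 2) 1 0 s s0.
rewrite mul0r tan0 !subr0 mul1r => L; apply: le_trans (ler_norm _) (L _ _) => t ts.
  exact: is_derive_tan2 (c0 t ts).
have /andP[p q] := tg t ts.
have q2 : tan (t / 2) ^+ 2 <= 1 by rewrite expr_le1.
rewrite ger0_norm; first by move: q2; clear; lra.
by rewrite divr_ge0// addr_ge0// sqr_ge0.
Qed.

(** With [phi = pi - sg * th], [sg * e] is [1 / tan (phi / 2)], and [tan (phi / 2) <= phi]. *)
Lemma tan_half_ge (R : realType) (sg th e : R) : sg ^+ 2 = 1 -> e = tan (th / 2) ->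
  0 < pi - sg * th <= pi / 2 -> 1 <= sg * e * (pi - sg * th).
Proof.
move=> sg2 -> /andP[p0 p1]; have pi0 := pi_gt0 R.
have sgE : sg = 1 \/ sg = -1.
  by move/eqP: sg2; rewrite sqrf_eq1 => /orP[/eqP|/eqP]; [left|right].
have -> : sg * tan (th / 2) = tan (sg * th / 2).
  by case: sgE => ->; rewrite ?mul1r ?mulN1r// mulNr tanN.
set ph := pi - sg * th in p0 p1 *.
have -> : sg * th / 2 = pi / 2 - ph / 2 by rewrite /ph; field.
have c0 : 0 < cos (ph / 2).
  by apply: cos_gt0_pihalf; apply/andP; split; move: p0 p1 pi0; clear; lra.
have s0 : 0 < sin (ph / 2).
  by apply: sin_gt0_pi; apply/andP; split; move: p0 p1 pi0; clear; lra.
have -> : tan (pi / 2 - ph / 2) = (tan (ph / 2))^-1.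
  by rewrite /tan sinB cosB cos_pihalf sin_pihalf !mul0r !mul1r subr0 add0r invf_div.
have t0 : 0 < tan (ph / 2) by rewrite divr_gt0.
rewrite mulrC ler_pdivlMr// mul1r; apply: tan_half_le.
by rewrite (ltW p0).
Qed.

(** Here [tau - N = (s - W) / (1 + s W)] is the smaller eigenvalue. It decreases in [W], and the
    bound is its value at the endpoint [W = 1 / s]. *)
Lemma slope_inequality (R : realType) (s tau W N g : R) : 1 <= s -> 0 <= W -> s * W < 1 ->
  tau * (1 - s ^+ 2 * W ^+ 2) = s * (1 + W ^+ 2) -> N = W * (1 + s * tau) ->
  - N <= g -> (s - s^-1) / 2 <= tau + g.
Proof.
move=> s1 W0 sW E EN gN; apply: le_trans (_ : tau - N <= _); last by rewrite lerD2l.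
have s0 : 0 < s by exact: lt_le_trans ltr01 s1.
have p : 0 < 1 + s * W by rewrite ltr_pwDl// mulr_ge0// ltW.
have E2 : (tau - N) * (1 + s * W) = s - W.
  rewrite EN (_ : _ * _ = tau * (1 - s ^+ 2 * W ^+ 2) - W - s * W ^+ 2); last by ring.
  by rewrite E; ring.
have -> : tau - N = (s - W) / (1 + s * W) by rewrite -E2 mulfK// gt_eqF.
rewrite ler_pdivlMr//.
have Wi : W <= s^-1 by rewrite -[s^-1]mul1r ler_pdivlMr// mulrC ltW.
have si : s^-1 <= s by rewrite (le_trans _ s1)// invf_le1.
have : (s - s^-1) / 2 * (1 + s * W) <= (s - s^-1) / 2 * 2.
  rewrite ler_wpM2l ?divr_ge0 ?subr_ge0//; move: sW; clear; lra.
by move/le_trans; apply; move: Wi; clear; lra.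
Qed.

Lemma phase_real_identities (R : realType) (U : set 'rV[R]_2) T e Th G w P y :
  phase_system U T e Th G w P -> U y ->
  [/\ T y * (1 - e y ^+ 2 * nc (w y) ^+ 2) = e y * (1 + nc (w y) ^+ 2),
    0 <= e y * T y, nc (G y) = nc (w y) * (1 + e y * T y) & `|e y| * nc (w y) < 1].
Proof.
move=> S Uy; have lt1 := ps_lt1 S Uy; rewrite ncM ncR in lt1.
have ET : T y * (1 - e y ^+ 2 * nc (w y) ^+ 2) = e y * (1 + nc (w y) ^+ 2).
  have := ps_Tw S Uy; rewrite nc_conj -!rmorphXn -!rmorphM -(rmorph1 (real_complex R)).
  by rewrite -rmorphB -rmorphD -!rmorphM => -[].
have D0 : 0 < 1 - e y ^+ 2 * nc (w y) ^+ 2.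
  rewrite subr_gt0 -(real_normK (num_real (e y))) -exprMn expr_lt1//.
  by rewrite mulr_ge0// nc_ge0.
have eT0 : 0 <= e y * T y.
  rewrite -(pmulr_lge0 _ D0) -mulrA ET mulrA -expr2 mulr_ge0 ?sqr_ge0//.
  by rewrite addr_ge0// sqr_ge0.
split=> //; rewrite (ps_Gw S Uy) ncM -(rmorph1 (real_complex R)) -rmorphM -rmorphD ncR.
by rewrite ger0_norm// addr_ge0.
Qed.

Lemma slope_P (R : realType) (U : set 'rV[R]_2) T e Th G w P y sg :
  phase_system U T e Th G w P -> U y -> sg ^+ 2 = 1 -> 1 <= sg * e y ->
  (sg * e y - (sg * e y)^-1) / 2 <= sg * pd false (fun t => Re (P t)) y.
Proof.
move=> S Uy sg2 s1; have [ET eT0 EG lt1] := phase_real_identities S Uy.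
have nsg : `|sg| = 1.
  by apply/eqP; rewrite -(@eqrXn2 _ 2)// real_normK ?num_real// sg2 expr1n.
have -> : pd false (fun t => Re (P t)) y = T y + Re (G y).
  have /(congr1 (@Re R)) := ps_dzP S Uy; have /(congr1 (@Re R)) := ps_dbP S Uy.
  rewrite dbE dzE !ReImE /=; clear.
  by move: (pd _ _ _) (pd _ _ _) (Re _) => a c d h1 h2; lra.
rewrite mulrDr; apply: (slope_inequality (W := nc (w y)) (N := nc (G y)) s1 (nc_ge0 _)).
- by apply: le_lt_trans lt1; rewrite ler_wpM2r ?nc_ge0// (le_trans (ler_norm _))// normrM nsg mul1r.
- by rewrite [(sg * e y) ^+ 2]exprMn sg2 mul1r -mulrA ET mulrA.
- by rewrite EG mulrACA -expr2 sg2 mul1r.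
- rewrite lerNl; apply: le_trans (nc_Re (G y)).
  by rewrite -[leRHS]mul1r -nsg -normrM -normrN ler_norm.
Qed.

(** The last conclusion says that a slope of [1 / (4 dl)], where [dl = (1 + b) * rho ^+ 2], kept up
    along a segment of length [rho], exceeds the variation [2 * A] which the gradient bound allows.
    This is possible because slope times length grows like [1 / rho]. *)
Lemma segment_length_spec (R : realType) (A b r rho : R) : 0 <= A -> 0 <= b -> 0 < r ->
  rho = (8 * (A + 1) * (1 + b) + 4 / r)^-1 ->
  [/\ 0 < rho, rho < r / 2, (1 + b) * rho ^+ 2 <= 64^-1 &
    2 * A < (4 * ((1 + b) * rho ^+ 2))^-1 * rho].
Proof.
move=> A0 b0 r0 ->; set Y := _ + 4 / r.
have r4 : 0 < 4 / r by rewrite divr_gt0.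
have b1 : 1 <= 1 + b by rewrite lerDl.
have b10 : 0 < 1 + b := lt_le_trans ltr01 b1.
have A1 : (8 : R) <= 8 * (A + 1) by move: A0; clear; lra.
have h8 : 8 * (1 + b) <= 8 * (A + 1) * (1 + b) by rewrite ler_wpM2r// ltW.
have Yb : 8 * (1 + b) <= Y by rewrite /Y; move: h8 r4; clear; lra.
have Y8 : 8 <= Y by move: b1 Yb; clear; lra.
have Y0 : 0 < Y by exact: lt_le_trans Y8.
split.
- by rewrite invr_gt0.
- rewrite -[Y^-1]mul1r ltr_pdivrMr//.
  have : r / 2 * (4 / r) <= r / 2 * Y.
    by rewrite ler_wpM2l ?divr_ge0 ?(ltW r0)// /Y lerDr !mulr_ge0// ?addr_ge0// ltW.
  apply: lt_le_trans; rewrite (_ : _ * _ = 2); last by field; rewrite gt_eqF.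
  by clear; lra.
- rewrite exprVn ler_pdivrMr ?exprn_gt0// expr2.
  apply: le_trans (_ : 64^-1 * (8 * (1 + b) * 8) <= _); first by clear; lra.
  by rewrite ler_wpM2l// ler_pM// mulr_ge0// ltW.
- rewrite (_ : _^-1 * _ = Y / (4 * (1 + b))); last first.
    by field; rewrite !gt_eqF.
  rewrite ltr_pdivlMr ?mulr_gt0// /Y.
  apply: le_lt_trans (_ : 8 * (A + 1) * (1 + b) < _); last by rewrite ltrDl.
  rewrite mulrA ler_wpM2r ?(ltW b10)//; move: A0; clear; lra.
Qed.

(* If Th is close to pi or - pi at x, it stays close to it on a short segment, where one
   second derivative of u is then so large that the bound on the gradient of u fails. *)
Lemma phase_gap (R : realType) (A b r : R) : 0 <= A -> 0 <= b -> 0 < r ->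
  exists2 eps, 0 < eps & forall T e Th G w P, controlled A b r T e Th G w P ->
    forall x sg, nc (xc x) < r / 2 -> sg ^+ 2 = 1 -> eps <= pi - sg * Th x.
Proof.
move=> A0 b0 r0; pose rho := (8 * (A + 1) * (1 + b) + 4 / r)^-1.
have [rho0 rhor dl1 big] := segment_length_spec A0 b0 r0 (erefl rho).
exists (rho ^+ 2 / 2); first by rewrite divr_gt0// exprn_gt0.
move=> T e Th G w P D x sg xr sg2; rewrite leNgt; apply/negP => close.
have S := ct_sys D; have oU := ps_open S.
have nsg : `|sg| = 1.
  by apply/eqP; rewrite -(@eqrXn2 _ 2)// real_normK ?num_real// sg2 expr1n.
have pi2 := pi_ge2 R.
set dl := (1 + b) * rho ^+ 2 in dl1 big.
have dl0 : 0 < dl by rewrite mulr_gt0 ?exprn_gt0// ltr_pwDl.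
have Uc (c t : R) : `|c| = 1 -> 0 <= t <= rho -> eball r (t *: (c *: axis R false) + x).
  move=> c1 /andP[t0 t1]; apply: eball_axis; rewrite c1 mulr1 ger0_norm//.
  by move: t1 rhor xr; clear; lra.
pose ps c t := pi - sg * Th (t *: (c *: axis R false) + x).
have ps0 c t : `|c| = 1 -> 0 <= t <= rho -> 0 < ps c t.
  move=> c1 tr; have /andP[h1 h2] := ct_pi D (Uc c t c1 tr).
  rewrite subr_gt0 (le_lt_trans (ler_norm _))// normrM nsg mul1r ltr_norml.
  by rewrite h1 h2.
have tay c t : `|c| = 1 -> 0 <= t <= rho ->
    ps c t <= pi - sg * Th x - sg * (c * pd false Th x) * t + b * t ^+ 2 / 2.
  move=> c1 /andP[t0 t1].
  have tr s : 0 <= s <= t -> 0 <= s <= rho by move=> /andP[-> h]; exact: le_trans h t1.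
  have E0 (h : 'rV[R]_2 -> R) : h (0 *: (c *: axis R false) + x) = h x by rewrite scale0r add0r.
  have := @taylor_le R (ps c) (fun s => - (sg * (c * pd false Th (s *: (c *: axis R false) + x))))
    (fun s => - (sg * (c * (c * pd false (pd false Th) (s *: (c *: axis R false) + x))))) b t t0.
  move=> L; apply: le_trans (L _ _ _) _; last by rewrite /ps !E0 mulNr.
  - move=> s /tr st; rewrite -[- (sg * _)]sub0r.
    apply: is_deriveB.
    apply: is_deriveZ; apply: is_derive_axis.
    exact: C_class_diff (ps_Th S) (Uc c s c1 st).
  - move=> s /tr st; apply: is_deriveN; apply: is_deriveZ; apply: is_deriveZ; apply: is_derive_axis.
    exact: C_class_diff (C_class_pd false (ps_Th S)) (Uc c s c1 st).
  - move=> s /tr st; rewrite normrN !normrM nsg c1 !mul1r.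
    exact (ct_ddTh D _ _ (Uc c s c1 st)).
have N1 : `|1 : R| = 1 by exact: normr1.
have M1 : `|-1 : R| = 1 by rewrite normrN normr1.
(* Positivity of [ps] in the opposite direction bounds the first-order term, so Taylor's formula
   gives [ps 1 t <= 2 (pi - sg Th x) + b t^2], and [2 * eps = rho ^+ 2]. *)
have small t : 0 <= t <= rho -> 0 < ps 1 t <= dl.
  move=> tr; rewrite ps0//=; have h1 := tay 1 t N1 tr.
  have h2 := lt_le_trans (ps0 (-1) t M1 tr) (tay (-1) t M1 tr).
  have tt : t ^+ 2 <= rho ^+ 2.
    by have /andP[t0 t1] := tr; rewrite ler_pXn2r ?nnegrE// ltW.
  have btt : b * t ^+ 2 <= b * rho ^+ 2 by rewrite ler_wpM2l.
  rewrite mulN1r mulrN mulNr opprK in h2; rewrite mul1r in h1.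
  rewrite /dl mulrDl mul1r.
  move: close btt h1 h2; clear.
  move: (rho ^+ 2) (b * t ^+ 2) (sg * pd _ _ _ * t) (pi - _) (ps _ _) (b * _) => a c d f g h.
  by lra.
pose q (t : R) := sg * Re (P (t *: (1 *: axis R false) + x)).
have dq t : 0 <= t <= rho -> is_derive t (1:R) q
    (sg * (1 * pd false (fun y => Re (P y)) (t *: (1 *: axis R false) + x))).
  move=> tr; apply: is_deriveZ; apply: (is_derive_axis (f := fun y => Re (P y))).
  exact: C_class_diff (ps_P S).1 (Uc 1 t N1 tr).
have [c /andP[c0 c1] E] := MVT_derive rho0 dq.
have cr : 0 <= c <= rho by rewrite !ltW.
(* As [sg * e] is at least [1 / dl >= 64], its inverse is negligible, and half of their difference
   exceeds [sg * e / 4]. *)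
have steep : (4 * dl)^-1 <= sg * pd false (fun y => Re (P y)) (c *: (1 *: axis R false) + x).
  have Uy := Uc 1 c N1 cr; have /andP[p0 p1] := small c cr.
  set y := (_ + x) in Uy *.
  have psE : pi - sg * Th y = ps 1 c by [].
  have p2 : 0 < pi - sg * Th y <= pi / 2.
    by rewrite psE p0; move: p1 dl1 pi2; clear; lra.
  have s1 := tan_half_ge sg2 (ct_e D y) p2; rewrite psE in s1.
  have sdl : dl^-1 <= sg * e y.
    have s0 : 0 < sg * e y by rewrite -(pmulr_lgt0 _ p0) (lt_le_trans ltr01 s1).
    by rewrite -[dl^-1]mul1r ler_pdivrMr// (le_trans s1)// ler_wpM2l// ltW.
  have d64 : 64 <= dl^-1 by rewrite -[leLHS]invrK lef_pV2 ?posrE ?invr_gt0.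
  have s64 := le_trans d64 sdl.
  apply: le_trans (slope_P S Uy sg2 _); last by apply: le_trans s64; clear; lra.
  have si : (sg * e y)^-1 <= 1 by rewrite invf_le1 ?(lt_le_trans _ s64)// (le_trans _ s64)//; clear; lra.
  rewrite invfM; move: sdl s64 si; clear.
  by move: (dl^-1) (sg * e y) ((sg * e y)^-1) => a d f; lra.
have Pb t : 0 <= t <= rho -> `|q t| <= A.
  move=> tr; rewrite /q normrM nsg mul1r; apply: le_trans (nc_Re _) _.
  exact (ct_P D (Uc 1 t N1 tr)).
have q1 := Pb rho; have q2 := Pb 0.
rewrite !lexx (ltW rho0) /= in q1 q2.
have {}q1 := q1 isT; have {}q2 := q2 isT.
have : (4 * dl)^-1 * rho <= q rho - q 0 by rewrite E subr0 ler_wpM2r ?(ltW rho0)// mul1r.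
move: big q1 q2; rewrite !ler_norml => h /andP[_ h1] /andP[h2 _]; move: h h1 h2; clear; lra.
Qed.

Lemma tan_half_bound (R : realType) (th eps : R) : 0 < eps ->
  (forall sg, sg ^+ 2 = 1 -> eps <= pi - sg * th) ->
  `|tan (th / 2)| <= `|tan ((pi - eps) / 2)|.
Proof.
move=> e0 H; have h1 := H 1 (expr1n _ _).
have h2 := H (-1) (sqrr_sign _ 1%N).
rewrite mul1r in h1; rewrite mulN1r opprK in h2.
have pi0 := pi_gt0 R.
have I (s : R) : `|s| <= pi - eps -> s / 2 \in `](- (pi / 2)), (pi / 2)[.
  rewrite ler_norml => /andP[s1 s2]; rewrite in_itv/=.
  apply/andP; split; move: s1 s2 e0; clear; lra.
have I1 : th / 2 \in `](- (pi / 2)), (pi / 2)[.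
  by apply: I; rewrite ler_norml; apply/andP; split; move: h1 h2; clear; lra.
have I2 : - th / 2 \in `](- (pi / 2)), (pi / 2)[.
  by apply: I; rewrite normrN ler_norml; apply/andP; split; move: h1 h2; clear; lra.
have I3 : (pi - eps) / 2 \in `](- (pi / 2)), (pi / 2)[.
  by apply: I; rewrite ger0_norm//; move: h1 h2; clear; lra.
apply: le_trans (ler_norm _); rewrite ler_norml lerNl -tanN -mulNr !le_tan//.
by apply/andP; split; move: h1 h2; clear; lra.
Qed.

Lemma e_upper_bound (R : realType) (A b r : R) : 0 <= A -> 0 <= b -> 0 < r ->
  exists2 E, 0 <= E & forall T e Th G w P, controlled A b r T e Th G w P ->
    forall x, nc (xc x) < r / 2 -> `|e x| <= E.
Proof.
move=> A0 b0 r0; have [eps e0 H] := phase_gap A0 b0 r0.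
exists (`|tan ((pi - eps) / 2)|) => // T e Th G w P D x xr.
by rewrite (ct_e D); apply: tan_half_bound e0 _ => sg sg2; exact: (H _ _ _ _ _ _ D x sg xr sg2).
Qed.

(** The bounds on [e] and on the gradient of [Th] make [e] Lipschitz with constant [2 * L]. The
    radius is chosen so that [|e|] loses at most [1 / (4 C)] of its value at 0, which is at least
    twice that. *)
Lemma e_lower_bound (R : realType) (A b r E C : R) : 0 <= b -> 0 < r -> 0 <= E -> 1 <= C ->
  exists2 r1, 0 < r1 <= r / 2 & forall T e Th G w P, controlled A b r T e Th G w P ->
    (forall x, nc (xc x) < r / 2 -> `|e x| <= E) -> 2^-1 <= `|e 0| * C ->
    forall x, nc (xc x) < r1 -> (4 * C)^-1 <= `|e x|.
Proof.
move=> b0 r0 E0 C1; have C0 : 0 < C := lt_le_trans ltr01 C1.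
pose L := (1 + E ^+ 2) / 2 * b.
have L0 : 0 <= L by rewrite !mulr_ge0 ?addr_ge0 ?sqr_ge0.
pose Y := 2 / r + 8 * C * (L + 1).
have Y1 : 0 < 2 / r by rewrite divr_gt0.
have Y2 : 0 <= 8 * C * (L + 1) by rewrite !mulr_ge0 ?addr_ge0// ltW.
have Y0 : 0 < Y by rewrite ltr_wpDr.
exists Y^-1.
  rewrite invr_gt0 Y0/= -(invf_div 2 r) lef_pV2 ?posrE//.
  by rewrite lerDl.
move=> T e Th G w P D hE h0 x xr.
have S := ct_sys D.
have r2 : Y^-1 <= r / 2.
  by rewrite -(invf_div 2 r) lef_pV2 ?posrE// lerDl.
have xr2 : eball (r / 2) x by rewrite eball_nc (lt_le_trans xr).
have sub (y : 'rV[R]_2) : eball (r / 2) y -> eball r y.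
  by rewrite !eball_nc => h; move: h r0; clear; lra.
have cE : C_class 1 (eball (r / 2)) e.
  by apply: C_class_sub sub _; exact: C_class_le (isT : (1 <= 2)%N) (ps_e S).
have dE i y : nc (xc y) <= nc (xc x) -> `|pd i e y| <= L.
  move=> yx; have yr : nc (xc y) < r / 2 by rewrite (le_lt_trans yx)// -eball_nc.
  have Uy : eball r y by apply: sub; rewrite eball_nc.
  apply: (@le_trans _ _ (nc (dz (cplx e) y))).
    by rewrite nc_dz_grad; case: i; [exact: (nc_Im (grad_c e y))|exact: (nc_Re (grad_c e y))].
  rewrite (ps_dze S Uy) ncM ncR ger0_norm ?divr_ge0 ?addr_ge0 ?sqr_ge0//.
  apply: ler_pM; rewrite ?nc_ge0 ?divr_ge0 ?addr_ge0 ?sqr_ge0//; last exact: (ct_dTh D Uy).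
  rewrite ler_pM2r// lerD2l -(real_normK (num_real (e y))) ler_pXn2r ?nnegrE//.
  exact: hE.
have Lip := lipschitz_ball cE xr2 dE.
have Lr : 2 * L * nc (xc x) <= (4 * C)^-1.
  apply: le_trans (_ : 2 * L * Y^-1 <= _); first exact: ler_wpM2l (mulr_ge0 _ L0) _ _ (ltW xr).
  rewrite ler_pdivrMr// [leRHS]mulrC ler_pdivlMr ?mulr_gt0//.
  rewrite (_ : 2 * L * (4 * C) = 8 * C * L); last by ring.
  apply: le_trans (_ : 8 * C * (L + 1) <= _); last by rewrite lerDr ltW.
  by rewrite ler_wpM2l ?lerDl// mulr_ge0// ltW.
have e0 : 2 * (4 * C)^-1 <= `|e 0|.
  rewrite (_ : 2 * _ = 2^-1 / C); last by field; rewrite gt_eqF.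
  by rewrite ler_pdivrMr.
have := ler_distD (e x) (e 0) 0; rewrite !subr0 distrC.
by move: e0 Lr Lip; clear; move: ((4 * C)^-1) => a; lra.
Qed.

(** * Bound for zeta at the centre *)

Lemma cut_ratio_exists (R : realType) (rho Kb m A : R) : 0 < rho -> 1 <= Kb -> 0 <= m -> 0 <= A ->
  exists2 k, 0 < k & [/\ 72 * k ^+ 2 * rho ^+ 2 <= 1, k * rho ^+ 2 <= 1, k * rho ^+ 2 * Kb <= 1 &
    m * A * (k * rho ^+ 2 * Kb) + 48 * rho * k <= 1].
Proof.
move=> r0 K1 m0 A0.
have r2 : 0 < rho ^+ 2 by rewrite exprn_gt0.
have K0 : 0 < Kb := lt_le_trans ltr01 K1.
have t1 : 0 <= rho ^+ 2 * Kb by rewrite mulr_ge0// ltW.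
have t2 : 0 <= m * A * (rho ^+ 2 * Kb) by exact: mulr_ge0 (mulr_ge0 m0 A0) t1.
pose Y := 1 + 73 * rho ^+ 2 + rho ^+ 2 * Kb + m * A * (rho ^+ 2 * Kb) + 48 * rho.
have Y1 : 1 <= Y.
  rewrite /Y; move: r2 t1 t2 r0; clear.
  by move: (rho ^+ 2 * Kb) (rho ^+ 2) (m * A * _) => a b c; lra.
have Y0 : 0 < Y := lt_le_trans ltr01 Y1.
have kle (a : R) : a <= Y -> Y^-1 * a <= 1.
  by move=> h; rewrite mulrC ler_pdivrMr// mul1r.
have k0 : 0 < Y^-1 by rewrite invr_gt0.
exists Y^-1 => //; split.
- rewrite (_ : _ * _ = Y^-1 * (Y^-1 * (72 * rho ^+ 2))); last by ring.
  rewrite -[leRHS](mul1r 1) ler_pM ?(ltW k0) ?invf_le1//.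
    by rewrite mulr_ge0 ?(ltW k0)// mulr_ge0// ltW.
  apply: kle; rewrite /Y; move: r2 t1 t2 r0; clear.
  by move: (rho ^+ 2 * Kb) (rho ^+ 2) (m * A * _) => a b c; lra.
- apply: kle; rewrite /Y; move: r2 t1 t2 r0; clear.
  by move: (rho ^+ 2 * Kb) (rho ^+ 2) (m * A * _) => a b c; lra.
- rewrite -mulrA; apply: kle; rewrite /Y; move: r2 t1 t2 r0; clear.
  by move: (rho ^+ 2 * Kb) (rho ^+ 2) (m * A * _) => a b c; lra.
- rewrite (_ : _ + _ = Y^-1 * (m * A * (rho ^+ 2 * Kb) + 48 * rho)); last by ring.
  apply: kle; rewrite /Y; move: r2 t1 t2 r0; clear.
  by move: (rho ^+ 2 * Kb) (rho ^+ 2) (m * A * _) => a b c; lra.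
Qed.

(** A square root of the phase of [z] is needed, and not only the phase, because the coordinates and
    the gradient are rotated by [ga]. For [z = 0] any unit number would do. *)
Lemma polar_conj (R : realType) (z : R[i]) :
  exists2 ga : R[i], nc ga = 1 & conjc (ga ^+ 2) * z = (nc z)%:C.
Proof.
have [->|z0] := eqVneq z 0.
  by exists 1; rewrite ?mulr0 /nc /Normc.normc /= ?expr0n/= ?expr1n addr0 ?sqrtr1 ?sqrtr0.
have n0 : nc z != 0 by apply/eqP => /nc0_eq0 /eqP; rewrite (negbTE z0).
exists (sqrtc (z * ((nc z)^-1)%:C)).
  apply/eqP; rewrite -(@eqrXn2 _ 2) ?nc_ge0// expr1n expr2 -ncM -expr2 sqr_sqrtc.
  by rewrite ncM ncR ger0_norm ?invr_ge0 ?nc_ge0// mulfV.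
rewrite sqr_sqrtc conjcM conjcR mulrAC [conjc z * z]mulrC nc_conj -rmorphM.
by congr (_%:C); field.
Qed.

Lemma imag_part (R : realType) (z : R[i]) : Re (- 'i * z) = Im z.
Proof. by case: z => a b; rewrite !ReImE /= ?ReImE /=; ring. Qed.

Lemma cut_value (R : realType) (rho chi : R) : 0 <= rho -> 0 < chi -> chi <= rho ^+ 2 ->
  chi ^+ 12 <= rho ^+ 20 * chi ^+ 2.
Proof.
move=> r0 c0 h; rewrite (exprD chi 10 2) ler_wpM2r ?sqr_ge0//.
by rewrite (exprM rho 2 10) ler_pXn2r ?nnegrE ?sqr_ge0// ltW.
Qed.

(** Two of the twelve powers of [c1] are traded for [2 * f / k ^+ 2]. The other ten, and the twelve
    of [c2], are bounded by powers of [rho ^+ 2], whence 44 = 20 + 24. *)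
Lemma cut_product (R : realType) (rho k f h c1 c2 : R) : 0 < rho -> 0 < k ->
  0 < c1 -> c1 <= rho ^+ 2 -> 0 < c2 -> c2 <= rho ^+ 2 ->
  k * c1 < h -> h ^+ 2 <= 2 * f -> (c1 * c2) ^+ 12 <= rho ^+ 44 * (2 * f / k ^+ 2).
Proof.
move=> r0 k0 p1 l1 p2 l2 kh hf.
have h1 := cut_value (ltW r0) p1 l1.
have h2 : c2 ^+ 12 <= rho ^+ 24.
  by rewrite (exprM rho 2 12) ler_pXn2r ?nnegrE ?sqr_ge0// ltW.
have h3 : c1 ^+ 2 <= 2 * f / k ^+ 2.
  rewrite ler_pdivlMr ?exprn_gt0// mulrC -exprMn; apply: le_trans hf.
  by rewrite ler_pXn2r ?nnegrE ?(ltW kh)// ?mulr_ge0 ?(ltW k0) ?(ltW p1)// (le_trans _ (ltW kh))// mulr_ge0// ltW.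
rewrite exprMn; apply: le_trans (_ : rho ^+ 20 * c1 ^+ 2 * rho ^+ 24 <= _).
  by rewrite ler_pM// exprn_ge0// ltW.
rewrite (_ : rho ^+ 20 * _ * _ = rho ^+ 44 * c1 ^+ 2); last by ring.
by rewrite ler_wpM2l ?exprn_ge0// ltW.
Qed.

Lemma compare_at_center (R : realType) (rho k EA f0 X : R) : 0 < rho -> 0 < k -> 0 < EA -> 0 < f0 ->
  rho ^+ 48 / f0 <= X -> X <= rho ^+ 44 * 2 / k ^+ 2 * EA -> rho ^+ 4 * k ^+ 2 / (2 * EA) <= f0.
Proof.
move=> r0 k0 e0 p h1 h2; have := le_trans h1 h2.
have k2 : 0 < k ^+ 2 by rewrite exprn_gt0.
have r44 : 0 < rho ^+ 44 by rewrite exprn_gt0.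
rewrite ler_pdivrMr// ler_pdivrMr ?mulr_gt0// => H.
rewrite -(ler_pM2l r44) (_ : rho ^+ 44 * (f0 * (2 * EA)) = rho ^+ 44 * 2 / k ^+ 2 * EA * f0 * k ^+ 2).
  rewrite (_ : rho ^+ 44 * (rho ^+ 4 * k ^+ 2) = rho ^+ 48 * k ^+ 2); last by ring.
  by rewrite ler_pM2r.
by field; rewrite gt_eqF.
Qed.

(* The cutoffs have exponent 12: where the maximum principle gives no information,
   k chi < |1 - conjc al * zeta| for one cutoff chi, hence k^2 chi^2 <= 2 f there. *)
Lemma zeta_center_gap (R : realType) (A b r r1 Kb : R) : 0 <= A -> 0 <= b -> 0 < r1 -> r1 <= r -> 1 <= Kb ->
  exists2 c, 0 < c & forall T e Th G w P, controlled A b r T e Th G w P ->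
    (forall x, nc (xc x) < r1 -> [/\ e x != 0, `|e x| <= Kb & `|e x|^-1 <= Kb]) ->
    c <= 1 - nc ((e 0)%:C * w 0).
Proof.
move=> A0 b0 r10 r1r K1.
(* The square with half side [rho] in the rotated coordinates lies in the ball of radius
   [2 * rho < r1]. *)
pose rho := r1 / 4; have rho0 : 0 < rho by rewrite divr_gt0.
have K40 : 0 <= 4 * b by rewrite mulr_ge0.
have Kb0 : 0 <= Kb := le_trans ler01 K1.
(* One more than the largest weight that [weight_le_at_max] permits. *)
pose m := ell_f_const Kb (4 * b) ^+ 2 + ell_f_const Kb (4 * b) + 2 + ell_P_const Kb (4 * b) ^+ 2 + 432 / rho ^+ 2 + 1.
have m0 : 0 <= m.
  have c0 : 0 <= source_const Kb (4 * b) by rewrite /source_const !mulr_ge0.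
  have s1 : 0 <= 1 + Kb ^+ 2 by rewrite addr_ge0 ?sqr_ge0.
  have cM : 0 <= second_order_const Kb (4 * b).
    by rewrite /second_order_const; do ![exact: sqr_ge0 | exact: Kb0 | exact: K40 | exact: s1 | apply: addr_ge0 | apply: mulr_ge0 | by []].
  have c1 : 0 <= ell_f_const Kb (4 * b).
    by rewrite /ell_f_const; do ![exact: sqr_ge0 | exact: c0 | exact: cM | apply: addr_ge0 | apply: mulr_ge0 | by []].
  by rewrite /m; do ![exact: sqr_ge0 | exact: c1 | rewrite divr_ge0 ?sqr_ge0 | apply: addr_ge0 | by []].
have [k k0 [k1 k2 k3 k4]] := cut_ratio_exists rho0 K1 m0 A0.
pose EA := expR (m / 2 * A ^+ 2).
have EA0 : 0 < EA by exact: expR_gt0.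
exists (rho ^+ 4 * k ^+ 2 / (2 * EA)).
  by rewrite divr_gt0 ?mulr_gt0 ?exprn_gt0.
move=> T e Th G w P D hE.
have S := ct_sys D; have oU := ps_open S.
have [ga ga1 hal] := polar_conj ((e 0)%:C * w 0).
set al := ga ^+ 2 in hal.
pose xi y := Re (ga * xc y); pose et y := Re (- ('i * ga) * xc y).
pose yp y := Re (ga * P y).
pose f y := 1 - Re (conjc al * ((e y)%:C * w y)).
pose chi y := (rho ^+ 2 - xi y ^+ 2) * (rho ^+ 2 - et y ^+ 2).
have oT := @openT 'rV[R]_2.
have cxi : C_class 2 setT xi := C_class_Re ga oT (CC_xc 2 setT).
have cet : C_class 2 setT et := C_class_Re _ oT (CC_xc 2 setT).
have cont g : C_class 2 setT g -> forall y, {for y, continuous (fun y => `|g y|)}.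
  move=> cg y; apply: (@continuous_comp _ _ _ g Num.norm); last exact: norm_continuous.
  exact: (C_class_le (isT : (0 <= 2)%N) cg) y I.
pose K := (fun y => `|xi y|) @^-1` [set t | t <= rho] `&` (fun y => `|et y|) @^-1` [set t | t <= rho].
pose O := (fun y => `|xi y|) @^-1` [set t | t < rho] `&` (fun y => `|et y|) @^-1` [set t | t < rho].
have clK : closed K.
  by apply: closedI; (apply: closed_comp; [move=> y _; exact: cont|exact: closed_le]).
have opO : open O.
  by apply: openI; (apply: open_comp; [move=> y _; exact: cont|exact: open_lt]).
have Knc y : K y -> nc (xc y) <= 2 * rho.
  move=> [h1 h2]; rewrite /= in h1 h2; have -> : nc (xc y) = nc (ga * xc y) by rewrite ncM ga1 mul1r.
  rewrite mulr_natl mulr2n; apply: nc_le => //.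
  by rewrite -imag_part mulrA mulNr.
have Kr1 y : K y -> nc (xc y) < r1.
  by move/Knc; rewrite /rho; move: r10; clear; lra.
have Kr y : K y -> eball r y by move=> /Kr1 h; rewrite eball_nc (lt_le_trans h).
have OK : O `<=` K by move=> y [/= h1 h2]; split; exact: ltW.
have f0 y : K y -> 0 < f y by move=> /Kr; exact: one_minus_Re_gt0 S _ _ (erefl al) ga1 y.
pose F y := chi y ^+ 12 * (expR (m / 2 * yp y ^+ 2) * (f y)^-1).
have cfun y : K y -> {for y, continuous F}.
  move=> Ky.
  have cxy g : C_class 2 setT g -> {for y, continuous (fun y => rho ^+ 2 - g y ^+ 2)}.
    move=> cg; exact: (C_class_le (isT : (0 <= 2)%N) (C_class_cut rho oT cg)) y I.
  have cchi : {for y, continuous (fun y => chi y ^+ 12)}.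
    apply: (@continuous_comp _ _ _ chi (fun t => t ^+ 12)); last exact: exprn_continuous.
    exact: continuousM (cxy _ cxi) (cxy _ cet).
  have cy : {for y, continuous (fun y => expR (m / 2 * yp y ^+ 2))}.
    apply: (@continuous_comp _ _ _ (fun y => m / 2 * yp y ^+ 2) (@expR R)); last exact: continuous_expR.
    have c2 : C_class 2 (eball r) (fun y => m / 2 * yp y ^+ 2).
      exact: C_classM oU (C_class_cst 2 _ (m / 2)) (C_classM oU (C_class_Re ga oU (ps_P S)) (C_class_Re ga oU (ps_P S))).
    exact: (C_class_le (isT : (0 <= 2)%N) c2) y (Kr y Ky).
  have cf : {for y, continuous f}.
    have c2 : C_class 2 (eball r) f.
      exact: C_classB oU (C_class_cst 2 _ 1) (C_class_Re _ oU (CCM oU (CC_real (ps_e S)) (ps_w S))).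
    exact: (C_class_le (isT : (0 <= 2)%N) c2) y (Kr y Ky).
  apply: continuousM => //; apply: continuousM => //.
  by apply: continuousV => //; rewrite gt_eqF// f0.
have xi0 : xi 0 = 0 by rewrite /xi xc0 mulr0.
have et0 : et 0 = 0 by rewrite /et xc0 mulr0.
have O0 : O 0 by split; rewrite /= ?xi0 ?et0 normr0.
have chi0 : chi 0 = rho ^+ 4 by rewrite /chi xi0 et0; ring.
have F0 : F 0 = rho ^+ 48 * (expR (m / 2 * yp 0 ^+ 2) * (f 0)^-1).
  by rewrite /F chi0 -exprM.
have F0p : 0 < F 0.
  by rewrite F0 !mulr_gt0 ?exprn_gt0 ?expR_gt0 ?invr_gt0// f0//; exact: OK.
have sqcut g : `|g| = rho -> rho ^+ 2 - g ^+ 2 = 0.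
  by move=> h; rewrite -(real_normK (num_real g)) h subrr.
have bd y : K y -> ~ O y -> F y <= 0.
  move=> [/= h1 h2] nO; have : `|xi y| = rho \/ `|et y| = rho.
    have [e1|n1] := eqVneq `|xi y| rho; first by left.
    have [e2|n2] := eqVneq `|et y| rho; first by right.
    by case: nO; split; rewrite /= lt_neqAle ?n1 ?n2.
  by case=> /sqcut h; rewrite /F /chi h ?mulr0 ?mul0r expr0n/= mul0r.
have cK : compact K := compact_closed_nc clK Knc.
have [x Ox xmax] := max_interior cK OK cfun O0 F0p bd.
have Kx := OK x Ox; have Ux := Kr x Kx.
have hx : (forall y, O y -> eball r y) by move=> y /OK /Kr.
have S' := phase_system_sub opO hx S.
have [ex0 exK eiK] := hE x (Kr1 x Kx).
have [d1 d2] := DB_second_le oU (ps_Th S) Ux (ltW (ps_lt1 S Ux)) (fun i j => ct_ddTh D i j Ux).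
have dth : nc (dz (cplx Th) x) <= 4 * b.
  by apply: le_trans (ct_dTh D Ux) _; move: b0; clear; lra.
have cutp g : `|g| < rho -> 0 < rho ^+ 2 - g ^+ 2.
  move=> h; rewrite subr_gt0 -(real_normK (num_real g)) ltr_pXn2r ?nnegrE//; exact: ltW.
have lnF y : O y -> ln (F y) = -1 * ln (f y) + 1 * (12 * ln (rho ^+ 2 - xi y ^+ 2)
    + 1 * (12 * ln (rho ^+ 2 - et y ^+ 2) + m / 2 * (yp y ^+ 2))).
  move=> Oy; have [/= h1 h2] := Oy; have fy := f0 y (OK y Oy).
  have [p1 p2] := (cutp _ h1, cutp _ h2).
  rewrite /F /chi exprMn !lnM ?posrE ?mulr_gt0 ?expR_gt0 ?invr_gt0 ?exprn_gt0//.
  rewrite lnV ?posrE// expRK.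
  by move: (ln _) (ln _) (ln _) (_ / 2 * _) => a1 a2 a3 a4; ring.
have Fp y : O y -> 0 < F y.
  move=> Oy; have [/= h1 h2] := Oy; have fy := f0 y (OK y Oy).
  have pc : 0 < chi y := mulr_gt0 (cutp _ h1) (cutp _ h2).
  exact: mulr_gt0 (exprn_gt0 12 pc) (mulr_gt0 (expR_gt0 _) (etrans (invr_gt0 _) fy)).
have lmax y : O y -> -1 * ln (f y) + 1 * (12 * ln (rho ^+ 2 - xi y ^+ 2)
    + 1 * (12 * ln (rho ^+ 2 - et y ^+ 2) + m / 2 * (yp y ^+ 2))) <=
    -1 * ln (f x) + 1 * (12 * ln (rho ^+ 2 - xi x ^+ 2)
    + 1 * (12 * ln (rho ^+ 2 - et x ^+ 2) + m / 2 * (yp x ^+ 2))).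
  move=> Oy; rewrite -(lnF y Oy) -(lnF x Ox).
  by rewrite ler_ln ?posrE; [exact: xmax (OK y Oy)|exact: Fp|exact: Fp].
have contra := weight_le_at_max S' Ox K1 K40 ex0 exK eiK dth d1 d2 (erefl al) ga1 rho0 m0 (ltW k0)
  (ct_P D Ux) (fun y h => h) lmax k1 k2 k3 k4.
have cle g : rho ^+ 2 - g ^+ 2 <= rho ^+ 2 by rewrite gerBl sqr_ge0.
have [/= Ox1 Ox2] := Ox.
have fx := f0 x Kx.
have H2 := one_minus_sqr_norm_le S Ux (erefl al) ga1; rewrite -/(f x) in H2.
have key : chi x ^+ 12 <= rho ^+ 44 * (2 * f x / k ^+ 2).
  have [q1|q1] := leP (nc (1 - conjc al * ((e x)%:C * w x))) (k * (rho ^+ 2 - xi x ^+ 2)).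
    have [q2|q2] := leP (nc (1 - conjc al * ((e x)%:C * w x))) (k * (rho ^+ 2 - et x ^+ 2)).
      by have := contra q1 q2; rewrite /m leNgt ltrDl ltr01.
    rewrite /chi mulrC.
    exact: cut_product rho0 k0 (cutp _ Ox2) (cle _) (cutp _ Ox1) (cle _) q2 H2.
  exact: cut_product rho0 k0 (cutp _ Ox1) (cle _) (cutp _ Ox2) (cle _) q1 H2.
(* The factor [f x] in [key] cancels the denominator of [F], so the maximum is bounded without any
   information on [f x]. *)
have Fx : F x <= rho ^+ 44 * 2 / k ^+ 2 * EA.
  have yA : expR (m / 2 * yp x ^+ 2) <= EA.
    rewrite ler_expR ler_wpM2l ?divr_ge0// -(real_normK (num_real (yp x))).
    rewrite ler_pXn2r ?nnegrE//; apply: le_trans (nc_Re _) _.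
    by rewrite ncM ga1 mul1r; exact (ct_P D Ux).
  rewrite (_ : _ * EA = rho ^+ 44 * (2 * f x / k ^+ 2) * (EA * (f x)^-1)); last first.
    by field; rewrite !gt_eqF.
  have c0 : 0 <= chi x ^+ 12 by rewrite exprn_ge0// ltW// mulr_gt0 ?cutp.
  have i0 : 0 <= (f x)^-1 by rewrite invr_ge0 ltW.
  apply: (ler_pM c0 _ key); first exact: mulr_ge0 (expR_ge0 _) i0.
  exact: ler_wpM2r i0 _ _ yA.
have f00 := f0 0 (OK 0 O0).
have -> : 1 - nc ((e 0)%:C * w 0) = f 0 by rewrite /f hal.
apply: (compare_at_center (X := F 0) rho0 k0 EA0 f00); last exact: le_trans (xmax 0 (OK 0 O0)) Fx.
rewrite F0 ler_wpM2l ?exprn_ge0 ?(ltW rho0)// ler_peMl ?invr_ge0 ?(ltW f00)//.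
by rewrite -[leLHS](expR0 R) ler_expR mulr_ge0 ?sqr_ge0// divr_ge0.
Qed.

(** * The estimate *)

Lemma hessian_inequality (R : realType) (e T W N E C c : R) : 0 < c -> 0 <= W -> W <= C -> `|e| <= E ->
  c <= 1 - `|e| * W -> T * (1 - e ^+ 2 * W ^+ 2) = e * (1 + W ^+ 2) ->
  0 <= e * T -> N = W * (1 + e * T) ->
  2 * (`|T| + N) <= 2 * (E * (1 + C ^+ 2) / c + C * (1 + E * (E * (1 + C ^+ 2) / c))).
Proof.
move=> c0 W0 WC eE hc hT eT hN; rewrite ler_pM2l//.
have E0 : 0 <= E := le_trans (normr_ge0 _) eE.
have C0 : 0 <= C := le_trans W0 WC.
have WC2 : W ^+ 2 <= C ^+ 2 by rewrite ler_pXn2r.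
set M := E * (1 + C ^+ 2) / c.
have den : c <= 1 - e ^+ 2 * W ^+ 2.
  rewrite -(real_normK (num_real e)) -exprMn; apply: (le_trans hc).
  rewrite lerD2l lerN2 expr2 ler_piMl ?mulr_ge0//.
  by rewrite -subr_ge0; exact: le_trans (ltW c0) hc.
have TM : `|T| <= M.
  rewrite /M ler_pdivlMr//; apply: le_trans (_ : `|T| * (1 - e ^+ 2 * W ^+ 2) <= _).
    by rewrite ler_wpM2l.
  have d0 : 0 <= 1 - e ^+ 2 * W ^+ 2 := le_trans (ltW c0) den.
  rewrite -{1}(ger0_norm d0) -normrM hT normrM [`|1 + _|]ger0_norm ?addr_ge0 ?sqr_ge0//.
  have s0 : 0 <= 1 + W ^+ 2 by rewrite addr_ge0 ?sqr_ge0.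
  by apply: (ler_pM (normr_ge0 _) s0 eE); rewrite lerD2l.
apply: lerD => //; rewrite hN; apply: ler_pM => //; first by rewrite addr_ge0.
rewrite lerD2l -[e * T](ger0_norm eT) normrM; exact: ler_pM.
Qed.

(** The trace part and the trace-free part of the Hessian are orthogonal, so its squared Frobenius
    norm is [2 (T^2 + |G|^2)]. *)
Lemma enorm_hessian_le (R : realType) (U : set 'rV[R]_2) u y : open U -> smooth U u -> U y ->
  enorm (hessian u y) <= 2 * (`|half_lap u y| + nc (hopf u y)).
Proof.
move=> oU cu Uy.
have s0 : 0 <= `|half_lap u y| + nc (hopf u y) by rewrite addr_ge0// nc_ge0.
rewrite -(@ler_pXn2r _ 2) ?nnegrE ?enorm_ge0 ?mulr_ge0//.
have -> : enorm (hessian u y) ^+ 2 = 2 * (`|half_lap u y| ^+ 2 + nc (hopf u y) ^+ 2).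
  rewrite /enorm sqr_sqrtr; last by rewrite sumr_ge0// => i _; rewrite sumr_ge0// => j _; rewrite sqr_ge0.
  rewrite !sum_I2 !hessian_pd nc_sqr /hopf /half_lap /= (pdC oU (cu 2) Uy) real_normK ?num_real//.
  by move: (pd _ _ _) (pd _ _ _) (pd _ _ _) => p q s; field.
move: `|half_lap u y| (nc (hopf u y)) (normr_ge0 (half_lap u y)) (nc_ge0 (hopf u y)).
clear => p q p0 q0.
have h1 : 0 <= p * q by exact: mulr_ge0.
have h2 := sqr_ge0 p; have h3 := sqr_ge0 q.
rewrite (_ : (2 * (p + q)) ^+ 2 = 4 * p ^+ 2 + 8 * (p * q) + 4 * q ^+ 2); last by ring.
by move: h1 h2 h3; clear; move: (p ^+ 2) (q ^+ 2) (p * q) => a b c; lra.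
Qed.

Lemma hessian_bound (R : realType) (A b r : R) : 0 <= A -> 0 <= b -> 0 < r ->
  exists2 C, 0 < C & forall T e Th G w P, controlled A b r T e Th G w P ->
    2 * (`|T 0| + nc (G 0)) <= C.
Proof.
move=> A0 b0 r0.
have [E E0 hE] := e_upper_bound A0 b0 r0.
have [CA CA1 hA] := w_center_bound A0 b0 r0.
have CA0 : 0 < CA := lt_le_trans ltr01 CA1.
have [r1 /andP[r10 r1r] hr1] := e_lower_bound A b0 r0 E0 CA1.
have r1r' : r1 <= r by move: r1r r0; clear; lra.
(* Dominates [|e| <= E] and also [1 / |e| <= 4 * CA], the inverse of the lower bound from
   [e_lower_bound]. *)
pose Kb := 1 + E + 4 * CA.
have Kb1 : 1 <= Kb by rewrite /Kb; move: E0 CA0; clear; lra.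
have [c c0 hB] := zeta_center_gap A0 b0 r10 r1r' Kb1.
pose c' := Num.min 2^-1 c.
have c'0 : 0 < c' by rewrite lt_min c0 invr_gt0 ltr0n.
exists (2 * (E * (1 + CA ^+ 2) / c' + CA * (1 + E * (E * (1 + CA ^+ 2) / c')))).
  have M0 : 0 <= E * (1 + CA ^+ 2) / c'.
    by rewrite !mulr_ge0 ?addr_ge0 ?sqr_ge0// invr_ge0 ltW.
  by rewrite mulr_gt0// ltr_wpDl// mulr_gt0// ltr_pwDl// mulr_ge0.
move=> T e Th G w P D; have S := ct_sys D.
have U0 : eball r (0 : 'rV[R]_2) by rewrite eball_nc xc0 ncR normr0.
have [hT eT EG lt1] := phase_real_identities S U0.
have W0 := nc_ge0 (w 0); have WC := hA _ _ _ _ _ _ D.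
have r20 : nc (xc (0 : 'rV[R]_2)) < r / 2 by rewrite xc0 ncR normr0 divr_gt0.
have eE := hE _ _ _ _ _ _ D.
apply: (hessian_inequality c'0 W0 WC (eE 0 r20) _ hT eT EG).
(* If [|e 0| * CA] is below 1/2, then so is [|zeta 0|], because [|w 0| <= CA]; otherwise [e] is
   bounded below near 0 and [zeta_center_gap] applies. *)
rewrite /c' ge_min; have [h|h] := leP 2^-1 (`|e 0| * CA); apply/orP.
  right; rewrite -[`|e 0|]ncR -ncM; apply: (hB _ _ _ _ _ _ D) => x xr.
  have xr2 : nc (xc x) < r / 2 by exact: lt_le_trans xr r1r.
  have el := hr1 _ _ _ _ _ _ D eE h x xr.
  have el0 : 0 < `|e x| by apply: lt_le_trans el; rewrite invr_gt0 mulr_gt0.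
  split; first by rewrite -normr_gt0.
    by apply: le_trans (eE x xr2) _; rewrite /Kb; move: CA0; clear; lra.
  apply: le_trans (_ : 4 * CA <= _); last by rewrite /Kb; move: E0; clear; lra.
  by rewrite -[4 * CA]invrK lef_pV2 ?posrE// invr_gt0 mulr_gt0.
left; have : `|e 0| * nc (w 0) <= `|e 0| * CA by rewrite ler_wpM2l.
by move: h; clear; lra.
Qed.

Lemma controlled_of_equation (R : realType) (r : R) (Th u l1 l2 : 'rV[R]_2 -> R) :
  0 < r -> C_class 2 (eball r) Th ->
  (forall x, eball r x -> - pi < Th x < pi) ->
  (forall x, eball r x -> Th x = 0 -> grad Th x = 0) ->
  smooth (eball r) u ->
  (forall x, eball r x ->
     char_poly (hessian u x) = ('X - (l1 x)%:P) * ('X - (l2 x)%:P)) ->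
  (forall x, eball r x -> atan (l1 x) + atan (l2 x) = Th x) ->
  (C1_norm (eball r) u < +oo)%E -> (C2_norm (eball r) Th < +oo)%E ->
  controlled (fine (C1_norm (eball r) u)) (fine (C2_norm (eball r) Th)) r
    (half_lap u) (tan_half Th) Th (hopf u) (hopf_ratio Th u) (grad_c u).
Proof.
move=> r0 cTh hpi crit cu hchar heq n1 n2.
have U0 : eball r (0 : 'rV[R]_2) by rewrite eball_nc xc0 ncR normr0.
apply: Controlled (phase_system_of_equation (@open_eball R 1 r) cTh cu hchar heq) _ _ _ hpi _ _.
- by move=> y Uy; exact (grad_le_C1 U0 n1 Uy).
- by move=> y Uy; rewrite nc_dz_grad; exact (grad_le_C2 U0 n2 Uy).
- by move=> y i j Uy; exact (pd2_le_C2 U0 i j n2 Uy).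
- by [].
- move=> y i Uy /(crit y Uy) /rowP /(_ (idx i)).
  by rewrite !mxE pdfE.
Qed.

Local Close Scope complex_scope.

Theorem theorem1p1 (R : realType) :
  exists C : R -> R -> R -> R,
    (forall a b r : R, 0 <= a -> 0 <= b -> 0 < r -> 0 < C a b r) /\
    forall (r : R) (Theta u lambda1 lambda2 : 'rV[R]_2 -> R),
      0 < r ->
      C_class 2 (eball r) Theta ->
      (forall x, eball r x -> - pi < Theta x < pi) ->
      (forall x, eball r x -> Theta x = 0 -> grad Theta x = 0) ->
      smooth (eball r) u ->
      (* lambda1 x and lambda2 x are the eigenvalues of the Hessian of u at x,
         counted with multiplicity *)
      (forall x, eball r x ->
         char_poly (hessian u x) =
           ('X - (lambda1 x)%:P) * ('X - (lambda2 x)%:P)) ->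
      (forall x, eball r x ->
         atan (lambda1 x) + atan (lambda2 x) = Theta x) ->
      (C1_norm (eball r) u < +oo)%E ->
      (C2_norm (eball r) Theta < +oo)%E ->
      enorm (hessian u 0) <=
        C (fine (C1_norm (eball r) u)) (fine (C2_norm (eball r) Theta)) r.
Proof.
(* The constant must depend on the three numbers only, so it is selected by choice over triples
   before any function is given; outside the admissible range it is 1, which keeps it positive. *)
have bound (p : R * R * R) : exists C, 0 < C /\ (0 <= p.1.1 -> 0 <= p.1.2 -> 0 < p.2 ->
    forall T e Th G w P, controlled p.1.1 p.1.2 p.2 T e Th G w P ->
      2 * (`|T 0| + nc (G 0)) <= C).
  have [[[a0 b0] r0]|n] := pselect ((0 <= p.1.1 /\ 0 <= p.1.2) /\ 0 < p.2).
    by have [C C0 hC] := hessian_bound a0 b0 r0; exists C.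
  by exists 1; split=> // a0 b0 r0; case: n.
have [F hF] := choice bound; exists (fun a b r => F (a, b, r)); split.
  by move=> a b r _ _ _; exact: (hF (a, b, r)).1.
move=> r Th u l1 l2 r0 cTh hpi crit cu hchar heq n1 n2.
have D := controlled_of_equation r0 cTh hpi crit cu hchar heq n1 n2.
have U0 : eball r (0 : 'rV[R]_2) by rewrite eball_nc xc0 ncR normr0.
apply: le_trans (enorm_hessian_le (@open_eball R 1 r) cu U0) _.
apply: ((hF (_, _, r)).2 _ _ r0 _ _ _ _ _ _ D) => /=.
  by apply: le_trans (ct_P D U0); exact: nc_ge0.
by apply: le_trans (ct_dTh D U0); exact: nc_ge0.
Qed.
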